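(* Let $\frac14<s_1<\frac34$ and $s_1<s_2<1$. Suppose that: (1) $f:\mathbb{R}^3\to\mathbb{R}$ is nontrivial, $f\in L^1(\mathbb{R}^3)$ and $(-\Delta)^{1-s_1}f\in L^2(\mathbb{R}^3)$; $\mathcal{K}:\mathbb{R}^3\to\mathbb{R}$, $\mathcal{K}\in L^1(\mathbb{R}^3)$, $(-\Delta)^{1-s_1}\mathcal{K}\in L^2(\mathbb{R}^3)$ and $Q:=\|(-\Delta)^{1-s_1}\mathcal{K}\|_{L^2(\mathbb{R}^3)}>0$. (2) $M>0$ and $g:\mathbb{R}\to\mathbb{R}$ satisfies $g(0)=0$, $g'(0)=0$, $g\in D_M$ (that is, $g\in C^2(I)$ with $\|g\|_{C^2(I)}\le M$), and $g$ does not vanish identically on the interval $I$. Then for every $\rho\in(0,1]$ the problem $$[(-\Delta)^{s_1}+(-\Delta)^{s_2}]u(x)=\varepsilon\int_{\mathbb{R}^3}\mathcal{K}(x-y)\,g(u_0(y)+v(y))\,dy \qquad (v\in B_\rho \text{ given},\ u \text{ unknown})$$ defines a map $t_g:B_\rho\to B_\rho$, $t_g v=u$, which is a strict contraction for all $$0<\varepsilon\le\frac{\rho}{H},$$ where $$H=2M\big(\|u_0\|_{H^2(\mathbb{R}^3)}+1\big)^2\left[\frac{3\,\|\mathcal{K}\|_{L^1(\mathbb{R}^3)}^2\big(\|u_0\|_{H^2(\mathbb{R}^3)}+1\big)^{\frac{8s_1}{3}-2}}{(3-4s_1)\,s_1^{\frac{4s_1}{3}}\,\pi^{\frac{8s_1}{3}}\,2^{4s_1+\frac{8s_1}{3}}}+\frac{Q^2}{4}\right]^{\frac12}.$$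 The unique fixed point $u_p$ of this map $t_g$ is the only solution in $B_\rho$ of the equation $$[(-\Delta)^{s_1}+(-\Delta)^{s_2}]u_p(x)=\varepsilon\int_{\mathbb{R}^3}\mathcal{K}(x-y)\,g(u_0(y)+u_p(y))\,dy .$$
   Context: Fractional powers $(-\Delta)^{s}$ on $\mathbb{R}^3$ are defined by the Fourier symbol $|p|^{2s}$, with $\widehat\phi(p)=(2\pi)^{-3/2}\int_{\mathbb{R}^3}\phi(x)e^{-ipx}dx$. Functions are real valued. For $0<s\le 1$, $H^{2s}(\mathbb{R}^3)=\{u:\mathbb{R}^3\to\mathbb{R}\mid u\in L^2(\mathbb{R}^3),\ (-\Delta)^{s}u\in L^2(\mathbb{R}^3)\}$ with norm $\|u\|_{H^{2s}(\mathbb{R}^3)}^2=\|u\|_{L^2(\mathbb{R}^3)}^2+\|(-\Delta)^{s}u\|_{L^2(\mathbb{R}^3)}^2$; in particular $\|u\|_{H^2(\mathbb{R}^3)}^2=\|u\|_{L^2(\mathbb{R}^3)}^2+\|\Delta u\|_{L^2(\mathbb{R}^3)}^2$. $c_e>0$ denotes the constant of the Sobolev embedding $\|u\|_{L^\infty(\mathbb{R}^3)}\le c_e\|u\|_{H^2(\mathbb{R}^3)}$. $u_0$ denotes the unique solution in $H^{2s_2}(\mathbb{R}^3)$ of the linear equation $[(-\Delta)^{s_1}+(-\Delta)^{s_2}]u_0=f$; under the hypotheses on $f$ it exists, is nontrivial and belongs to $H^2(\mathbb{R}^3)$. $B_\rho:=\{u\in H^2(\mathbb{R}^3)\mid \|u\|_{H^2(\mathbb{R}^3)}\le\rho\}$,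 $0<\rho\le1$, with the metric induced by the $H^2(\mathbb{R}^3)$ norm. $I:=\big[-c_e\|u_0\|_{H^2(\mathbb{R}^3)}-c_e,\ c_e\|u_0\|_{H^2(\mathbb{R}^3)}+c_e\big]$. $D_M:=\{g\in C^2(I)\mid \|g\|_{C^2(I)}\le M\}$, where $\|g\|_{C^2(I)}:=\|g\|_{C(I)}+\|g'\|_{C(I)}+\|g''\|_{C(I)}$ and $\|g\|_{C(I)}:=\max_{z\in I}|g(z)|$. The map $t_g$ sends $v\in B_\rho$ to the solution $u$ of the displayed problem. *)

(* Defs.v *)
From HB Require Import structures.
From mathcomp Require Import all_boot all_order all_algebra.
From mathcomp Require Import all_classical all_reals all_analysis.
From mathcomp Require Import complex.

Set Implicit Arguments.
Unset Strict Implicit.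
Unset Printing Implicit Defensive.

Import Order.TTheory GRing.Theory Num.Theory.
Import numFieldNormedType.Exports.

Local Open Scope classical_set_scope.
Local Open Scope ring_scope.

(* R^3 with its Borel sigma-algebra and Lebesgue measure.  These are notations
   so that the canonical structures of products are found. *)
Notation R3 R := (measurableTypeR R * measurableTypeR R * measurableTypeR R)%type.
Notation leb3 R := (((@lebesgue_measure R \x @lebesgue_measure R)
                       \x @lebesgue_measure R)%E).

Section FractionalLaplacian.
Context (R : realType).
Local Notation R3 := (R3 R).
Local Notation mu := (leb3 R).

Definition dot3 (p x : R3) : R :=
  p.1.1 * x.1.1 + p.1.2 * x.1.2 + p.2 * x.2.

(* Euclidean norm; the library norm on a product is the sup norm. *)
Definition norm3 (p : R3) : R := Num.sqrt (dot3 p p).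

(* (2 pi)^(-3/2) * \int_D f(x) exp(-i p.x) dx *)
Definition fourier_on (D : set R3) (f : R3 -> R) (p : R3) : R[i] :=
  (((2 * pi) `^ (- (3 / 2)))%:C *
   ((\int[mu]_(x in D) (f x * cos (dot3 p x))) -i*
    (\int[mu]_(x in D) (f x * sin (dot3 p x)))))%C.

(* [F] is a Fourier transform of [f]: given by the Fourier integral when [f] is
   in L^1; for [f] in L^2 (Plancherel), the L^2 limit of the Fourier integrals
   of the truncations of [f] to the balls of radius n. *)
Definition is_fourier (f : R3 -> R) (F : R3 -> R[i]) : Prop :=
  (f \in Lfun mu 1 /\ forall p, F p = fourier_on setT f p)
  \/
  [/\ f \in Lfun mu 2%:E,
      (fun p => complex.Re (F p)) \in Lfun mu 2%:E /\
        (fun p => complex.Im (F p)) \in Lfun mu 2%:E &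
      (fun n : nat => 'N[mu]_2%:E[(fun p : R3 =>
         (Normc.normc
            (F p - fourier_on [set x | norm3 x <= n%:R] f p))%:E)])%E
        @ \oo --> 0%E].

Definition is_fraclap (s : R) (u w : R3 -> R) : Prop :=
  w \in Lfun mu 2%:E /\
  exists U W : R3 -> R[i],
    [/\ is_fourier u U, is_fourier w W &
        \forall p \ae mu, W p = ((norm3 p `^ (2 * s))%:C * U p)%C].

(* (-Delta)^s u is a function in L^2 *)
Definition fraclap_in_L2 (s : R) (u : R3 -> R) : Prop :=
  exists w, is_fraclap s u w.

(* A representative of (-Delta)^s u, meaningful when [fraclap_in_L2 s u]; it is
   unique up to a null set. *)
Definition fraclap (s : R) (u : R3 -> R) : R3 -> R :=
  get [set w | is_fraclap s u w].

Definition L1norm (u : R3 -> R) : R := fine ('N[mu]_1[EFin \o u])%E.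

Definition L2norm (u : R3 -> R) : R := fine ('N[mu]_2%:E[EFin \o u])%E.

(* H^{2s}, so that H^2 is [H2s 1] *)
Definition H2s (s : R) (u : R3 -> R) : Prop :=
  u \in Lfun mu 2%:E /\ fraclap_in_L2 s u.

Definition H2s_norm (s : R) (u : R3 -> R) : R :=
  Num.sqrt (L2norm u ^+ 2 + L2norm (fraclap s u) ^+ 2).

Definition sobolev_constant (c : R) : Prop :=
  0 < c /\
  forall u : R3 -> R, H2s 1 u ->
    ('N[mu]_+oo[EFin \o u] <= (c * H2s_norm 1 u)%:E)%E.

Definition H2_ball (rho : R) (v : R3 -> R) : Prop :=
  H2s 1 v /\ H2s_norm 1 v <= rho.

Definition solves (s1 s2 : R) (h u : R3 -> R) : Prop :=
  H2s s2 u /\ (fun x => fraclap s1 u x + fraclap s2 u x) = h %[ae mu].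

Definition conv3 (K G : R3 -> R) (x : R3) : R :=
  \int[mu]_y (K (x - y) * G y).

End FractionalLaplacian.

Section C2.
Context (R : realType).
Implicit Types (I : set R) (g : R -> R).

(* Derivatives relative to I, hence one-sided at the endpoints of an interval *)
Definition derivable_within I g : Prop :=
  forall z, I z -> cvg ((fun y => (g y - g z) / (y - z)) @ within I z^').

Definition derive_within I g (z : R) : R :=
  lim ((fun y => (g y - g z) / (y - z)) @ within I z^').

Definition C2_on I g : Prop :=
  [/\ derivable_within I g,
      derivable_within I (derive_within I g) &
      {within I, continuous (derive_within I (derive_within I g))}].

Definition C_norm I g : R := sup [set `|g z| | z in I].

Definition C2_norm I g : R :=
  C_norm I g + C_norm I (derive_within I g)
  + C_norm I (derive_within I (derive_within I g)).

Definition D_M (M : R) I g : Prop := C2_on I g /\ C2_norm I g <= M.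

End C2.

Section FixedPointMap.
Context (R : realType).
Local Notation R3 := (R3 R).
Local Notation mu := (leb3 R).

Definition H_const (s1 M : R) (K u0 : R3 -> R) : R :=
  let N := H2s_norm 1 u0 + 1 in
  let Q := L2norm (fraclap (1 - s1) K) in
  2 * M * N ^+ 2 *
  Num.sqrt
    (3 * L1norm K ^+ 2 * N `^ (8 * s1 / 3 - 2)
     / ((3 - 4 * s1) * s1 `^ (4 * s1 / 3) * pi `^ (8 * s1 / 3)
        * 2 `^ (4 * s1 + 8 * s1 / 3))
     + Q ^+ 2 / 4).

Definition rhs (eps : R) (K : R3 -> R) (g : R -> R) (u0 v : R3 -> R) : R3 -> R :=
  fun x => eps * conv3 K (fun y => g (u0 y + v y)) x.

(* Elements of H^2 are functions up to a.e. equality; [T] acts on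
   representatives. *)
Definition is_solution_map (s1 s2 eps rho : R) (K : R3 -> R) (g : R -> R)
    (u0 : R3 -> R) (T : (R3 -> R) -> (R3 -> R)) : Prop :=
  forall v, H2_ball rho v ->
    [/\ H2_ball rho (T v),
        solves s1 s2 (rhs eps K g u0 v) (T v) &
        forall u, solves s1 s2 (rhs eps K g u0 v) u -> u = T v %[ae mu]].

Definition strict_contraction_on (B : set (R3 -> R))
    (T : (R3 -> R) -> (R3 -> R)) : Prop :=
  exists2 q : R, 0 <= q < 1 &
    forall v1 v2, B v1 -> B v2 ->
      H2s_norm 1 (fun x => T v1 x - T v2 x)
      <= q * H2s_norm 1 (fun x => v1 x - v2 x).

End FixedPointMap.

(* Main.v *)
(* For real functions the Fourier transform carries the same information as the
   Hartley transform [HT], whose kernel is cos(p.x) + sin(p.x): if E and O are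
   the even and odd parts of [HT f], the Fourier transform of f is E - iO.  [HT]
   is a symmetric involutive isometry of L^2, so everything stays real, and
   (-Delta)^s is multiplication by |p|^(2s) on the Hartley side.

   On L^1 and L^2 the contraction property of [HT] comes from inserting the
   weight exp(-e(|p1| + |p2| + |p3|)), whose transform is a product of Poisson
   kernels, and letting e tend to 0.  A symmetric contraction squares to the
   identity on the vectors whose norm it preserves; boxes are such vectors, and
   they are total.

   The solution of the problem with right-hand side h has Hartley transform
   [T0 h / (|p|^(2 s1) + |p|^(2 s2))].  For h = K * G the convolution theorem
   bounds its H^2 norm: the |p|^4 part by Q and the L^1 norm of G, the other part
   by splitting frequencies at a radius r, using the L^1 norm of G below r (where
   |p|^(-4 s1) is integrable because s1 < 3/4) and its L^2 norm above.  The best r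
   gives the constant H.  With M bounding |g|, |g'|, |g''| on I and g(0) = g'(0) = 0,
   |g a - g b| is at most M |a - b| and M/2 (|a| + |b|) |a - b|, which bounds the
   two norms of G.  Hence the map has Lipschitz constant rho / (|u0| + 1) < 1. *)
From HB Require Import structures.
From mathcomp Require Import all_boot all_order all_algebra.
From mathcomp Require Import all_classical all_reals all_analysis.
From mathcomp Require Import measurable_realfun ess_sup_inf complex.
From mathcomp Require Import ring lra.
Require Import Defs.

Set Implicit Arguments.
Unset Strict Implicit.
Unset Printing Implicit Defensive.

Import Order.TTheory GRing.Theory Num.Theory.
Import numFieldNormedType.Exports.

Local Open Scope classical_set_scope.
Local Open Scope ring_scope.

(** * L^2 of a measure *)

(** Objects obtained through [get] or as L^2 limits are determined only up to null sets. Statements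
    are therefore carried to the Hartley side as a.e. identities, where the H^2 norm is the L^2 norm
    of [h2w p * HT u p]; linearity, completeness and uniqueness in H^2 are inherited from L^2.

    The exponential weight is convenient because its cosine transform and the total mass of that
    transform both come from elementary primitives.

    [g] is controlled only on [I]; outside it may even fail to be measurable. The Sobolev bound puts
    u0 + v in [I] almost everywhere, so values outside [I] can be replaced without changing the
    convolution.

    Write N = |u0| + 1, k for the L^1 norm of K, and let M N d and M d bound the L^1 and L^2 norms
    of G. The frequency splitting then produces M^2 d^2 k^2 (N^2 r^(3 - 4 s1) / (2 pi^2 (3 - 4 s1))
    + r^(-4 s1)), and setting the derivative in r to zero gives r^3 = 8 pi^2 s1 / N^2. *)

Section L2.
Context d (T : measurableType d) (R : realType).
Variable mu : {measure set T -> \bar R}.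
Implicit Types (f g h : T -> R).

Local Notation intg f := (mu.-integrable setT (EFin \o f)).

(** An unbundled form of [Lfun mu 2%:E], equivalent by [Lfun2P]; functions stay plain maps and
    equality almost everywhere is tracked by hand. *)
Definition L2 f := measurable_fun setT f /\ intg (fun x => f x ^+ 2).

Definition ip f g : R := \int[mu]_x (f x * g x).

Definition n2 f : R := Num.sqrt (ip f f).

Lemma integrable_meas f : intg f -> measurable_fun setT f.
Proof. by move/measurable_int/measurable_EFinP. Qed.

Lemma le_intg f g : measurable_fun setT f -> (forall x, `|f x| <= g x) ->
  intg g -> intg f.
Proof.
move=> mf fg ig; apply: le_integrable ig => //; first exact/measurable_EFinP.
by move=> x _ /=; rewrite lee_fin (le_trans (fg x))// ler_norm.
Qed.

Lemma intgD f g : intg f -> intg g -> intg (fun x => f x + g x).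
Proof. by move=> i j; apply: (integrableD measurableT i j). Qed.

Lemma intgB f g : intg f -> intg g -> intg (fun x => f x - g x).
Proof. by move=> i j; apply: (integrableB measurableT i j). Qed.

Lemma intgZ c f : intg f -> intg (fun x => c * f x).
Proof. by move=> i; apply: (@integrableZl _ _ _ mu _ measurableT c _ i). Qed.

Lemma Lfun2P f : f \in Lfun mu 2%:E <-> L2 f.
Proof.
split=> [fL|[mf f2]].
  split; last exact: Lfun2_integrable_sqr.
  by move: fL; rewrite inE => /andP[/[!inE]/= mf _].
rewrite inE; apply/andP; split; rewrite inE//= /finite_norm unlock.
rewrite poweR_lty//.
move/integrableP: f2 => [_]; apply: le_lt_trans.
by under [leLHS]eq_integral do rewrite /= powR_mulrn// -normrX.
Qed.

Lemma L2_mul f g : L2 f -> L2 g -> intg (fun x => f x * g x).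
Proof.
move=> [mf f2] [mg g2]; apply: (le_intg _ _ (intgD f2 g2)).
  exact: measurable_funM.
move=> x; rewrite normrM -(real_normK (num_real (f x))).
rewrite -(real_normK (num_real (g x))).
have := sqr_ge0 (`|f x| - `|g x|); have := normr_ge0 (f x).
have := normr_ge0 (g x); nra.
Qed.

Lemma L2D f g : L2 f -> L2 g -> L2 (fun x => f x + g x).
Proof.
move=> Lf Lg; have [mf f2] := Lf; have [mg g2] := Lg.
split; first exact: measurable_funD.
have := intgD (intgD f2 (intgZ 2 (L2_mul Lf Lg))) g2.
apply: eq_integrable => // x _ /=; congr EFin; ring.
Qed.

Lemma L2Z c f : L2 f -> L2 (fun x => c * f x).
Proof.
move=> [mf f2]; split; first exact: measurable_funM.
have := intgZ (c ^+ 2) f2.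
by apply: eq_integrable => // x _ /=; congr EFin; ring.
Qed.

Lemma L2N f : L2 f -> L2 (fun x => - f x).
Proof.
move=> /(L2Z (-1)); congr L2; apply/funext => x /=; ring.
Qed.

Lemma L2B f g : L2 f -> L2 g -> L2 (fun x => f x - g x).
Proof. by move=> Lf /L2N; exact: L2D. Qed.

Lemma L20 : L2 (fun=> 0).
Proof.
split; first exact: measurable_cst.
have := @integrable0 _ _ _ mu setT.
by apply: eq_integrable => // x _; rewrite /= expr0n.
Qed.

Lemma L2_le f g : measurable_fun setT f -> (forall x, `|f x| <= `|g x|) ->
  L2 g -> L2 f.
Proof.
move=> mf fg [mg g2]; split => //; apply: (le_intg _ _ g2).
  exact: measurable_funX.
by move=> x; rewrite normrX -(real_normK (num_real (g x))) lerXn2r ?nnegrE.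
Qed.

Lemma L2_ae f g : measurable_fun setT g -> f = g %[ae mu] -> L2 f -> L2 g.
Proof.
move=> mg fg [mf f2]; split => //.
have mg2 : measurable_fun setT (EFin \o (fun x => g x ^+ 2)).
  by apply/measurable_EFinP; exact: measurable_funX.
apply/integrableP; split => //.
have /integrableP[_] := f2; apply: le_lt_trans.
rewrite le_eqVlt; apply/orP; left; apply/eqP.
apply: ge0_ae_eq_integral => //; try exact: measurableT_comp.
  by apply: measurableT_comp => //; apply/measurable_EFinP; exact: measurable_funX.
by apply: filterS fg => x /(_ I) /= ->.
Qed.

Lemma RintD f g : intg f -> intg g ->
  \int[mu]_x (f x + g x) = \int[mu]_x f x + \int[mu]_x g x.
Proof. by move=> i j; rewrite RintegralD. Qed.

Lemma RintB f g : intg f -> intg g ->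
  \int[mu]_x (f x - g x) = \int[mu]_x f x - \int[mu]_x g x.
Proof. by move=> i j; rewrite RintegralB. Qed.

Lemma RintZ c f : intg f -> \int[mu]_x (c * f x) = c * \int[mu]_x f x.
Proof. by move=> i; rewrite RintegralZl. Qed.

Lemma eq_Rint f g : (forall x, f x = g x) -> \int[mu]_x f x = \int[mu]_x g x.
Proof. by move=> fg; apply: eq_Rintegral. Qed.

Lemma ae_eq_Rint f g : measurable_fun setT f -> measurable_fun setT g ->
  f = g %[ae mu] -> \int[mu]_x f x = \int[mu]_x g x.
Proof.
move=> mf mg fg; rewrite /Rintegral; congr fine; apply: ae_eq_integral => //.
- exact/measurable_EFinP.
- exact/measurable_EFinP.
- by apply: filterS fg => x /(_ I) /= ->.
Qed.

Lemma Rint_EFin f : intg f -> (\int[mu]_x f x)%:E = (\int[mu]_x (f x)%:E)%E.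
Proof.
by move=> i; rewrite /Rintegral fineK// (integrable_fin_num measurableT i).
Qed.

Lemma ipC f g : ip f g = ip g f.
Proof. by apply: eq_Rint => x; rewrite mulrC. Qed.

Lemma ipDl f g h : L2 f -> L2 g -> L2 h ->
  ip (fun x => f x + g x) h = ip f h + ip g h.
Proof.
move=> Lf Lg Lh; rewrite /ip -RintD; [|exact: L2_mul..].
by apply: eq_Rint => x; rewrite mulrDl.
Qed.

Lemma ipZl c f g : L2 f -> L2 g -> ip (fun x => c * f x) g = c * ip f g.
Proof.
move=> Lf Lg; rewrite /ip -RintZ; last exact: L2_mul.
by apply: eq_Rint => x; rewrite mulrA.
Qed.

Lemma ipBl f g h : L2 f -> L2 g -> L2 h ->
  ip (fun x => f x - g x) h = ip f h - ip g h.
Proof.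
move=> Lf Lg Lh; rewrite /ip -RintB; [|exact: L2_mul..].
by apply: eq_Rint => x; rewrite mulrBl.
Qed.

Lemma ipBr f g h : L2 f -> L2 g -> L2 h ->
  ip h (fun x => f x - g x) = ip h f - ip h g.
Proof. by move=> Lf Lg Lh; rewrite ipC ipBl// !(ipC h). Qed.

Lemma ip_ge0 f : 0 <= ip f f.
Proof. by apply: Rintegral_ge0 => x _; rewrite -expr2 sqr_ge0. Qed.

Lemma ip_quad f g t : L2 f -> L2 g ->
  ip (fun x => f x + t * g x) (fun x => f x + t * g x) =
  ip f f + 2 * t * ip f g + t ^+ 2 * ip g g.
Proof.
move=> Lf Lg; have Ltg := L2Z t Lg.
rewrite ipDl ?(ipC _ (fun x => f x + _))//; [|exact: L2D..].
rewrite !ipDl ?ipZl// ?[ip _ (fun x => t * g x)]ipC ?ipZl// ?(ipC g f).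
ring.
Qed.

Lemma discr_le (a b c : R) : 0 <= a -> 0 <= c ->
  (forall t, 0 <= a + 2 * t * b + t ^+ 2 * c) -> b ^+ 2 <= a * c.
Proof.
move=> a0 c0 H; have [c00|cn0] := eqVneq c 0.
  have [->|bn0] := eqVneq b 0; first by rewrite expr0n mulr_ge0.
  (* This [t] makes the affine function [a + 2 * t * b] equal to -1. *)
  have := H (- (a + 1) / (2 * b)); rewrite c00 mulr0 addr0.
  suff -> : 2 * (- (a + 1) / (2 * b)) * b = - (a + 1) by lra.
  by field.
have cp : 0 < c by rewrite lt_neqAle eq_sym cn0.
(* The minimiser of the quadratic. *)
have := H (- b / c).
have -> : a + 2 * (- b / c) * b + (- b / c) ^+ 2 * c = (a * c - b ^+ 2) / c.
  by field.
by rewrite pmulr_lge0 ?invr_gt0// subr_ge0.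
Qed.

Lemma CS f g : L2 f -> L2 g -> ip f g ^+ 2 <= ip f f * ip g g.
Proof.
move=> Lf Lg; apply: discr_le; [exact: ip_ge0..|].
by move=> t; rewrite -ip_quad// ip_ge0.
Qed.

Lemma n2_ge0 f : 0 <= n2 f. Proof. exact: sqrtr_ge0. Qed.

Lemma n2E f : n2 f ^+ 2 = ip f f.
Proof. by rewrite sqr_sqrtr ?ip_ge0. Qed.

Lemma CSn f g : L2 f -> L2 g -> `|ip f g| <= n2 f * n2 g.
Proof.
move=> Lf Lg; rewrite -(@ler_pXn2r _ 2)// ?nnegrE ?mulr_ge0 ?n2_ge0//.
by rewrite exprMn !n2E real_normK ?num_real// CS.
Qed.

Lemma n2D f g : L2 f -> L2 g -> n2 (fun x => f x + g x) <= n2 f + n2 g.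
Proof.
move=> Lf Lg; rewrite -(@ler_pXn2r _ 2)// ?nnegrE ?addr_ge0 ?n2_ge0//.
rewrite sqrrD !n2E; have := ip_quad 1 Lf Lg.
under eq_fun do rewrite mul1r; move=> ->.
have := CSn Lf Lg; have := ler_norm (ip f g); rewrite expr1n; lra.
Qed.

Lemma n2Z c f : L2 f -> n2 (fun x => c * f x) = `|c| * n2 f.
Proof.
move=> Lf; rewrite /n2 ipZl//; last exact: L2Z.
rewrite (ipC f) ipZl//.
by rewrite mulrA -expr2 sqrtrM ?sqr_ge0// sqrtr_sqr.
Qed.

Lemma n2N f : L2 f -> n2 (fun x => - f x) = n2 f.
Proof.
by move=> Lf; rewrite /n2 /ip; congr Num.sqrt; apply: eq_Rint => x; rewrite mulrNN.
Qed.

Lemma n2BC f g : n2 (fun x => f x - g x) = n2 (fun x => g x - f x).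
Proof. by congr Num.sqrt; apply: eq_Rint => x; ring. Qed.

Lemma n2_tri f g h : L2 f -> L2 g -> L2 h ->
  n2 (fun x => f x - h x) <= n2 (fun x => f x - g x) + n2 (fun x => g x - h x).
Proof.
move=> Lf Lg Lh; rewrite (_ : (fun x => f x - h x) =
  (fun x => (f x - g x) + (g x - h x))); first by apply: n2D; exact: L2B.
by apply/funext => x; ring.
Qed.

Lemma n2_eq0 f : L2 f -> n2 f = 0 -> f = (fun=> 0) %[ae mu].
Proof.
move=> Lf /eqP; rewrite sqrtr_eq0 => f0.
have f00 : ip f f = 0 by apply/eqP; rewrite eq_le f0 ip_ge0.
have [mf f2] := Lf.
have : (\int[mu]_(x in setT) `|(EFin \o (fun x => f x ^+ 2)%R) x| = 0)%E.
  under eq_integral do rewrite /= ger0_norm ?sqr_ge0//.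
  rewrite -(Rint_EFin f2); congr EFin; rewrite -f00; apply: eq_Rint => x.
  by rewrite expr2.
move/ae_eq_integral_abs => /(_ measurableT).
move/(_ (measurable_int _ f2)) => H.
apply: filterS H => x /(_ I) /= [/eqP].
by rewrite sqrf_eq0 => /eqP.
Qed.

Lemma n2_ae0 f g : L2 f -> L2 g -> n2 (fun x => f x - g x) = 0 -> f = g %[ae mu].
Proof.
move=> Lf Lg /(n2_eq0 (L2B Lf Lg)); apply: filterS => x /(_ I) /= /eqP.
by rewrite subr_eq0 => /eqP.
Qed.

Lemma ae_n2 f g : L2 f -> L2 g -> f = g %[ae mu] -> n2 f = n2 g.
Proof.
move=> Lf Lg fg; rewrite /n2 /ip; congr Num.sqrt; apply: ae_eq_Rint.
- by apply: measurable_funM; case: Lf.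
- by apply: measurable_funM; case: Lg.
- by apply: filterS fg => x /(_ I) /= ->.
Qed.

Lemma n2_0 : n2 (fun=> 0) = 0.
Proof.
rewrite /n2 /ip (_ : \int[mu]__ _ = 0) ?sqrtr0//.
by rewrite /Rintegral; under eq_integral do rewrite mul0r; rewrite integral0.
Qed.

Definition cauchyL2 (u : nat -> T -> R) :=
  forall e, 0 < e -> exists N, forall m n, (N <= m)%N -> (N <= n)%N ->
    n2 (fun x => u m x - u n x) <= e.

Definition cvgL2 (u : nat -> T -> R) f :=
  forall e, 0 < e -> exists N, forall n, (N <= n)%N ->
    n2 (fun x => u n x - f x) <= e.

Lemma n2_eint f : L2 f -> (\int[mu]_x (f x ^+ 2)%:E = (n2 f ^+ 2)%:E)%E.
Proof.
by move=> [mf f2]; rewrite -Rint_EFin// n2E; congr EFin; exact: eq_Rint.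
Qed.

Lemma subseq_geo u : cauchyL2 u -> exists k : nat -> nat,
  (forall i, (i <= k i)%N) /\
  forall i m n, (k i <= m)%N -> (k i <= n)%N ->
    n2 (fun x => u m x - u n x) <= (1 / 8) ^+ i.
Proof.
move=> uC.
have H i : exists N, forall m n, (N <= m)%N -> (N <= n)%N ->
    n2 (fun x => u m x - u n x) <= (1 / 8) ^+ i.
  by apply: uC; apply: exprn_gt0; lra.
have [N HN] := choice H.
exists (fun i => maxn i (N i)); split=> [i|i m n]; first exact: leq_maxl.
by rewrite !geq_max => /andP[_ h1] /andP[_ h2]; exact: HN.
Qed.

(** The squared gaps weighted by [4 ^+ i] have integrals at most (4 / 64)^i, so their sum is finite
    almost everywhere. Where it is finite, the gaps are bounded by a multiple of (1/2)^i and the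
    telescoping series converges. *)
Lemma ae_cvg_geo (v : nat -> T -> R) : (forall i, L2 (v i)) ->
  (forall i, n2 (fun x => v i.+1 x - v i x) <= (1 / 8) ^+ i) ->
  \forall x \ae mu, cvgn (fun i => v i x).
Proof.
move=> Lv vg.
pose D i x := ((4 ^+ i) * (v i.+1 x - v i x) ^+ 2)%:E : \bar R.
have LB i : L2 (fun x => v i.+1 x - v i x) by apply: L2B.
have mD i : measurable_fun setT (D i).
  apply/measurable_EFinP; apply: measurable_funM => //.
  by apply: measurable_funX; case: (LB i).
have D0 i x : (0 <= D i x)%E.
  by rewrite lee_fin mulr_ge0 ?sqr_ge0// exprn_ge0.
have intD i : (\int[mu]_x D i x <= ((1 / 16) ^+ i)%:E)%E.
  rewrite /D; under eq_integral do rewrite EFinM.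
  rewrite ge0_integralZl_EFin ?exprn_ge0//; last 2 first.
    by move=> x _; rewrite lee_fin sqr_ge0.
    by apply/measurable_EFinP; apply: measurable_funX; case: (LB i).
  rewrite (n2_eint (LB i)) -EFinM lee_fin.
  apply: (@le_trans _ _ (4 ^+ i * ((1 / 8) ^+ i) ^+ 2)).
    by rewrite ler_pM2l ?exprn_gt0// lerXn2r ?nnegrE ?n2_ge0 ?exprn_ge0//; lra.
  rewrite -exprM mulnC exprM -exprMn le_eqVlt; apply/orP; left; apply/eqP.
  by congr (_ ^+ i); field.
have intS : (\int[mu]_x (\sum_(i <oo) D i x) < +oo)%E.
  rewrite integral_nneseries//.
  apply: (@le_lt_trans _ _ (\sum_(i <oo) ((1 / 16) ^+ i)%:E)%E).
    apply: lee_nneseries => i; last by move=> _; exact: intD.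
    by move=> *; apply: integral_ge0.
  rewrite (_ : (fun n => \sum_(0 <= i < n) ((1 / 16) ^+ i)%:E)%E =
    (fun n => (series (geometric 1 (1 / 16)) n)%:E)); last first.
    apply/funext => n; rewrite /series /= sumEFin; congr EFin.
    by under [RHS]eq_bigr do rewrite mul1r.
  rewrite EFin_lim; last by apply: is_cvg_geometric_series; rewrite ger0_norm; lra.
  exact: ltry.
have : mu.-integrable setT (fun x => (\sum_(i <oo) D i x)%E).
  apply/integrableP; split.
    by apply: ge0_emeasurable_sum => // i x _ _; exact: D0.
  apply: le_lt_trans intS; apply: ge0_le_integral => //.
  - apply: measurableT_comp => //.
    by apply: ge0_emeasurable_sum => // i x _ _; exact: D0.
  - by apply: ge0_emeasurable_sum => // i x _ _; exact: D0.
  - by move=> x _; rewrite gee0_abs// nneseries_ge0.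
move=> /(integrable_ae measurableT); apply: filterS => x /(_ I) Sfin.
have [C HC] : exists C : R, forall i, 4 ^+ i * (v i.+1 x - v i x) ^+ 2 <= C.
  exists (fine (\sum_(i <oo) D i x)%E) => i.
  rewrite -lee_fin fineK//; apply: le_trans (nneseries_lim_ge i.+1 _) => //.
  by rewrite big_nat_recr//= leeDr// sume_ge0.
have Hd i : `|v i.+1 x - v i x| <= Num.sqrt C * (1 / 2) ^+ i.
  have C0 : 0 <= C.
    by apply: le_trans (HC 0%N); rewrite mulr_ge0 ?sqr_ge0// exprn_ge0.
  have h0 : 0 <= 1 / 2 :> R by lra.
  rewrite -(@ler_pXn2r _ 2)// ?nnegrE ?mulr_ge0 ?sqrtr_ge0 ?exprn_ge0//.
  rewrite exprMn sqr_sqrtr// real_normK ?num_real//.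
  have -> : ((1 / 2) ^+ i) ^+ 2 = (4 ^+ i)^-1 :> R.
    by rewrite -exprM mulnC exprM -exprVn; congr (_ ^+ _); field.
  by rewrite ler_pdivlMr ?exprn_gt0// mulrC.
have cs : cvgn (series (fun i => v i.+1 x - v i x)).
  apply: normed_cvg.
  apply: (@series_le_cvg _ _ (geometric (Num.sqrt C) (1 / 2))) => //.
  - by move=> n /=.
  - by move=> n; rewrite /geometric /= mulr_ge0 ?sqrtr_ge0 ?exprn_ge0//; lra.
  - by apply: is_cvg_geometric_series; rewrite ger0_norm; lra.
have -> : (fun i => v i x) =
    (fun n => v 0%N x + series (fun i => v i.+1 x - v i x) n).
  by apply/funext => n; rewrite /series /= telescope_sumr//; ring.
by apply: is_cvgD => //; exact: is_cvg_cst.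
Qed.

Lemma fatou_le (g_ : nat -> T -> R) (g : T -> R) (c : \bar R) :
  (forall n, measurable_fun setT (g_ n)) -> measurable_fun setT g ->
  (forall n x, 0 <= g_ n x) -> (forall x, 0 <= g x) ->
  (\forall x \ae mu, g_ n x @[n --> \oo] --> g x) ->
  (forall n, (\int[mu]_x (g_ n x)%:E <= c)%E) -> (\int[mu]_x (g x)%:E <= c)%E.
Proof.
move=> mg_ mg g_0 g0 cv le_c.
have mE n : measurable_fun setT (fun x => (g_ n x)%:E).
  exact/measurable_EFinP.
(* Fatou's lemma concerns the lower limit, which agrees with [g] only almost everywhere. *)
have -> : (\int[mu]_x (g x)%:E =
   \int[mu]_x limn_einf (fun i => (g_ i x)%:E))%E.
  apply: ge0_ae_eq_integral => //.
  - exact/measurable_EFinP.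
  - under eq_fun do rewrite -[limn_einf _]oppeK -limn_esupN.
    apply: measurableT_comp => //; apply: measurable_fun_limn_esup => n.
    exact: measurableT_comp.
  - by move=> x _; rewrite lee_fin.
  - move=> x _; rewrite limn_einf_lim; apply: lime_ge; first exact: is_cvg_einfs.
    by apply: nearW => n; apply: le_ereal_inf_tmp => _ [i _ <-]; rewrite lee_fin.
  - apply: filterS cv => x cv _.
    have H : (g_ n x)%:E @[n --> \oo] --> (g x)%:E by apply: cvg_EFin => //; exact: nearW.
    rewrite is_cvg_limn_einfE; first by apply/esym/cvg_lim.
    by apply/cvg_ex; exists (g x)%:E.
apply: le_trans (fatou _ _ _ _) _ => //.
  by move=> i x _; rewrite lee_fin.
rewrite limn_einf_lim; apply: lime_le; first exact: is_cvg_einfs.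
apply: nearW => n; apply: le_trans (le_c n).
by apply: ereal_inf_lbound; exists n => //=.
Qed.

Lemma L2_of_eint f (c : R) : measurable_fun setT f ->
  (\int[mu]_x (f x ^+ 2)%:E <= (c ^+ 2)%:E)%E -> 0 <= c -> L2 f /\ n2 f <= c.
Proof.
move=> mf le_c c0.
have Lf : L2 f.
  split => //; apply/integrableP; split.
    by apply/measurable_EFinP; apply: measurable_funX.
  apply: le_lt_trans (ltry (c ^+ 2)); apply: le_trans le_c.
  by under eq_integral do rewrite /= ger0_norm ?sqr_ge0//.
split => //; move: le_c; rewrite n2_eint// lee_fin.
by rewrite ler_pXn2r ?nnegrE ?n2_ge0.
Qed.

(* Riesz-Fischer: a subsequence with geometric gaps converges a.e., and Fatou's
   lemma controls the distance to its limit. *)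
Lemma complete_L2 u : (forall n, L2 (u n)) -> cauchyL2 u ->
  exists2 f, L2 f & cvgL2 u f.
Proof.
move=> Lu uC; have [k [ki Hk]] := subseq_geo uC.
(* The running maximum makes both [K i] and [K i.+1] at least [k i], so consecutive terms of [v]
   have geometric gaps. *)
pose K i := \max_(j < i.+1) k j.
have kK i j : (i <= j)%N -> (k i <= K j)%N.
  move=> ij; exact: (@leq_bigmax _ (fun j : 'I__ => k j) (Ordinal (ij : (i < j.+1)%N))).
pose v i := u (K i).
have Lv i : L2 (v i) by exact: Lu.
have vg i : n2 (fun x => v i.+1 x - v i x) <= (1 / 8) ^+ i.
  by apply: Hk; apply: kK.
have aev := ae_cvg_geo Lv vg.
(* An upper limit is measurable everywhere and equals the limit wherever that exists; [fine] gives
   the value 0 where it is infinite. *)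
pose F x := limn_esup (fun i => (v i x)%:E).
pose f x := fine (F x).
have mF : measurable_fun setT F.
  apply: measurable_fun_limn_esup => i.
  by apply/measurable_EFinP; case: (Lv i).
have mf : measurable_fun setT f.
  exact: measurableT_comp mF.
have fE : \forall x \ae mu, v i x @[i --> \oo] --> f x.
  apply: filterS aev => x cv.
  have H : (v i x)%:E @[i --> \oo] --> (limn (fun i => v i x))%:E.
    by apply: cvg_EFin => //; exact: nearW.
  rewrite /f /F is_cvg_limn_esupE; last by apply/cvg_ex; eexists; exact: H.
  by move/(cvg_lim (@ereal_hausdorff _)) : H => ->.
have fat m (e : R) : 0 <= e ->
    (exists N, forall i, (N <= i)%N -> n2 (fun x => v i x - u m x) <= e) ->
    L2 (fun x => f x - u m x) /\ n2 (fun x => f x - u m x) <= e.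
  move=> e0 [N HN].
  have mu_ : measurable_fun setT (u m) by case: (Lu m).
  have LB i : L2 (fun x => v i x - u m x) by apply: L2B.
  apply: L2_of_eint => //; first exact: measurable_funB.
  apply: (@fatou_le (fun i x => (v (i + N)%N x - u m x) ^+ 2)).
  - by move=> n; apply: measurable_funX; case: (LB (n + N)%N).
  - by apply: measurable_funX; exact: measurable_funB.
  - by move=> n x; exact: sqr_ge0.
  - by move=> x; exact: sqr_ge0.
  - apply: filterS fE => x cv; rewrite (cvg_shiftn N (fun i => (v i x - u m x) ^+ 2)).
    have H : v i x - u m x @[i --> \oo] --> f x - u m x.
      by apply: cvgB; [exact: cv|exact: cvg_cst].
    by rewrite expr2; under eq_fun do rewrite expr2; exact: cvgM.
  - move=> n; rewrite n2_eint// lee_fin ler_pXn2r ?nnegrE ?n2_ge0//.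
    by apply: HN; rewrite leq_addl.
have main e : 0 < e -> exists N, forall m, (N <= m)%N ->
    L2 (fun x => f x - u m x) /\ n2 (fun x => f x - u m x) <= e.
  move=> e0; have [N HN] := uC _ e0; exists N => m Nm; apply: fat; first exact: ltW.
  exists N => i Ni; apply: HN => //; apply: leq_trans Ni _.
  by apply: leq_trans (ki i) _; exact: kK.
exists f.
  have [N /(_ N (leqnn N))[LB _]] := main 1 ltr01.
  have -> : f = (fun x => (f x - u N x) + u N x) by apply/funext => x; ring.
  exact: L2D.
move=> e e0; have [N HN] := main e e0; exists N => n Nn.
by rewrite n2BC; case: (HN n Nn).
Qed.

Lemma cvgL2_cauchy u f : (forall n, L2 (u n)) -> L2 f -> cvgL2 u f -> cauchyL2 u.
Proof.
move=> Lu Lf uf e e0; have [N HN] := uf _ (divr_gt0 e0 (ltr0Sn R 1)); exists N => m n Nm Nn.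
apply: le_trans (n2_tri (Lu m) Lf (Lu n)) _.
rewrite (n2BC f); apply: le_trans (lerD (HN m Nm) (HN n Nn)) _.
by move: (e) => ?; lra.
Qed.

Lemma cvgL2_unique u f g : (forall n, L2 (u n)) -> L2 f -> L2 g ->
  cvgL2 u f -> cvgL2 u g -> f = g %[ae mu].
Proof.
move=> Lu Lf Lg uf ug; apply: n2_ae0 => //.
apply/eqP; rewrite eq_le n2_ge0 andbT; apply/ler_addgt0Pr; rewrite ?add0r => e e0.
have [N HN] := uf _ (divr_gt0 e0 (ltr0Sn R 1)); have [N' HN'] := ug _ (divr_gt0 e0 (ltr0Sn R 1)).
pose n := maxn N N'.
apply: le_trans (n2_tri Lf (Lu n) Lg) _.
rewrite (n2BC f); apply: le_trans (lerD (HN n _) (HN' n _)) _; rewrite ?leq_maxl ?leq_maxr//.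
by move: (e) => ?; lra.
Qed.

Lemma n2_dist f g : L2 f -> L2 g -> `|n2 f - n2 g| <= n2 (fun x => f x - g x).
Proof.
move=> Lf Lg; have H u v : L2 u -> L2 v -> n2 u - n2 v <= n2 (fun x => u x - v x).
  move=> Lu Lv; rewrite lerBlDr; apply: le_trans (n2D (L2B Lu Lv) Lv).
  by rewrite le_eqVlt; apply/orP; left; apply/eqP; congr n2; apply/funext => x; ring.
by rewrite ler_norml H// andbT lerNl opprB n2BC H.
Qed.

Lemma cvgL2_n2 u f : (forall n, L2 (u n)) -> L2 f -> cvgL2 u f ->
  n2 (u n) @[n --> \oo] --> n2 f.
Proof.
move=> Lu Lf uf; apply/cvgrPdist_le => e e0.
have [N HN] := uf _ e0; exists N => // n /= Nn; apply: le_trans (HN n Nn).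
by rewrite n2BC; apply: n2_dist.
Qed.

Lemma cvgL2_ip u f g : (forall n, L2 (u n)) -> L2 f -> L2 g -> cvgL2 u f ->
  ip (u n) g @[n --> \oo] --> ip f g.
Proof.
move=> Lu Lf Lg uf; apply/cvgrPdist_le => e e0.
have e1 : 0 < e / (n2 g + 1) by rewrite divr_gt0// ltr_wpDl// n2_ge0.
have [N HN] := uf _ e1; exists N => // n /= Nn.
rewrite distrC -ipBl//; apply: le_trans (CSn _ Lg) _; first exact: L2B.
apply: le_trans (ler_wpM2r (n2_ge0 _) (HN n Nn)) _.
rewrite mulrAC ler_pdivrMr ?ltr_wpDl ?n2_ge0//.
by rewrite ler_pM2l// lerDl.
Qed.

Lemma DCT (f_ : nat -> T -> R) f g :
  (forall n, measurable_fun setT (f_ n)) -> measurable_fun setT f ->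
  (\forall x \ae mu, f_ n x @[n --> \oo] --> f x) ->
  intg g -> (forall n x, `|f_ n x| <= g x) ->
  \int[mu]_x f_ n x @[n --> \oo] --> \int[mu]_x f x.
Proof.
move=> mf_ mf cv ig fg.
have [] := @dominated_convergence _ _ _ mu setT measurableT
  (fun n x => (f_ n x)%:E) (EFin \o f) (EFin \o g).
- by move=> n; exact/measurable_EFinP.
- exact/measurable_EFinP.
- apply: filterS cv => x cv _; apply: cvg_EFin => //; exact: nearW.
- exact: ig.
- by apply: nearW => x n _; rewrite lee_fin.
move=> i _ H; apply: fine_cvg; rewrite fineK; first exact: H.
exact: (integrable_fin_num measurableT i).
Qed.

End L2.

(** * Product measures and invariance of Lebesgue measure *)

(* The library's canonical sigma-finite structure on product measures only
   covers products of probabilities. *)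
Section prodsf.
Context d1 d2 (T1 : measurableType d1) (T2 : measurableType d2) (R : realType).
Variable m1 : {sigma_finite_measure set T1 -> \bar R}.
Variable m2 : {sigma_finite_measure set T2 -> \bar R}.

Lemma prod_sigma_finite : sigma_finite setT (m1 \x m2)%E.
Proof.
have /sigma_finiteP[F [TF ndF Foo]] := sigma_finiteT m1.
have /sigma_finiteP[G [TG ndG Goo]] := sigma_finiteT m2.
exists (fun n => F n `*` G n).
  rewrite -setXTT TF TG predeqE => -[x y]; split.
    move=> [/= [n _ Fnx] [k _ Gky]]; exists (maxn n k) => //; split.
    - by move: x Fnx; exact/subsetPset/ndF/leq_maxl.
    - by move: y Gky; exact/subsetPset/ndG/leq_maxr.
  by move=> [n _ []/= ? ?]; split; exists n.
move=> k; have [? ?] := Foo k; have [? ?] := Goo k.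
split; first exact: measurableX.
by rewrite product_measure1E// lte_mul_pinfty// ge0_fin_numE.
Qed.

Definition prodsf : {sigma_finite_measure set (T1 * T2)%type -> \bar R} :=
  HB.pack (m1 \x m2)%E
    (Measure_isSigmaFinite.Build _ _ _ (m1 \x m2)%E prod_sigma_finite).

End prodsf.

Section Rfubini.
Context d1 d2 (T1 : measurableType d1) (T2 : measurableType d2) (R : realType).
Variable m1 : {sigma_finite_measure set T1 -> \bar R}.
Variable m2 : {sigma_finite_measure set T2 -> \bar R}.
Variable f : T1 * T2 -> R.
Hypothesis mf : measurable_fun setT f.
Hypothesis i1 : forall x, m2.-integrable setT (fun y => (f (x, y))%:E).
Hypothesis i2 : forall y, m1.-integrable setT (fun x => (f (x, y))%:E).
Hypothesis fin : (\int[m1]_x \int[m2]_y `|f (x, y)|%:E < +oo)%E.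

Let mE : measurable_fun setT (EFin \o f). Proof. exact/measurable_EFinP. Qed.

Let int12 : (m1 \x m2)%E.-integrable setT (EFin \o f).
Proof. exact/integrable12ltyP. Qed.

Let R1 x : (\int[m2]_y f (x, y))%:E = (\int[m2]_y (f (x, y))%:E)%E.
Proof. by rewrite /Rintegral fineK// (integrable_fin_num measurableT (i1 x)). Qed.

Let R2 y : (\int[m1]_x f (x, y))%:E = (\int[m1]_x (f (x, y))%:E)%E.
Proof. by rewrite /Rintegral fineK// (integrable_fin_num measurableT (i2 y)). Qed.

Lemma Rfubini_meas1 : measurable_fun setT (fun x => \int[m2]_y f (x, y)).
Proof.
apply/measurable_EFinP; have := measurable_fubini_F int12.
by congr measurable_fun; apply/funext => x; rewrite /= R1.
Qed.

Lemma Rfubini_int1 :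
  m1.-integrable setT (fun x => (\int[m2]_y f (x, y))%:E).
Proof.
have := integrable_fubini_F int12.
by apply: eq_integrable => // x _; rewrite /= R1.
Qed.

(** Integrability of every section, not only of almost every one, makes each inner integral finite,
    so [fine] is harmless inside the outer integral. *)
Lemma Rfubini : \int[m1]_x \int[m2]_y f (x, y) = \int[m2]_y \int[m1]_x f (x, y).
Proof.
rewrite {1 3}/Rintegral; congr fine.
under eq_integral do rewrite R1.
under [RHS]eq_integral do rewrite R2.
exact: (Fubini int12).
Qed.

End Rfubini.

Section prod_tonelli.
Context d1 d2 (T1 : measurableType d1) (T2 : measurableType d2) (R : realType).
Variable m1 : {sigma_finite_measure set T1 -> \bar R}.
Variable m2 : {sigma_finite_measure set T2 -> \bar R}.

Lemma prod_tonelli (a : T1 -> R) (b : T2 -> R) :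
  measurable_fun setT a -> measurable_fun setT b ->
  (forall x, 0 <= a x) -> (forall x, 0 <= b x) ->
  (\int[m1 \x m2]_z (a z.1 * b z.2)%:E =
   (\int[m1]_x (a x)%:E) * (\int[m2]_x (b x)%:E))%E.
Proof.
move=> ma mb a0 b0.
have mab : measurable_fun setT (fun z : T1 * T2 => (a z.1 * b z.2)%:E).
  apply/measurable_EFinP; apply: measurable_funM.
    exact: (measurableT_comp ma measurable_fst).
  exact: (measurableT_comp mb measurable_snd).
rewrite fubini_tonelli1//; last by move=> z; rewrite lee_fin mulr_ge0.
rewrite /fubini_F /=; transitivity (\int[m1]_x ((a x)%:E * \int[m2]_y (b y)%:E))%E.
  apply: eq_integral => x _; under eq_integral do rewrite EFinM.
  by rewrite ge0_integralZl_EFin//; [move=> y _; rewrite lee_fin|exact/measurable_EFinP].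
rewrite ge0_integralZr//; first exact/measurable_EFinP.
- by move=> x _; rewrite lee_fin.
- by apply: integral_ge0 => y _; rewrite lee_fin.
Qed.

End prod_tonelli.

Section dynkin_integral.
Context d (T : measurableType d) (R : realType).
Variable mu : {measure set T -> \bar R}.
Variable f : T -> R.
Hypothesis fi : mu.-integrable setT (EFin \o f).
Variables (d' : measure_display) (T' : measurableType d') (X : T -> T').
Hypothesis mX : measurable_fun setT X.
Variable D : set T.
Hypothesis mD : measurable D.

Let J (A : set T') := (\int[mu]_(x in X @^-1` A `&` D) (f x)%:E)%E.

Let mXD (A : set T') : measurable A -> measurable (X @^-1` A `&` D).
Proof.
by move=> mA; apply: measurableI => //; rewrite -[X in measurable X]setTI; exact: mX.
Qed.

(** The sets with [J A = 0] form a Dynkin system: complements use the vanishing of the integral over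
    [D], disjoint unions use countable additivity. [X] is meant as one coordinate and [D] as the
    constraints on the others, so that the sides of a box can be treated one at a time. *)
Lemma dynkin_integral (G : set (set T')) : @measurable _ T' = <<s G >> ->
  setI_closed G -> (\int[mu]_(x in D) (f x)%:E = 0)%E ->
  (forall A, G A -> J A = 0%E) -> forall A, measurable A -> J A = 0%E.
Proof.
move=> GE GI fD0 GJ A mA.
apply: (@dynkin_induction _ T' G (fun A => J A = 0%E)) => //; last by rewrite -GE.
- by rewrite /J preimage_setT setTI.
- move=> S mS JS; rewrite /J.
  have := fD0; have -> : D = (X @^-1` S `&` D) `|` (X @^-1` (~` S) `&` D).
    by rewrite -setIUl preimage_setC setUv setTI.
  rewrite integral_setU//=.
  + by rewrite -/(J S) JS add0e -setIUl preimage_setC setUv setTI.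
  + exact: mXD.
  + by apply: mXD; exact: measurableC.
  + apply/measurable_EFinP; apply: measurable_funTS; apply/measurable_EFinP.
    exact: (measurable_int _ fi).
  + apply/disj_setPS; rewrite preimage_setC => x /= [[h _] [h' _]]; exact: h'.
- move=> F mF tF JF; rewrite /J preimage_bigcup setI_bigcupl integral_bigcup//=.
  + by rewrite eseries0// => i _ _; exact: JF.
  + move=> i j _ _ [x [[h1 _] [h2 _]]]; apply: tF => //.
    by exists (X x).
  + by move=> k; exact: mXD.
  + apply: (integrableS measurableT) => //.
    by apply: bigcupT_measurable => k; exact: mXD.
Qed.

End dynkin_integral.

Section product_transfer.
Context d1 d2 (T1 : measurableType d1) (T2 : measurableType d2) (R : realType).
Variable m1 : {sigma_finite_measure set T1 -> \bar R}.
Variable m2 : {sigma_finite_measure set T2 -> \bar R}.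

(** The pushforward has the right values on rectangles, hence is the product measure. Applied twice,
    this reduces translations and reflections of R^3 to the line. *)
Lemma product_measure_invariant (p1 : T1 -> T1) (p2 : T2 -> T2)
  (phi := fun x : T1 * T2 => (p1 x.1, p2 x.2)) :
  measurable_fun setT p1 -> measurable_fun setT p2 ->
  (forall A, measurable A -> m1 (p1 @^-1` A) = m1 A) ->
  (forall A, measurable A -> m2 (p2 @^-1` A) = m2 A) ->
  forall A, measurable A -> (m1 \x m2)%E (phi @^-1` A) = (m1 \x m2)%E A.
Proof.
move=> mp1 mp2 i1 i2 A mA.
have mphi : measurable_fun setT phi.
  apply/measurable_fun_pairP; split.
    exact: (measurableT_comp mp1 measurable_fst).
  exact: (measurableT_comp mp2 measurable_snd).
pose phim : {mfun _ >-> _} := HB.pack phi (isMeasurableFun.Build _ _ _ _ _ mphi).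
have := @product_measure_unique _ _ _ _ _ m1 m2 (pushforward (m1 \x m2)%E phim).
move=> /(_ mphi) H; rewrite (H _ _ mA) // => B C mB mC; change ((m1 \x m2)%E ((p1 @^-1` B) `*` (p2 @^-1` C)) = (m1 B * m2 C)%E).
have mB' : measurable (p1 @^-1` B) by rewrite -[X in measurable X]setTI; exact: mp1.
have mC' : measurable (p2 @^-1` C) by rewrite -[X in measurable X]setTI; exact: mp2.
by apply: etrans (product_measure1E _ _ mB' mC') _; congr (_ * _)%E; [exact: i1|exact: i2].
Qed.

End product_transfer.

Section R3.
Context (R : realType).
Local Notation R3 := (R3 R).
Local Notation mu := (leb3 R).
Local Notation l1 := (@lebesgue_measure R).

Lemma mtrans1 (a : R) : measurable_fun setT (fun x : measurableTypeR R => a + x : measurableTypeR R).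
Proof. exact: measurable_funD. Qed.

Lemma mopp1 : measurable_fun setT (fun x : measurableTypeR R => - x : measurableTypeR R).
Proof. exact: measurable_funN. Qed.

Lemma leb_trans (a : R) (A : set (measurableTypeR R)) : measurable A ->
  l1 ((fun x : measurableTypeR R => a + x : measurableTypeR R) @^-1` A) = l1 A.
Proof.
move=> mA.
have ms : measurable_fun setT (fun x : measurableTypeR R => a + x : measurableTypeR R).
  exact: measurable_funD.
pose phim : {mfun _ >-> _} := HB.pack (fun x : measurableTypeR R => a + x : measurableTypeR R) (isMeasurableFun.Build _ _ _ _ _ ms).
have := @lebesgue_measure_unique R (pushforward l1 phim).
move=> /(_ ms) H; rewrite (H _ A mA) // => X [[b c] _ <-]; change (l1 `]b, c]%classic = l1 ((fun x : measurableTypeR R => a + x : measurableTypeR R) @^-1` `]b, c]%classic)).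
have -> : (fun x : measurableTypeR R => a + x : measurableTypeR R) @^-1` `]b, c]%classic = `](b - a), (c - a)]%classic.
  by apply/seteqP; split => x /=; rewrite !in_itv /= ltrBlDl lerBrDl.
rewrite !lebesgue_measure_itv /= !lte_fin ltrD2r.
by case: ifP => // _; rewrite -!EFinB; congr EFin; ring.
Qed.

Lemma leb_opp (A : set (measurableTypeR R)) : measurable A ->
  l1 ((fun x : measurableTypeR R => - x : measurableTypeR R) @^-1` A) = l1 A.
Proof. exact: lebesgue_measureN. Qed.

Lemma trans3_meas (a : R3) : measurable_fun setT (fun x : R3 => a + x : R3).
Proof.
apply/measurable_fun_pairP; split; first apply/measurable_fun_pairP; try split.
- apply: (measurable_funD (f := fun=> a.1.1)) => //.
  by apply: measurableT_comp.
- apply: (measurable_funD (f := fun=> a.1.2)) => //.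
  by apply: measurableT_comp.
- exact: (measurable_funD (f := fun=> a.2)).
Qed.

Lemma opp3_meas : measurable_fun setT (fun x : R3 => - x : R3).
Proof.
apply/measurable_fun_pairP; split; first apply/measurable_fun_pairP; try split.
- by apply: (measurable_funN (f := fun x : R3 => x.1.1)) => //; apply: measurableT_comp.
- by apply: (measurable_funN (f := fun x : R3 => x.1.2)) => //; apply: measurableT_comp.
- exact: (measurableT_comp mopp1 measurable_snd).
Qed.

Lemma leb3_trans (a : R3) (A : set R3) : measurable A ->
  mu ((fun x : R3 => a + x : R3) @^-1` A) = mu A.
Proof.
move=> mA.
have H2 (B : set (measurableTypeR R * measurableTypeR R)) : measurable B -> (l1 \x l1)%E ((fun x : measurableTypeR R * measurableTypeR R => (a.1.1 + x.1, a.1.2 + x.2)) @^-1` B) = (l1 \x l1)%E B.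
  by apply: (product_measure_invariant (mtrans1 a.1.1) (mtrans1 a.1.2)) => C mC; exact: leb_trans.
have HM : measurable_fun setT (fun x : measurableTypeR R * measurableTypeR R => (a.1.1 + x.1, a.1.2 + x.2) : measurableTypeR R * measurableTypeR R).
  apply/measurable_fun_pairP; split.
    exact: (measurableT_comp (mtrans1 a.1.1) measurable_fst).
  exact: (measurableT_comp (mtrans1 a.1.2) measurable_snd).
have := product_measure_invariant (m1 := prodsf l1 l1) (m2 := l1) HM (mtrans1 a.2) H2 (fun B mB => leb_trans a.2 mB).
move=> H; refine (H A mA).
Qed.

Lemma leb3_opp (A : set R3) : measurable A ->
  mu ((fun x : R3 => - x : R3) @^-1` A) = mu A.
Proof.
move=> mA.
have H2 (B : set (measurableTypeR R * measurableTypeR R)) : measurable B -> (l1 \x l1)%E ((fun x : measurableTypeR R * measurableTypeR R => (- x.1, - x.2)) @^-1` B) = (l1 \x l1)%E B.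
  by apply: (product_measure_invariant mopp1 mopp1) => C mC; exact: leb_opp.
have HM : measurable_fun setT (fun x : measurableTypeR R * measurableTypeR R => (- x.1, - x.2) : measurableTypeR R * measurableTypeR R).
  apply/measurable_fun_pairP; split.
    exact: (measurableT_comp mopp1 measurable_fst).
  exact: (measurableT_comp mopp1 measurable_snd).
have := product_measure_invariant (m1 := prodsf l1 l1) (m2 := l1) HM mopp1 H2 (fun B mB => leb_opp mB).
move=> H; refine (H A mA).
Qed.

End R3.

Section invariant.
Context d (T : measurableType d) (R : realType).
Variable mu : {measure set T -> \bar R}.
Variable phi : T -> T.
Hypothesis mphi : measurable_fun setT phi.
Hypothesis inv : forall A, measurable A -> mu (phi @^-1` A) = mu A.

Lemma ge0_integral_inv (f : T -> \bar R) : measurable_fun setT f ->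
  (forall x, (0 <= f x)%E) -> (\int[mu]_x f (phi x) = \int[mu]_x f x)%E.
Proof.
move=> mf f0; pose phim : {mfun _ >-> _} := HB.pack phi (isMeasurableFun.Build _ _ _ _ _ mphi).
have := ge0_integral_pushforward mphi mu measurableT mf (fun y _ => f0 y).
rewrite preimage_setT => <-.
have := @eq_measure_integral _ _ _ setT mu (pushforward mu phim) f.
by move=> /(_ mphi) ->// A mA _; exact: inv.
Qed.

Lemma integrable_inv (f : T -> R) : mu.-integrable setT (EFin \o f) ->
  mu.-integrable setT (EFin \o (fun x => f (phi x))).
Proof.
move=> i; have mf := measurable_int _ i; apply/integrableP; split.
  exact: measurableT_comp mf mphi.
have /integrableP[_] := i; apply: le_lt_trans.
rewrite -(@ge0_integral_inv (fun x => `|(EFin \o f) x|)%E)//.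
exact: measurableT_comp.
Qed.

Lemma Rintegral_inv (f : T -> R) : mu.-integrable setT (EFin \o f) ->
  \int[mu]_x f (phi x) = \int[mu]_x f x.
Proof.
move=> i; pose phim : {mfun _ >-> _} := HB.pack phi (isMeasurableFun.Build _ _ _ _ _ mphi).
rewrite /Rintegral; congr fine.
have mf := measurable_int _ i.
have := @integral_pushforward _ _ _ _ _ _ mphi mu setT (EFin \o f) mf.
rewrite preimage_setT => /(_ (integrable_inv i) measurableT) <-.
have := @eq_measure_integral _ _ _ setT mu (pushforward mu phim) (EFin \o f).
by move=> /(_ mphi) ->// A mA _; exact: inv.
Qed.

Lemma ae_inv (P : T -> Prop) : (\forall x \ae mu, P x) ->
  \forall x \ae mu, P (phi x).
Proof.
move=> [N [mN N0 PN]]; exists (phi @^-1` N); split.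
- by rewrite -[X in measurable X]setTI; exact: mphi.
- by rewrite -N0; exact: inv.
- by move=> x /= nP; apply: PN.
Qed.

End invariant.

(** * Boxes in R^3 and their totality *)

Section R3b.
Context (R : realType).
Local Notation R3 := (R3 R).
Local Notation mu := (leb3 R).
Local Notation l1 := (@lebesgue_measure R).
Local Notation mR := (measurableTypeR R).

Definition mu3 : {sigma_finite_measure set R3 -> \bar R} := prodsf (prodsf l1 l1) l1.

Lemma tonelli3 (a b c : mR -> R) :
  measurable_fun setT a -> measurable_fun setT b -> measurable_fun setT c ->
  (forall x, 0 <= a x) -> (forall x, 0 <= b x) -> (forall x, 0 <= c x) ->
  (\int[mu]_z (a z.1.1 * b z.1.2 * c z.2)%:E =
   (\int[l1]_x (a x)%:E) * (\int[l1]_x (b x)%:E) * (\int[l1]_x (c x)%:E))%E.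
Proof.
move=> ma mb mc a0 b0 c0.
have mab : measurable_fun setT (fun z : mR * mR => a z.1 * b z.2).
  apply: measurable_funM.
    exact: (measurableT_comp ma measurable_fst).
  exact: (measurableT_comp mb measurable_snd).
have := prod_tonelli (prodsf l1 l1) l1 mab mc.
move=> /(_ (fun z => mulr_ge0 (a0 _) (b0 _)) c0) ->; congr (_ * _)%E.
exact: prod_tonelli.
Qed.

Definition box (a b : R3) : set R3 :=
  [set x | [/\ a.1.1 < x.1.1 <= b.1.1, a.1.2 < x.1.2 <= b.1.2 & a.2 < x.2 <= b.2]].

Let c1 (x : R3) : mR := x.1.1.
Let c2 (x : R3) : mR := x.1.2.
Let c3 (x : R3) : mR := x.2.
Let mc1 : measurable_fun setT c1.
Proof. exact: (measurableT_comp measurable_fst measurable_fst). Qed.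
Let mc2 : measurable_fun setT c2.
Proof. exact: (measurableT_comp measurable_snd measurable_fst). Qed.
Let mc3 : measurable_fun setT c3.
Proof. exact: measurable_snd. Qed.

Definition oc (a b : R) : set mR := `]a, b]%classic.

Lemma boxE (a b : R3) : box a b = c1 @^-1` `]a.1.1, b.1.1] `&` (c2 @^-1` `]a.1.2, b.1.2] `&` (c3 @^-1` `]a.2, b.2])).
Proof.
apply/seteqP; split => x /=; rewrite !in_itv/=; first by case.
by case=> ? [].
Qed.

Lemma indic_box (a b x : R3) : \1_(box a b) x =
  \1_(oc a.1.1 b.1.1) x.1.1 * \1_(oc a.1.2 b.1.2) x.1.2 * \1_(oc a.2 b.2) x.2 :> R.
Proof.
rewrite !indicE -!natrM !mulnb boxE !in_setI; congr (_ %:R); congr nat_of_bool.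
by rewrite -andbA; congr [&& _, _ & _]; apply/idP/idP; rewrite !inE.
Qed.

Lemma measurable_box (a b : R3) : measurable (box a b).
Proof.
rewrite boxE; do !apply: measurableI.
- by rewrite -[X in measurable X]setTI; exact: mc1.
- by rewrite -[X in measurable X]setTI; exact: mc2.
- by rewrite -[X in measurable X]setTI; exact: mc3.
Qed.

(** Half-open intervals are stable under intersection and generate the Borel sets, but the whole
    line is not one of them. The vanishing of the integral over [D] itself is recovered by dominated
    convergence along ]-n, n]. *)
Lemma cover_itv (X : R3 -> mR) (D : set R3) (f : R3 -> R) : measurable_fun setT X ->
  measurable D -> mu.-integrable setT (EFin \o f) ->
  (forall a b : R, (\int[mu]_(x in X @^-1` oc a b `&` D) (f x)%:E = 0)%E) ->
  forall A, measurable A -> (\int[mu]_(x in X @^-1` A `&` D) (f x)%:E = 0)%E.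
Proof.
move=> mX mD fi H A mA.
apply: (dynkin_integral fi mX mD (G := @ocitv R)) => //.
- exact: ocitvI.
- pose I (n : nat) := X @^-1` `](- n%:R), n%:R]%classic.
  pose f_ (n : nat) := (EFin \o f) \_ (I n).
  have mI n : measurable (I n) by rewrite -[X in measurable X]setTI; exact: mX.
  have mf : measurable_fun setT (EFin \o f) by exact: (measurable_int _ fi).
  have fiD : mu.-integrable D (EFin \o f) by apply: (integrableS measurableT).
  have [] := @dominated_convergence _ _ _ mu D mD f_ (EFin \o f) (fun x => `|(f x)%:E|)%E.
  + by move=> n; apply: measurable_funTS; apply/(measurable_restrictT _ (mI n)); exact: measurable_funTS.
  + exact: measurable_funTS.
  + apply: nearW => x Dx; apply: cvg_near_cst; near=> n.
    rewrite /f_ patchE ifT//; rewrite inE /I /= in_itv /=.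
    have : `|X x : R| < n%:R by near: n; exact: nbhs_infty_gtr.
    by rewrite ltr_norml => /andP[-> /ltW ->].
  + exact: integrable_abse.
  + apply: nearW => x n Dx; rewrite /f_ patchE; case: ifP => // _.
    by rewrite abse0 abse_ge0.
  + move=> _ _; rewrite (_ : [sequence _]_n = fun=> 0%E).
      by move=> /(cvg_lim (@ereal_hausdorff _)); rewrite lim_cst.
    by apply/funext => n /=; rewrite /f_ -integral_mkcondr setIC; exact: H.
- by move=> B [[a b] _ <-]; exact: H.
Unshelve. all: by end_near. Qed.

(** [cover_itv] frees the three sides of a box in turn. Two more Dynkin inductions, for the inner
    and then the outer product, go from rectangles to all measurable sets. *)
Lemma box_total1 (f : R3 -> R) : mu.-integrable setT (EFin \o f) ->
  (forall a b : R3, (\int[mu]_(x in box a b) (f x)%:E = 0)%E) ->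
  f = (fun=> 0) %[ae mu].
Proof.
move=> fi H.
have mpre (X : R3 -> mR) A : measurable_fun setT X -> measurable A -> measurable (X @^-1` A).
  by move=> mX mA; rewrite -[X in measurable X]setTI; exact: mX.
have H1 A1 A2 A3 : measurable A1 -> measurable A2 -> measurable A3 ->
    (\int[mu]_(x in c1 @^-1` A1 `&` (c2 @^-1` A2 `&` c3 @^-1` A3)) (f x)%:E = 0)%E.
  move=> m1 m2 m3; apply: cover_itv => //; first by apply: measurableI; apply: mpre => //; exact: measurable_itv.
  move=> a1 b1; rewrite setICA; apply: cover_itv => //.
    by apply: measurableI; apply: mpre => //; exact: measurable_itv.
  move=> a2 b2; rewrite setICA setIC -setIA setICA; apply: cover_itv => //.
    by apply: measurableI; apply: mpre => //; exact: measurable_itv.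
  move=> a3 b3; rewrite setIC -setIA.
  by rewrite setICA; have := H ((a1, a2), a3) ((b1, b2), b3); rewrite boxE.
have H12 (S : set (mR * mR)) A3 : measurable S -> measurable A3 ->
    (\int[mu]_(x in fst @^-1` S `&` c3 @^-1` A3) (f x)%:E = 0)%E.
  move=> mS mA3.
  apply: (dynkin_integral fi measurable_fst _ (measurable_prod_measurableType _ _)) => //.
  - exact: mpre.
  - move=> _ _ [A1 mA1 [A2 mA2 <-]] [B1 mB1 [B2 mB2 <-]]; rewrite -setXI.
    exists (A1 `&` B1); first exact: measurableI.
    by exists (A2 `&` B2) => //; exact: measurableI.
  - by have := H1 setT setT A3 measurableT measurableT mA3; rewrite !preimage_setT !setTI.
  - move=> _ [A1 mA1 [A2 mA2 <-]].
    have -> : fst @^-1` (A1 `*` A2) `&` c3 @^-1` A3 = c1 @^-1` A1 `&` (c2 @^-1` A2 `&` c3 @^-1` A3).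
      by apply/seteqP; split => x /=; [case=> [[? ?] ?]|case=> ? []].
    exact: H1.
have H123 (S : set R3) : measurable S -> (\int[mu]_(x in S) (f x)%:E = 0)%E.
  move=> mS; have -> : S = id @^-1` S `&` setT by rewrite setIT.
  apply: (dynkin_integral fi (@measurable_id _ _ _) _ (measurable_prod_measurableType _ _)) => //.
  - move=> _ _ [A1 mA1 [A2 mA2 <-]] [B1 mB1 [B2 mB2 <-]]; rewrite -setXI.
    exists (A1 `&` B1); first exact: measurableI.
    by exists (A2 `&` B2) => //; exact: measurableI.
  - by have := H12 setT setT measurableT measurableT; rewrite !preimage_setT !setTI.
  - move=> _ [A1 mA1 [A2 mA2 <-]].
    have -> : id @^-1` (A1 `*` A2) `&` setT = fst @^-1` A1 `&` c3 @^-1` A2.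
      by apply/seteqP; split => x /=; case=> // -[].
    exact: H12.
have := @integral_ae_eq _ _ _ mu setT measurableT (cst 0%E) (EFin \o f) fi.
move=> /(_ (measurable_cst _)) HH.
apply: filterS (HH _) => [x /(_ I) [] -> //|E _ mE].
by rewrite H123// integral0.
Qed.

Lemma moc (a b : R) : measurable_fun setT (\1_(oc a b) : mR -> R).
Proof. by apply: measurable_indic; exact: measurable_itv. Qed.

Lemma int_oc (a b : R) : (\int[l1]_x (\1_(oc a b) x)%:E = (Num.max (b - a) 0)%:E)%E.
Proof.
rewrite integral_indic ?setIT//; last exact: measurable_itv.
rewrite [LHS](lebesgue_measure_itv `]a, b])/= lte_fin; case: ltP => ab.
  by rewrite -EFinB maxEle; case: ifP => //; rewrite subr_le0 leNgt ab.
by rewrite maxEle; case: ifP => //; rewrite subr_le0 ab.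
Qed.

Lemma int_box (a b : R3) : (\int[mu]_x (\1_(box a b) x)%:E =
  (Num.max (b.1.1 - a.1.1) 0 * Num.max (b.1.2 - a.1.2) 0 * Num.max (b.2 - a.2) 0)%:E)%E.
Proof.
under eq_integral do rewrite indic_box.
by rewrite (tonelli3 (moc _ _) (moc _ _) (moc _ _))// !int_oc.
Qed.

Lemma intg_box (a b : R3) : mu.-integrable setT (EFin \o (\1_(box a b) : R3 -> R)).
Proof.
apply/integrableP; split.
  by apply/measurable_EFinP; apply: measurable_indic; exact: measurable_box.
under eq_integral do rewrite /= ger0_norm//.
by rewrite int_box ltry.
Qed.

Lemma L2_box (a b : R3) : L2 mu (\1_(box a b) : R3 -> R).
Proof.
split; first by apply: measurable_indic; exact: measurable_box.
have := intg_box a b; apply: eq_integrable => // x _ /=.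
by rewrite indicE; case: (_ \in _); rewrite /= ?expr1n ?expr0n.
Qed.

(** A function in L^2 need not be integrable, so it is first cut off to the cubes [C n]; a box meets
    a cube in a box, and countably many cubes cover the space. *)
Lemma box_total (f : R3 -> R) : L2 mu f ->
  (forall a b : R3, (\int[mu]_(x in box a b) (f x)%:E = 0)%E) ->
  f = (fun=> 0) %[ae mu].
Proof.
move=> Lf H; have [mf f2] := Lf.
pose C (n : nat) := box ((- n%:R, - n%:R), - n%:R) ((n%:R, n%:R), n%:R).
have mC n : measurable (C n) by exact: measurable_box.
have L1C n : L2 mu (\1_(C n) : R3 -> R) by exact: L2_box.
have fC n : (fun x => f x * \1_(C n) x) = (fun=> 0) %[ae mu].
  apply: box_total1; first exact: L2_mul.
  move=> a b.
  rewrite (_ : (fun x => (f x * \1_(C n) x)%:E) = (EFin \o f) \_ (C n)); last first.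
    apply/funext => x; rewrite patchE indicE.
    by case: ifP => _; rewrite ?mulr1 ?mulr0.
  rewrite -integral_mkcondr.
  have -> : box a b `&` C n = box ((Num.max a.1.1 (- n%:R), Num.max a.1.2 (- n%:R)), Num.max a.2 (- n%:R))
     ((Num.min b.1.1 n%:R, Num.min b.1.2 n%:R), Num.min b.2 n%:R).
    apply/seteqP; split => x; rewrite /C /box /= !gt_max !le_min.
      by case=> [[/andP[-> ->] /andP[-> ->] /andP[-> ->]] [/andP[-> ->] /andP[-> ->] /andP[-> ->]]].
    by case=> [/andP[/andP[-> ->] /andP[-> ->]] /andP[/andP[-> ->] /andP[-> ->]] /andP[/andP[-> ->] /andP[-> ->]]].
  exact: H.
have : \forall x \ae mu, forall n, f x * \1_(C n) x = 0.
  apply: ae_foralln => n; apply: filterS (fC n) => x; exact.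
apply: filterS => x fx _.
have [n Hn] : exists n, x \in C n.
  pose m := `|x.1.1 : R| + `|x.1.2 : R| + `|x.2 : R|.
  have [n mn] : exists n : nat, m < n%:R.
    exact: filter_ex (nbhs_infty_gtr m).
  exists n; rewrite inE /C /box /=.
  have h1 := normr_ge0 (x.1.1 : R); have h2 := normr_ge0 (x.1.2 : R).
  have h3 := normr_ge0 (x.2 : R).
  have K (t : R) : `|t| <= m -> - n%:R < t <= n%:R.
    move=> tm; have : `|t| < n%:R by exact: le_lt_trans mn.
    by rewrite ltr_norml => /andP[-> /ltW ->].
  by split; apply: K; rewrite /m; lra.
by have := fx n; rewrite indicE Hn mulr1.
Qed.
End R3b.

(** * The Poisson kernel *)

Section poisson1.
Context (R : realType).
Local Notation l1 := (@lebesgue_measure R).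
Local Notation mR := (measurableTypeR R).
Implicit Types e p z : R.

Definition pw e p := expR (- (e * `|p|)).
(** 2 pi times the Poisson kernel of the line; it is the cosine transform of [pw e]. *)
Definition pk e z := 2 * e / (e ^+ 2 + z ^+ 2).

Lemma pw_ge0 e p : 0 <= pw e p. Proof. exact: expR_ge0. Qed.

Lemma pw_continuous e : continuous (pw e).
Proof.
move=> p; rewrite /pw; apply: continuous_comp; last exact: continuous_expR.
apply: cvgN; apply: cvgM; first exact: cvg_cst.
exact: norm_continuous.
Qed.

Lemma pw_meas e : measurable_fun setT (pw e : mR -> R).
Proof. exact: continuous_measurable_fun (@pw_continuous e). Qed.

Lemma expRN_cvgy e : 0 < e -> expR (- (e * p)) @[p --> +oo] --> (0 : R).
Proof.
move=> e0.
have H : e * p @[p --> +oo] --> +oo.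
  by apply: gt0_cvgMry => //; exact: cvg_id.
apply: (@cvg_comp _ _ _ (fun p => e * p) (fun p => expR (- p)) _ +oo) => //.
exact: cvgr_expR.
Qed.

Lemma is_derive_cont (F : R -> R) (f : R -> R) : (forall x : R, is_derive x 1 F (f x)) -> continuous F.
Proof.
move=> dF x; apply/differentiable_continuous/derivable1_diffP.
by have [] := dF x.
Qed.

Lemma FTC_itv (F f : R -> R) (a b : R) : a < b ->
  (forall x : R, is_derive x 1 F (f x)) -> continuous f ->
  (\int[l1]_(x in `[a, b]) (f x)%:E = (F b - F a)%:E)%E.
Proof.
move=> ab dF cf; have cF := is_derive_cont dF.
rewrite (@continuous_FTC2 _ f F) ?EFinB//.
- by apply: continuous_subspaceT.
- split.
  + by move=> x _; have [] := dF x.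
  + by apply: cvg_at_right_filter; exact: cF.
  + by apply: cvg_at_left_filter; exact: cF.
- by move=> x _; rewrite derive1E; have [_ ->] := dF x.
Qed.

Lemma FTC_y (F f : R -> R) (l : R) : (forall x : R, is_derive x 1 F (f x)) ->
  continuous f -> (forall x, 0 <= x -> 0 <= f x) -> F x @[x --> +oo] --> l ->
  (\int[l1]_(x in `[0%R, +oo[) (f x)%:E = (l - F 0)%:E)%E.
Proof.
move=> dF cf f0 Fl; have cF := is_derive_cont dF.
rewrite (@ge0_continuous_FTC2y _ f F 0 l) ?EFinB//.
- by apply: continuous_subspaceT.
- by apply: cvg_at_right_filter; exact: cF.
- by move=> x _; rewrite derive1E; have [_ ->] := dF x.
Qed.

(** The summand 1 next to the cosine makes the integrand nonnegative, as [FTC_y] requires on the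
    half-line; it is subtracted again in [pw_cosE]. *)
Lemma pF_derive e z p : 0 < e ->
  is_derive p 1 (fun p => expR (- (e * p)) * ((z * sin (p * z) - e * cos (p * z)) / (e ^+ 2 + z ^+ 2) - e^-1))
   (expR (- (e * p)) * (1 + cos (p * z))).
Proof.
move=> e0; have q0 : e ^+ 2 + z ^+ 2 != 0 by rewrite gt_eqF// ltr_wpDr ?sqr_ge0// exprn_gt0.
apply: is_derive_eq; rewrite /GRing.scale /=.
by field; rewrite q0 gt_eqF.
Qed.

Lemma pk_derive e (x y : R) : 0 < e ->
  is_derive y 1 (fun y => 2 * atan ((y - x) / e)) (pk e (x - y)).
Proof.
move=> e0; have q0 : e ^+ 2 + (x - y) ^+ 2 != 0 by rewrite gt_eqF// ltr_wpDr ?sqr_ge0// exprn_gt0.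
apply: is_derive_eq; rewrite /GRing.scale /=.
rewrite /pk.
by field; rewrite q0 gt_eqF//= gt_eqF// ltr_wpDr ?sqr_ge0// exprn_gt0.
Qed.

Lemma cos_scale_cont z : continuous (fun p => cos (p * z)).
Proof.
move=> p; apply: continuous_comp; last exact: continuous_cos.
by apply: cvgM; [exact: cvg_id|exact: cvg_cst].
Qed.

Lemma sin_scale_cont z : continuous (fun p => sin (p * z)).
Proof.
move=> p; apply: continuous_comp; last exact: continuous_sin.
by apply: cvgM; [exact: cvg_id|exact: cvg_cst].
Qed.

Lemma expRN_cont e : continuous (fun p => expR (- (e * p))).
Proof.
move=> p; apply: continuous_comp; last exact: continuous_expR.
by apply: cvgN; apply: cvgM; [exact: cvg_cst|exact: cvg_id].
Qed.

Lemma cos1_ge0 (t : R) : 0 <= 1 + cos t.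
Proof. by have := cos_geN1 t; lra. Qed.

Lemma pw_cos_half e z : 0 < e ->
  (\int[l1]_(p in `[0%R, +oo[) (expR (- (e * p)) * (1 + cos (p * z)))%:E =
   (e^-1 + e / (e ^+ 2 + z ^+ 2))%:E)%E.
Proof.
move=> e0; rewrite (FTC_y (l := 0) (fun p => pF_derive z p e0)) => [|x|x _|].
- rewrite mulr0 oppr0 expR0 mul0r sin0 cos0; congr EFin.
  have q0 : e ^+ 2 + z ^+ 2 != 0 by rewrite gt_eqF// ltr_wpDr ?sqr_ge0// exprn_gt0.
  by field; rewrite q0 gt_eqF.
- apply: cvgM; first exact: expRN_cont.
  by apply: cvgD; [exact: cvg_cst|exact: cos_scale_cont].
- by rewrite mulr_ge0 ?expR_ge0 ?cos1_ge0.
(* [C] bounds the bracketed factor of the primitive uniformly in [p], so the exponential forces the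
   limit 0. *)
- pose C := (`|z| + e) / (e ^+ 2 + z ^+ 2) + e^-1.
  have q0 : 0 < e ^+ 2 + z ^+ 2 by rewrite ltr_wpDr ?sqr_ge0// exprn_gt0.
  have lim1 : expR (- (e * p)) * C @[p --> +oo] --> 0.
    by rewrite -(mul0r C); apply: cvgM; [exact: expRN_cvgy|exact: cvg_cst].
  apply/cvgr0Pnorm_le => d d0; move/cvgr0Pnorm_le : lim1 => /(_ _ d0).
  apply: filterS => p; apply: le_trans; rewrite !normrM ler_wpM2l//.
  rewrite [leRHS]ger0_norm; last first.
    by rewrite /C addr_ge0 ?invr_ge0 ?(ltW e0)// divr_ge0 ?(ltW q0)// addr_ge0// ltW.
  apply: le_trans (ler_normB _ _) _; apply: lerD; last by rewrite gtr0_norm ?invr_gt0.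
  rewrite normrM [`|_^-1|]gtr0_norm ?invr_gt0// ler_pM2r ?invr_gt0//.
  apply: le_trans (ler_normB _ _) _; apply: lerD.
    by rewrite normrM ler_piMr// ler_norml sin_geN1 sin_le1.
  rewrite normrM [`|e|]gtr0_norm// ler_piMr//; first exact: ltW.
  by rewrite ler_norml cos_geN1 cos_le1.
Qed.

Lemma itv0y : `[0%R, +oo[%classic = [set x : R | 0 <= x].
Proof. by apply/seteqP; split => x /=; rewrite in_itv/= andbT. Qed.

Lemma pw_cos1 e z : 0 < e ->
  (\int[l1]_p (pw e p * (1 + cos (p * z)))%:E = (2 / e + pk e z)%:E)%E.
Proof.
move=> e0; rewrite ge0_symfun_integralT.
- rewrite -itv0y; under eq_integral => p.
    rewrite inE /= in_itv/= andbT => p0; rewrite /pw ger0_norm//.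
    over.
  by rewrite pw_cos_half// -EFinM; congr EFin; rewrite /pk; ring.
- by move=> x; rewrite mulr_ge0 ?pw_ge0 ?cos1_ge0.
- move=> x; apply: cvgM; first exact: pw_continuous.
  by apply: cvgD; [exact: cvg_cst|exact: cos_scale_cont].
- by move=> x; rewrite /= /pw normrN mulNr cosN.
Qed.

Lemma cos_meas z : measurable_fun setT (fun p : mR => cos (p * z)).
Proof. exact: continuous_measurable_fun (@cos_scale_cont z). Qed.

(** At frequency 0 the two terms of [pw_cos1] coincide, which yields integrability and the mass 2 /
    e of [pw e]; subtracting that mass leaves the cosine transform. *)
Lemma pw_cosE e z : 0 < e ->
  (l1.-integrable setT (fun p : mR => (pw e p)%:E)) /\
  \int[l1]_p (pw e p * cos (p * z)) = pk e z.
Proof.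
move=> e0.
have i1 w : l1.-integrable setT (fun p : mR => (pw e p * (1 + cos (p * w)))%:E).
  apply/integrableP; split.
    apply/measurable_EFinP; apply: measurable_funM; first exact: pw_meas.
    by apply: measurable_funD => //; exact: cos_meas.
  under eq_integral do rewrite /= ger0_norm ?mulr_ge0 ?pw_ge0 ?cos1_ge0//.
  by rewrite pw_cos1// ltry.
have i0 : l1.-integrable setT (fun p : mR => (pw e p)%:E).
  have := intgZ 2^-1 (i1 0); apply: eq_integrable => // p _ /=.
  by rewrite mulr0 cos0; congr EFin; field.
have v w : \int[l1]_p (pw e p * (1 + cos (p * w))) = 2 / e + pk e w.
  by rewrite /Rintegral pw_cos1.
have v0 : \int[l1]_p (pw e p) = 2 / e.
  have := v 0; under eq_Rint do rewrite mulr0 cos0 mulrC.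
  rewrite RintZ// /pk expr0n addr0 => H.
  have : e != 0 by rewrite gt_eqF.
  move: H; set I := Rintegral _ _ _ => H en.
  have -> : I = (1 + 1) * I / 2 by field.
  by rewrite H; field.
split => //; transitivity (\int[l1]_p (pw e p * (1 + cos (p * z)) - pw e p)).
  by apply: eq_Rint => p; ring.
by have := RintB (i1 z) i0; rewrite v v0 => ->; ring.
Qed.

Lemma sin_meas z : measurable_fun setT (fun p : mR => sin (p * z)).
Proof. exact: continuous_measurable_fun (@sin_scale_cont z). Qed.

Lemma pw_intg e : 0 < e -> l1.-integrable setT (fun p : mR => (pw e p)%:E).
Proof. by move=> e0; have [] := pw_cosE 0 e0. Qed.

Lemma pw_cos_intg e z : 0 < e -> l1.-integrable setT (fun p : mR => (pw e p * cos (p * z))%:E).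
Proof.
move=> e0; apply: (le_intg _ _ (pw_intg e0)).
  by apply: measurable_funM; [exact: pw_meas|exact: cos_meas].
move=> x; rewrite normrM ger0_norm ?pw_ge0// ler_piMr ?pw_ge0//.
by rewrite ler_norml cos_geN1 cos_le1.
Qed.

Lemma pw_sin_intg e z : 0 < e -> l1.-integrable setT (fun p : mR => (pw e p * sin (p * z))%:E).
Proof.
move=> e0; apply: (le_intg _ _ (pw_intg e0)).
  by apply: measurable_funM; [exact: pw_meas|exact: sin_meas].
move=> x; rewrite normrM ger0_norm ?pw_ge0// ler_piMr ?pw_ge0//.
by rewrite ler_norml sin_geN1 sin_le1.
Qed.

Lemma pw_sinE e z : 0 < e -> \int[l1]_p (pw e p * sin (p * z)) = 0.
Proof.
move=> e0; have i := pw_sin_intg z e0.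
have := Rintegral_inv (@mopp1 R) (@leb_opp R) i.
under eq_Rint do rewrite /pw normrN mulNr sinN mulrN -mulN1r -/(pw e _).
rewrite (RintZ _ i); set I := Rintegral _ _ _; lra.
Qed.

Lemma pk_ge0 e z : 0 < e -> 0 <= pk e z.
Proof. by move=> e0; rewrite divr_ge0 ?mulr_ge0 ?addr_ge0 ?sqr_ge0 ?ltW// . Qed.

Lemma pk_cont e : 0 < e -> continuous (pk e).
Proof.
move=> e0 z; apply: cvgM; first exact: cvg_cst.
apply: cvgV; first by rewrite gt_eqF// ltr_wpDr ?sqr_ge0// exprn_gt0.
apply: cvgD; first exact: cvg_cst.
exact: exprn_continuous.
Qed.

Lemma pk_int e : 0 < e -> (\int[l1]_z (pk e z)%:E = (2 * pi)%:E)%E.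
Proof.
move=> e0.
have dF (y : R) : is_derive y 1 (fun y => 2 * atan ((y - 0) / e)) (pk e y).
  by have := pk_derive 0 y e0; rewrite sub0r /pk sqrrN.
rewrite ge0_symfun_integralT; [|by move=> x; exact: pk_ge0|exact: pk_cont|].
- rewrite -itv0y (FTC_y (l := pi) dF) ?subr0 ?mul0r ?atan0 ?mulr0 ?subr0 -?EFinM//.
  + exact: pk_cont.
  + by move=> x _; exact: pk_ge0.
  + have -> : pi = 2 * (pi / 2) :> R by field.
    apply: cvgM; first exact: cvg_cst.
    apply: (@cvg_comp _ _ _ (fun x => (x - 0) / e) atan _ +oo); last exact: cvgy_atan.
    apply: gt0_cvgMly; first by rewrite invr_gt0.
    by under eq_fun do rewrite subr0; exact: cvg_id.
- by move=> x; rewrite /pk /= sqrrN.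
Qed.

Lemma pk_int_oc e x (a b : R) : 0 < e -> a < b ->
  (\int[l1]_y (pk e (x - y) * \1_(oc a b) y)%:E =
   (2 * (atan ((b - x) / e) - atan ((a - x) / e)))%:E)%E.
Proof.
move=> e0 ab.
rewrite (_ : (fun y => _) = (fun y => (pk e (x - y))%:E) \_ (oc a b)); last first.
  by apply/funext => y; rewrite patchE indicE; case: ifP => _; rewrite ?mulr1 ?mulr0.
rewrite -integral_mkcond.
have cf : continuous (fun y => pk e (x - y)).
  move=> y; apply: (@continuous_comp _ _ _ (fun y => x - y) (pk e)); last exact: pk_cont.
  by apply: cvgB; [exact: cvg_cst|exact: cvg_id].
have := FTC_itv ab (fun y => pk_derive x y e0) cf.
rewrite -mulrBr => <-.
rewrite -integral_itv_obnd_cbnd//.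
apply/measurable_EFinP; apply: measurable_funTS; exact: continuous_measurable_fun.
Qed.

End poisson1.

(** * Bilinear integrals against a bounded kernel *)

Section bilinear.
Context d1 d2 (T1 : measurableType d1) (T2 : measurableType d2) (R : realType).
Variable m1 : {sigma_finite_measure set T1 -> \bar R}.
Variable m2 : {sigma_finite_measure set T2 -> \bar R}.

Lemma prod_intg (g : T1 -> R) (f : T2 -> R) :
  m1.-integrable setT (EFin \o g) -> m2.-integrable setT (EFin \o f) ->
  (m1 \x m2)%E.-integrable setT (EFin \o (fun z => g z.1 * f z.2)).
Proof.
move=> ig jf; have mg := integrable_meas ig; have mf := integrable_meas jf.
apply/integrableP; split.
  apply/measurable_EFinP; apply: measurable_funM.
    exact: (measurableT_comp mg measurable_fst).
  exact: (measurableT_comp mf measurable_snd).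
under eq_integral do rewrite /= normrM.
have := prod_tonelli m1 m2 (measurableT_comp (@normr_measurable _ setT) mg)
  (measurableT_comp (@normr_measurable _ setT) mf) (fun x => normr_ge0 _) (fun x => normr_ge0 _).
move=> /= ->.
have /integrableP[_ /= h1] := ig; have /integrableP[_ /= h2] := jf.
by rewrite lte_mul_pinfty// ?integral_ge0// ge0_fin_numE// integral_ge0.
Qed.

Variable b : T1 * T2 -> R.
Variable B : R.
Hypothesis mb : measurable_fun setT b.
Hypothesis bB : forall z, `|b z| <= B.
Variables (g : T1 -> R) (f : T2 -> R).
Hypothesis ig : m1.-integrable setT (EFin \o g).
Hypothesis jf : m2.-integrable setT (EFin \o f).

Let mg : measurable_fun setT g. Proof. exact: integrable_meas ig. Qed.
Let mf : measurable_fun setT f. Proof. exact: integrable_meas jf. Qed.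

Let mb1 x : measurable_fun setT (fun y => b (x, y)).
Proof. exact: (measurableT_comp mb (measurable_pair1 x)). Qed.

Let mb2 y : measurable_fun setT (fun x => b (x, y)).
Proof. exact: (measurableT_comp mb (measurable_pair2 y)). Qed.

Lemma bil_int1 x : m2.-integrable setT (fun y => (f y * b (x, y))%:E).
Proof.
have := intgZ B (integrable_norm jf); apply: le_intg.
  exact: measurable_funM mf (mb1 x).
by move=> y /=; rewrite normrM mulrC ler_wpM2r.
Qed.

Lemma bil_int2 y : m1.-integrable setT (fun x => (g x * b (x, y))%:E).
Proof.
have := intgZ B (integrable_norm ig); apply: le_intg.
  exact: measurable_funM mg (mb2 y).
by move=> x /=; rewrite normrM mulrC ler_wpM2r.
Qed.

Let F z := g z.1 * f z.2 * b z.

Let mF : measurable_fun setT F.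
Proof. by apply: measurable_funM => //; apply: integrable_meas (prod_intg ig jf). Qed.

Lemma bil_prod : (m1 \x m2)%E.-integrable setT (EFin \o F).
Proof.
have := intgZ B (integrable_norm (prod_intg ig jf)); apply: le_intg => //.
by move=> z /=; rewrite /F normrM mulrC ler_wpM2r.
Qed.

Let i1 x : m2.-integrable setT (fun y => (F (x, y))%:E).
Proof.
have := intgZ (g x) (bil_int1 x); apply: eq_integrable => // y _.
by rewrite /F /= mulrA.
Qed.

Let i2 y : m1.-integrable setT (fun x => (F (x, y))%:E).
Proof.
have := intgZ (f y) (bil_int2 y); apply: eq_integrable => // x _.
by rewrite /F /= mulrA (mulrC (f y)).
Qed.

Let fin : (\int[m1]_x \int[m2]_y `|F (x, y)|%:E < +oo)%E.
Proof. by have /integrable12ltyP := bil_prod; apply; exact/measurable_EFinP. Qed.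

Lemma bil_swap : \int[m1]_x (g x * \int[m2]_y (f y * b (x, y))) =
  \int[m2]_y (f y * \int[m1]_x (g x * b (x, y))).
Proof.
have := Rfubini mF i1 i2 fin.
under eq_Rint => x.
  under eq_Rint do rewrite /F /= -mulrA.
  rewrite (RintZ _ (bil_int1 x)).
  over.
move=> ->; apply: eq_Rint => y; rewrite -(RintZ _ (bil_int2 y)).
by apply: eq_Rint => x; rewrite /F /= (mulrC (g x)) mulrA.
Qed.

Lemma bil_meas : measurable_fun setT (fun x => g x * \int[m2]_y (f y * b (x, y))).
Proof.
have := Rfubini_meas1 mF i1 fin.
congr measurable_fun; apply/funext => x; rewrite -(RintZ _ (bil_int1 x)).
by apply: eq_Rint => y; rewrite /F /= mulrA.
Qed.

Lemma bil_intg : m1.-integrable setT (fun x => (g x * \int[m2]_y (f y * b (x, y)))%:E).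
Proof.
have := Rfubini_int1 mF i1 fin.
apply: eq_integrable => // x _; congr EFin; rewrite -(RintZ _ (bil_int1 x)).
by apply: eq_Rint => y; rewrite /F /= mulrA.
Qed.

Lemma bil_prodE : \int[(m1 \x m2)%E]_z (g z.1 * f z.2 * b z) =
  \int[m1]_x (g x * \int[m2]_y (f y * b (x, y))).
Proof.
transitivity (\int[m1]_x \int[m2]_y F (x, y)).
  rewrite /Rintegral; congr fine; rewrite -(integral12_prod_meas1 bil_prod).
  apply: eq_integral => x _; rewrite /fubini_F.
  by rewrite fineK// (integrable_fin_num measurableT (i1 x)).
apply: eq_Rint => x; rewrite -(RintZ _ (bil_int1 x)).
by apply: eq_Rint => y; rewrite /F /= mulrA.
Qed.

End bilinear.

Section bil1.
Context d1 d2 (T1 : measurableType d1) (T2 : measurableType d2) (R : realType).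
Variable m1 : {sigma_finite_measure set T1 -> \bar R}.
Variable m2 : {sigma_finite_measure set T2 -> \bar R}.
Variables (g : T1 -> R) (f : T2 -> R).
Hypothesis ig : m1.-integrable setT (EFin \o g).
Hypothesis jf : m2.-integrable setT (EFin \o f).

Lemma prodRE : \int[(m1 \x m2)%E]_z (g z.1 * f z.2) = \int[m1]_x g x * \int[m2]_y f y.
Proof.
have b1 (z : T1 * T2) : `|(fun=> 1) z| <= 1 :> R by rewrite normr1.
have := bil_prodE (measurable_cst _) b1 ig jf.
under eq_Rint do rewrite mulr1.
move=> ->; under eq_Rint => x.
  under eq_Rint do rewrite mulr1.
  rewrite mulrC; over.
by rewrite (RintZ _ ig) mulrC.
Qed.

End bil1.

Section prod3.
Context (R : realType).
Local Notation R3 := (R3 R).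
Local Notation mu := (leb3 R).
Local Notation l1 := (@lebesgue_measure R).
Local Notation mR := (measurableTypeR R).
Variables a b c : mR -> R.
Hypothesis ia : l1.-integrable setT (EFin \o a).
Hypothesis ib : l1.-integrable setT (EFin \o b).
Hypothesis ic : l1.-integrable setT (EFin \o c).

Lemma prod3_intg : mu.-integrable setT (EFin \o (fun z : R3 => a z.1.1 * b z.1.2 * c z.2)).
Proof.
have h := prod_intg ia ib.
exact: (@prod_intg _ _ _ _ _ (prodsf l1 l1) l1 _ _ h ic).
Qed.

Lemma prod3E : \int[mu]_z (a z.1.1 * b z.1.2 * c z.2) =
  \int[l1]_x a x * \int[l1]_x b x * \int[l1]_x c x.
Proof.
have h := prod_intg ia ib.
rewrite -(prodRE ia ib).
exact: (@prodRE _ _ _ _ _ (prodsf l1 l1) l1 _ _ h ic).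
Qed.

End prod3.

Section kernel3.
Context (R : realType).
Local Notation R3 := (R3 R).
Local Notation mu := (leb3 R).
Local Notation intg f := (mu.-integrable setT (EFin \o f)).

Definition mm3 : {sigma_finite_measure set (R3 * R3)%type -> \bar R} := prodsf (mu3 R) (mu3 R).
Local Notation mm := mm3.

Lemma mm_intg (g f : R3 -> R) : intg g -> intg f ->
  mm.-integrable setT (EFin \o (fun z => g z.1 * f z.2)).
Proof. exact: (@prod_intg _ _ _ _ _ (mu3 R) (mu3 R)). Qed.

Lemma mmE (g f : R3 -> R) : intg g -> intg f ->
  \int[mm]_z (g z.1 * f z.2) = \int[mu]_x g x * \int[mu]_x f x.
Proof. exact: (@prodRE _ _ _ _ _ (mu3 R) (mu3 R)). Qed.

Lemma mm_tonelli1 (F : R3 * R3 -> \bar R) : measurable_fun setT F ->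
  (forall z, 0 <= F z)%E ->
  (\int[mm]_z F z = \int[mu]_x \int[mu]_y F (x, y))%E.
Proof. exact: (@fubini_tonelli1 _ _ _ _ _ (mu3 R) (mu3 R)). Qed.

Lemma mm_tonelli2 (F : R3 * R3 -> \bar R) : measurable_fun setT F ->
  (forall z, 0 <= F z)%E ->
  (\int[mm]_z F z = \int[mu]_y \int[mu]_x F (x, y))%E.
Proof. exact: (@fubini_tonelli2 _ _ _ _ _ (mu3 R) (mu3 R)). Qed.

Variables (k : R3 -> R3 -> R) (B : R).
Hypothesis mk : measurable_fun setT (fun z : R3 * R3 => k z.1 z.2).
Hypothesis kB : forall x y, `|k x y| <= B.
Variables g f : R3 -> R.
Hypothesis ig : intg g.
Hypothesis jf : intg f.

Let kB' (z : R3 * R3) : `|k z.1 z.2| <= B. Proof. exact: kB. Qed.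

Lemma K3_int1 x : intg (fun y => f y * k x y).
Proof. exact: (@bil_int1 _ _ _ _ _ (mu3 R) _ _ mk kB' _ jf x). Qed.

Lemma K3_swap : \int[mu]_x (g x * \int[mu]_y (f y * k x y)) =
  \int[mu]_y (f y * \int[mu]_x (g x * k x y)).
Proof. exact: (@bil_swap _ _ _ _ _ (mu3 R) (mu3 R) _ _ mk kB' _ _ ig jf). Qed.

Lemma K3_meas : measurable_fun setT (fun x => g x * \int[mu]_y (f y * k x y)).
Proof. exact: (@bil_meas _ _ _ _ _ (mu3 R) (mu3 R) _ _ mk kB' _ _ ig jf). Qed.

Lemma K3_intg : intg (fun x => g x * \int[mu]_y (f y * k x y)).
Proof. exact: (@bil_intg _ _ _ _ _ (mu3 R) (mu3 R) _ _ mk kB' _ _ ig jf). Qed.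

End kernel3.

Section kernel6.
Context (R : realType).
Local Notation R3 := (R3 R).
Local Notation mu := (leb3 R).
Local Notation mm := (mm3 R).
Variables (k : R3 -> R3 * R3 -> R) (B : R).
Hypothesis mk : measurable_fun setT (fun z : R3 * (R3 * R3) => k z.1 z.2).
Hypothesis kB : forall x y, `|k x y| <= B.
Variables (g : R3 -> R) (f : R3 * R3 -> R).
Hypothesis ig : mu.-integrable setT (EFin \o g).
Hypothesis jf : mm.-integrable setT (EFin \o f).

Let kB' (z : R3 * (R3 * R3)) : `|k z.1 z.2| <= B. Proof. exact: kB. Qed.

Lemma K6_swap : \int[mu]_x (g x * \int[mm]_y (f y * k x y)) =
  \int[mm]_y (f y * \int[mu]_x (g x * k x y)).
Proof. exact: (@bil_swap _ _ _ _ _ (mu3 R) mm _ _ mk kB' _ _ ig jf). Qed.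

Lemma K6_intg : mu.-integrable setT (EFin \o (fun x => g x * \int[mm]_y (f y * k x y))).
Proof. exact: (@bil_intg _ _ _ _ _ (mu3 R) mm _ _ mk kB' _ _ ig jf). Qed.

End kernel6.

(** * Cosine and sine transforms *)

Section T0.
Context (R : realType).
Local Notation R3 := (R3 R).
Local Notation mu := (leb3 R).
Local Notation l1 := (@lebesgue_measure R).
Local Notation mR := (measurableTypeR R).
Local Notation intg f := (mu.-integrable setT (EFin \o f)).
Local Notation mm := (mm3 R).
Implicit Types (f g : R3 -> R) (p x y z : R3) (e : R).

Definition c0 : R := (2 * pi) `^ (- (3 / 2)).

Lemma c0_gt0 : 0 < c0.
Proof. by apply: powR_gt0; rewrite mulr_gt0// pi_gt0. Qed.

Lemma c0_sqr : c0 ^+ 2 = ((2 * pi) ^+ 3)^-1.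
Proof.
rewrite /c0 -powR_mulrn ?powR_ge0// -powRrM.
have -> : - (3 / 2) * 2%:R = - 3%:R :> R by field.
by rewrite powRN powR_mulrn// mulr_ge0// pi_ge0.
Qed.

Lemma dot3C p x : dot3 p x = dot3 x p.
Proof. by rewrite /dot3 !(mulrC _ (x.1.1 : R)) !(mulrC _ (x.1.2 : R)) !(mulrC _ (x.2 : R)). Qed.

Lemma dot3Nl p x : dot3 (- p) x = - dot3 p x.
Proof. by rewrite /dot3 /= !mulNr !opprD. Qed.

Lemma dot3Br p x y : dot3 p (x - y) = dot3 p x - dot3 p y.
Proof. by rewrite /dot3 /=; ring. Qed.

Lemma m11 : measurable_fun setT (fun x : R3 => x.1.1 : R).
Proof. exact: (measurableT_comp measurable_fst measurable_fst). Qed.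
Lemma m12 : measurable_fun setT (fun x : R3 => x.1.2 : R).
Proof. exact: (measurableT_comp measurable_snd measurable_fst). Qed.
Lemma m2 : measurable_fun setT (fun x : R3 => x.2 : R).
Proof. exact: measurable_snd. Qed.

Lemma dot3_meas : measurable_fun setT (fun z : R3 * R3 => dot3 z.1 z.2).
Proof.
apply: measurable_funD; first apply: measurable_funD; apply: measurable_funM.
- exact: (measurableT_comp m11 measurable_fst).
- exact: (measurableT_comp m11 measurable_snd).
- exact: (measurableT_comp m12 measurable_fst).
- exact: (measurableT_comp m12 measurable_snd).
- exact: (measurableT_comp m2 measurable_fst).
- exact: (measurableT_comp m2 measurable_snd).
Qed.

Lemma mcos : measurable_fun setT (@cos R).
Proof. exact: continuous_measurable_fun (@continuous_cos R). Qed.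
Lemma msin : measurable_fun setT (@sin R).
Proof. exact: continuous_measurable_fun (@continuous_sin R). Qed.

Lemma cosd_meas : measurable_fun setT (fun z : R3 * R3 => cos (dot3 z.1 z.2)).
Proof. exact: measurableT_comp mcos dot3_meas. Qed.
Lemma sind_meas : measurable_fun setT (fun z : R3 * R3 => sin (dot3 z.1 z.2)).
Proof. exact: measurableT_comp msin dot3_meas. Qed.

Lemma cos_le1n (t : R) : `|cos t| <= 1.
Proof. by rewrite ler_norml cos_geN1 cos_le1. Qed.
Lemma sin_le1n (t : R) : `|sin t| <= 1.
Proof. by rewrite ler_norml sin_geN1 sin_le1. Qed.

Lemma cosd_le p x : `|cos (dot3 p x)| <= 1.
Proof. exact: cos_le1n. Qed.
Lemma sind_le p x : `|sin (dot3 p x)| <= 1.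
Proof. exact: sin_le1n. Qed.

Lemma intg_cos f p : intg f -> intg (fun x => f x * cos (dot3 p x)).
Proof. by move=> i; exact: (K3_int1 cosd_meas cosd_le). Qed.
Lemma intg_sin f p : intg f -> intg (fun x => f x * sin (dot3 p x)).
Proof. by move=> i; exact: (K3_int1 sind_meas sind_le). Qed.

Definition CT f p := c0 * \int[mu]_x (f x * cos (dot3 p x)).
Definition ST f p := c0 * \int[mu]_x (f x * sin (dot3 p x)).
Definition T0 f p := CT f p + ST f p.

Definition W e p := pw e p.1.1 * pw e p.1.2 * pw e p.2.
Definition PK e p := pk e p.1.1 * pk e p.1.2 * pk e p.2.

Lemma W_intg e : 0 < e -> intg (W e).
Proof. by move=> e0; apply: prod3_intg; exact: pw_intg. Qed.

Lemma W_gt0 e p : 0 < W e p.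
Proof. by rewrite !mulr_gt0// expR_gt0. Qed.

Lemma W_le1 e p : 0 <= e -> W e p <= 1.
Proof.
move=> e0; have H t : pw e t <= 1 by rewrite expR_le1 oppr_le0 mulr_ge0.
by rewrite /W !mulr_ile1 ?mulr_ge0 ?pw_ge0.
Qed.

(** [K3_meas] yields measurability of a transform only after multiplication by an integrable factor.
    A positive weight is divided out here, its reciprocal being written as a power, since powers are
    measurable. *)
Lemma div_meas (h w : R3 -> R) : (forall p, 0 < w p) -> measurable_fun setT w ->
  measurable_fun setT (fun p => w p * h p) -> measurable_fun setT h.
Proof.
move=> w0 mw mwh.
have -> : h = (fun p => (w p * h p) * (w p `^ (-1))).
  by apply/funext => p; rewrite powR_inv1 ?ltW// mulrAC divff ?mul1r// gt_eqF.
by apply: measurable_funM => //; exact: (measurableT_comp (measurable_powR _) mw).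
Qed.

Lemma trig_meas (k : R -> R) f : measurable_fun setT (fun z : R3 * R3 => k (dot3 z.1 z.2)) ->
  (forall p x, `|k (dot3 p x)| <= 1) -> intg f ->
  measurable_fun setT (fun p => c0 * \int[mu]_x (f x * k (dot3 p x))).
Proof.
move=> mk k1 i; apply: (measurable_funM (measurable_cst c0)).
have := K3_meas (k := fun p x => k (dot3 p x)) mk k1 (W_intg ltr01) i.
apply: div_meas; first by move=> p; exact: W_gt0.
exact: integrable_meas (W_intg ltr01).
Qed.

Lemma CT_meas f : intg f -> measurable_fun setT (CT f).
Proof. exact: trig_meas cosd_meas cosd_le. Qed.

Lemma ST_meas f : intg f -> measurable_fun setT (ST f).
Proof. exact: trig_meas sind_meas sind_le. Qed.

Lemma T0_meas f : intg f -> measurable_fun setT (T0 f).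
Proof. by move=> i; apply: measurable_funD; [exact: CT_meas|exact: ST_meas]. Qed.

Lemma trig_sym (k : R -> R) f g : measurable_fun setT (fun z : R3 * R3 => k (dot3 z.1 z.2)) ->
  (forall p x, `|k (dot3 p x)| <= 1) -> intg f -> intg g ->
  \int[mu]_p (g p * (c0 * \int[mu]_x (f x * k (dot3 p x)))) =
  \int[mu]_p (f p * (c0 * \int[mu]_x (g x * k (dot3 p x)))).
Proof.
move=> mk k1 i j.
have K u v : intg u -> intg v -> \int[mu]_p (u p * (c0 * \int[mu]_x (v x * k (dot3 p x)))) =
    c0 * \int[mu]_p (u p * \int[mu]_x (v x * k (dot3 p x))).
  move=> iu iv; rewrite -RintZ; first by apply: eq_Rint => p; rewrite mulrCA.
  exact: (K3_intg (k := fun p x => k (dot3 p x)) mk k1 iu iv).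
have H := K3_swap (k := fun p x => k (dot3 p x)) mk k1 j i.
apply: etrans (K _ _ j i) _; apply: etrans (esym (K _ _ i j)).
congr (_ * _); apply: etrans H _.
by apply: eq_Rint => p; congr (_ * _); apply: eq_Rint => x; rewrite dot3C.
Qed.

Lemma CT_sym f g : intg f -> intg g ->
  \int[mu]_p (g p * CT f p) = \int[mu]_p (f p * CT g p).
Proof. exact: trig_sym cosd_meas cosd_le. Qed.

Lemma ST_sym f g : intg f -> intg g ->
  \int[mu]_p (g p * ST f p) = \int[mu]_p (f p * ST g p).
Proof. exact: trig_sym sind_meas sind_le. Qed.

(* Modulus of the complex-valued integral of [f e^{-ip.x}]. *)
Lemma CST_le f p : intg f ->
  CT f p ^+ 2 + ST f p ^+ 2 <= c0 ^+ 2 * (\int[mu]_x `|f x|) ^+ 2.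
Proof.
move=> i; rewrite /CT /ST !exprMn -mulrDr ler_wpM2l ?sqr_ge0//.
set A := Rintegral _ _ _; set B := Rintegral _ _ _; set N := Rintegral _ _ _.
have iN : intg (fun x => `|f x|) by exact: integrable_norm.
have N0 : 0 <= N by apply: Rintegral_ge0.
(* The vector (A, B) is tested against itself: A^2 + B^2 is the integral of f (A cos + B sin), and
   |A cos + B sin| <= r. *)
pose r := Num.sqrt (A ^+ 2 + B ^+ 2).
have r2 : r ^+ 2 = A ^+ 2 + B ^+ 2 by rewrite sqr_sqrtr// addr_ge0 ?sqr_ge0.
have ic := intgZ A (intg_cos p i); have is_ := intgZ B (intg_sin p i).
have : A ^+ 2 + B ^+ 2 <= N * r.
  have -> : A ^+ 2 + B ^+ 2 = \int[mu]_x (A * (f x * cos (dot3 p x)) + B * (f x * sin (dot3 p x))).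
    by rewrite RintD// !RintZ ?expr2//; [exact: intg_sin|exact: intg_cos].
  rewrite mulrC -RintZ//; apply: le_Rintegral => //.
  - exact: intgD.
  - exact: intgZ.
  move=> x _; set t := dot3 p x.
  have -> : A * (f x * cos t) + B * (f x * sin t) = (A * cos t + B * sin t) * f x by ring.
  apply: le_trans (ler_norm _) _; rewrite normrM ler_wpM2r//.
  rewrite -(@ler_pXn2r _ 2)// ?nnegrE ?sqrtr_ge0// real_normK ?num_real// r2.
  have := cos2Dsin2 t; have := sqr_ge0 (A * sin t - B * cos t); nra.
rewrite -r2 expr2; have [->|r0] := eqVneq r 0.
  by rewrite !mulr0 => _; exact: sqr_ge0.
have rp : 0 < r by rewrite lt_neqAle eq_sym r0 sqrtr_ge0.
by rewrite ler_pM2r// => rN; rewrite -expr2 lerXn2r// nnegrE ltW.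
Qed.

(** The addition formulas split cos(p.z) into four products over the coordinates; those with sine
    factors integrate to 0 and the pure cosine product gives three one-dimensional kernels. *)
Lemma W_cosE e z : 0 < e -> \int[mu]_p (W e p * cos (dot3 p z)) = PK e z.
Proof.
move=> e0.
pose c t := fun p : mR => pw e p * cos (p * t).
pose s t := fun p : mR => pw e p * sin (p * t).
have ic t : l1.-integrable setT (EFin \o c t) by exact: pw_cos_intg.
have is_ t : l1.-integrable setT (EFin \o s t) by exact: pw_sin_intg.
have Ec t : \int[l1]_p c t p = pk e t by exact: (pw_cosE _ e0).2.
have Es t : \int[l1]_p s t p = 0 by exact: pw_sinE.
transitivity (\int[mu]_p (((c z.1.1 p.1.1 * c z.1.2 p.1.2 * c z.2 p.2) -
    (s z.1.1 p.1.1 * s z.1.2 p.1.2 * c z.2 p.2)) -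
    ((s z.1.1 p.1.1 * c z.1.2 p.1.2 * s z.2 p.2) +
    (c z.1.1 p.1.1 * s z.1.2 p.1.2 * s z.2 p.2)))).
  by apply: eq_Rint => p; rewrite /W /dot3 !cosD sinD /c /s; ring.
rewrite RintB; last 2 first.
- by apply: intgB; exact: prod3_intg.
- by apply: intgD; exact: prod3_intg.
rewrite RintB ?RintD; [|exact: prod3_intg..].
by rewrite !prod3E// !Ec !Es /PK; ring.
Qed.

Lemma PK_ge0 e z : 0 < e -> 0 <= PK e z.
Proof. move=> e0; have h t := pk_ge0 t e0.
by rewrite /PK mulr_ge0// mulr_ge0. Qed.

Lemma pk_meas e : 0 < e -> measurable_fun setT (pk e : mR -> R).
Proof. by move=> e0; apply: continuous_measurable_fun; exact: pk_cont. Qed.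

Lemma PK_int e : 0 < e -> (\int[mu]_z (PK e z)%:E = ((2 * pi) ^+ 3)%:E)%E.
Proof.
move=> e0; have m := pk_meas e0; have p0 := (fun z : mR => pk_ge0 (z : R) e0).
by rewrite (tonelli3 m m m p0 p0 p0) pk_int// -!EFinM; congr EFin; ring.
Qed.

Lemma PK_meas e : 0 < e -> measurable_fun setT (PK e).
Proof.
move=> e0; have m := pk_meas e0.
apply: measurable_funM; first apply: measurable_funM.
- exact: measurableT_comp m m11.
- exact: measurableT_comp m m12.
- exact: measurableT_comp m m2.
Qed.

(* [CT^2 + ST^2 = c0^2 \int\int f(x) f(y) cos(p.(x-y))], integrated in [p]
   against the weight [W e]. *)
Lemma CST_W f e : intg f -> 0 < e ->
  intg (fun p => W e p * (CT f p ^+ 2 + ST f p ^+ 2)) /\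
  \int[mu]_p (W e p * (CT f p ^+ 2 + ST f p ^+ 2)) =
  c0 ^+ 2 * \int[mm]_z (f z.1 * f z.2 * PK e (z.1 - z.2)).
Proof.
move=> i e0.
pose h (z : R3 * R3) := f z.1 * f z.2.
have ih : mm.-integrable setT (EFin \o h) by exact: mm_intg.
pose b p (w : R3 * R3) := cos (dot3 p (w.1 - w.2)).
have ma1 : measurable_fun setT (fun w : R3 * (R3 * R3) => (w.1, w.2.1) : R3 * R3).
  apply/measurable_fun_pairP; split; first exact: measurable_fst.
  exact: (measurableT_comp measurable_fst measurable_snd).
have ma2 : measurable_fun setT (fun w : R3 * (R3 * R3) => (w.1, w.2.2) : R3 * R3).
  apply/measurable_fun_pairP; split; first exact: measurable_fst.
  exact: (measurableT_comp measurable_snd measurable_snd).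
have mb : measurable_fun setT (fun w : R3 * (R3 * R3) => b w.1 w.2).
  apply: measurableT_comp mcos _.
  have -> : (fun w : R3 * (R3 * R3) => dot3 w.1 (w.2.1 - w.2.2)) =
      (fun w => dot3 w.1 w.2.1 - dot3 w.1 w.2.2) by apply/funext => w; rewrite dot3Br.
  apply: measurable_funB.
    exact: (measurableT_comp dot3_meas ma1).
  exact: (measurableT_comp dot3_meas ma2).
have b1 p w : `|b p w| <= 1 by exact: cos_le1n.
have E p : CT f p ^+ 2 + ST f p ^+ 2 = c0 ^+ 2 * \int[mm]_z (h z * b p z).
  have -> : \int[mm]_z (h z * b p z) =
      \int[mm]_z ((f z.1 * cos (dot3 p z.1)) * (f z.2 * cos (dot3 p z.2)) +
       (f z.1 * sin (dot3 p z.1)) * (f z.2 * sin (dot3 p z.2))).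
    by apply: eq_Rint => z; rewrite /h /b /= dot3Br cosB; ring.
  have ic := intg_cos p i; have is_ := intg_sin p i.
  rewrite (RintD (mm_intg ic ic) (mm_intg is_ is_)).
  rewrite (mmE ic ic) (mmE is_ is_).
  by rewrite /CT /ST; ring.
have i1 := K6_intg mb b1 (W_intg e0) ih.
split.
  have := intgZ (c0 ^+ 2) i1; apply: eq_integrable => // p _ /=; congr EFin.
  by rewrite E mulrCA.
transitivity (c0 ^+ 2 * \int[mu]_p (W e p * \int[mm]_z (h z * b p z))).
  by rewrite -RintZ//; apply: eq_Rint => p; rewrite E mulrCA.
congr (_ * _).
have -> := K6_swap mb b1 (W_intg e0) ih.
by apply: eq_Rint => z; rewrite /b /= W_cosE.
Qed.

End T0.

(** * The transform as a contraction of L^2 *)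

Section evenodd.
Context (R : realType).
Local Notation R3 := (R3 R).
Local Notation mu := (leb3 R).

Lemma int_opp3 (F : R3 -> \bar R) : measurable_fun setT F -> (forall x, 0 <= F x)%E ->
  (\int[mu]_x F (- x)%R = \int[mu]_x F x)%E.
Proof. exact: (ge0_integral_inv (@opp3_meas R) (@leb3_opp R)). Qed.

(** The cross term 2 C S is odd, so adding the integral to its reflection removes it. The argument
    stays in the extended reals because finiteness is not yet known. *)
Lemma even_odd_sq (w C S : R3 -> R) : (forall p, 0 <= w p) ->
  measurable_fun setT w -> measurable_fun setT C -> measurable_fun setT S ->
  (forall p, w (- p) = w p) -> (forall p, C (- p) = C p) -> (forall p, S (- p) = - S p) ->
  (\int[mu]_p (w p * (C p + S p) ^+ 2)%:E =
   \int[mu]_p (w p * (C p ^+ 2 + S p ^+ 2))%:E)%E.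
Proof.
move=> w0 mw mC mS ew eC oS.
pose F p := (w p * (C p + S p) ^+ 2)%:E : \bar R.
have F0 p : (0 <= F p)%E by rewrite lee_fin mulr_ge0 ?sqr_ge0.
have mF : measurable_fun setT F.
  apply/measurable_EFinP; apply: measurable_funM => //; apply: measurable_funX.
  exact: measurable_funD.
pose A p := (w p * (C p ^+ 2 + S p ^+ 2))%:E : \bar R.
have A0 p : (0 <= A p)%E by rewrite lee_fin mulr_ge0 ?addr_ge0 ?sqr_ge0.
have mA : measurable_fun setT A.
  apply/measurable_EFinP; apply: measurable_funM => //.
  by apply: measurable_funD; exact: measurable_funX.
have mFo : measurable_fun setT (fun p : R3 => F (- p)).
  exact: (measurableT_comp mF (@opp3_meas R)).
have E : (\int[mu]_p F p + \int[mu]_p F p = \int[mu]_p A p + \int[mu]_p A p)%E.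
  rewrite -{2}(int_opp3 mF F0) -ge0_integralD// -ge0_integralD//.
  by apply: eq_integral => p _; rewrite /F /A ew eC oS -!EFinD; congr EFin; ring.
have H (u v : \bar R) : (0 <= u -> 0 <= v -> u + u = v + v -> u = v)%E.
  case: u => [u| |] //; case: v => [v| |] // _ _ /= [uv].
  by congr EFin; lra.
have I0 (G : R3 -> \bar R) : (forall p, 0 <= G p)%E -> (0 <= \int[mu]_p G p)%E.
  by move=> G0; apply: integral_ge0.
exact: (H _ _ (I0 _ F0) (I0 _ A0) E).
Qed.

End evenodd.

Section contraction.
Context (R : realType).
Local Notation R3 := (R3 R).
Local Notation mu := (leb3 R).
Local Notation l1 := (@lebesgue_measure R).
Local Notation mR := (measurableTypeR R).
Local Notation intg f := (mu.-integrable setT (EFin \o f)).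
Local Notation mm := (mm3 R).
Implicit Types (f g : R3 -> R) (p x y z : R3) (e : R).

Lemma CT_even f p : CT f (- p) = CT f p.
Proof. by rewrite /CT; congr (_ * _); apply: eq_Rint => x; rewrite dot3Nl cosN. Qed.

Lemma ST_odd f p : intg f -> ST f (- p) = - ST f p.
Proof.
move=> i; rewrite /ST -mulrN; congr (_ * _).
rewrite -[RHS]mulN1r -(RintZ _ (intg_sin p i)).
by apply: eq_Rint => x; rewrite dot3Nl sinN mulrN mulN1r.
Qed.

(** Under an even weight the square of the Hartley transform may be exchanged for the squared
    Fourier modulus, to which [CST_le] and the convolution theorem apply. *)
Lemma T0_CST f (w : R3 -> R) : intg f -> (forall p, 0 <= w p) ->
  measurable_fun setT w -> (forall p, w (- p) = w p) ->
  (\int[mu]_p (w p * T0 f p ^+ 2)%:E =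
   \int[mu]_p (w p * (CT f p ^+ 2 + ST f p ^+ 2))%:E)%E.
Proof.
move=> i w0 mw ew; apply: even_odd_sq => //; [exact: CT_meas|exact: ST_meas|exact: CT_even|].
by move=> p; exact: ST_odd.
Qed.

Lemma T0_CST1 f : intg f ->
  (\int[mu]_p (T0 f p ^+ 2)%:E = \int[mu]_p (CT f p ^+ 2 + ST f p ^+ 2)%:E)%E.
Proof.
move=> i; have H := T0_CST i (w := fun=> 1) (fun=> ler01) (measurable_cst _) (fun=> erefl).
transitivity (\int[mu]_p (1 * T0 f p ^+ 2)%:E)%E.
  by apply: eq_integral => p _; rewrite mul1r.
by rewrite H; apply: eq_integral => p _; rewrite mul1r.
Qed.

Lemma sub3_meas : measurable_fun setT (fun z : R3 * R3 => z.1 - z.2 : R3).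
Proof.
apply/measurable_fun_pairP; split; first apply/measurable_fun_pairP; try split.
- apply: (measurable_funB (f := fun z : R3 * R3 => z.1.1.1) (g := fun z : R3 * R3 => z.2.1.1)).
    exact: (measurableT_comp (@m11 R) measurable_fst).
  exact: (measurableT_comp (@m11 R) measurable_snd).
- apply: (measurable_funB (f := fun z : R3 * R3 => z.1.1.2) (g := fun z : R3 * R3 => z.2.1.2)).
    exact: (measurableT_comp (@m12 R) measurable_fst).
  exact: (measurableT_comp (@m12 R) measurable_snd).
- apply: (measurable_funB (f := fun z : R3 * R3 => z.1.2) (g := fun z : R3 * R3 => z.2.2)).
    exact: (measurableT_comp (@m2 R) measurable_fst).
  exact: (measurableT_comp (@m2 R) measurable_snd).
Qed.

Lemma int_subr (F : R3 -> \bar R) x : measurable_fun setT F -> (forall x, 0 <= F x)%E ->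
  (\int[mu]_y F (x - y)%R = \int[mu]_y F y)%E.
Proof.
move=> mF F0.
have mx := measurableT_comp mF (@trans3_meas R x).
have := int_opp3 mx (fun y => F0 _); move=> /= ->.
exact: (ge0_integral_inv (@trans3_meas R x) (@leb3_trans R x) mF F0).
Qed.

Lemma int_subl (F : R3 -> \bar R) y : measurable_fun setT F -> (forall x, 0 <= F x)%E ->
  (\int[mu]_x F (x - y)%R = \int[mu]_x F x)%E.
Proof.
move=> mF F0; under eq_integral do rewrite addrC.
exact: (ge0_integral_inv (@trans3_meas R (- y)) (@leb3_trans R (- y)) mF F0).
Qed.

Lemma PK_mm_meas e : 0 < e -> measurable_fun setT (fun z : R3 * R3 => PK e (z.1 - z.2)).
Proof. by move=> e0; exact: measurableT_comp (PK_meas e0) sub3_meas. Qed.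

Lemma m1_mm f : measurable_fun setT f -> measurable_fun setT (fun z : R3 * R3 => f z.1).
Proof. by move=> mf; exact: (measurableT_comp mf measurable_fst). Qed.

Lemma m2_mm f : measurable_fun setT f -> measurable_fun setT (fun z : R3 * R3 => f z.2).
Proof. by move=> mf; exact: (measurableT_comp mf measurable_snd). Qed.

Lemma PK_young e (a : R3 -> R) : 0 < e -> measurable_fun setT a -> (forall x, 0 <= a x) ->
  (\int[mm]_z (a z.1 * PK e (z.1 - z.2)%R)%:E = ((2 * pi) ^+ 3)%:E * \int[mu]_x (a x)%:E)%E /\
  (\int[mm]_z (a z.2 * PK e (z.1 - z.2))%:E = ((2 * pi) ^+ 3)%:E * \int[mu]_x (a x)%:E)%E.
Proof.
move=> e0 ma a0.
have P0 x : (0 <= (PK e x)%:E)%E by rewrite lee_fin PK_ge0.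
have mP : measurable_fun setT (fun x => (PK e x)%:E) by apply/measurable_EFinP; exact: PK_meas.
have pi0 : (0 <= (2 * pi : R) ^+ 3)%R by rewrite exprn_ge0// mulr_ge0// pi_ge0.
split.
- rewrite mm_tonelli1; last 2 first.
  + apply/measurable_EFinP; apply: measurable_funM; [exact: m1_mm|exact: PK_mm_meas].
  + by move=> z; rewrite lee_fin mulr_ge0// PK_ge0.
  rewrite -ge0_integralZl_EFin//; last 2 first.
  + by move=> x _; rewrite lee_fin.
  + exact/measurable_EFinP.
  apply: eq_integral => x _ /=; under eq_integral do rewrite EFinM.
  rewrite ge0_integralZl_EFin//.
    by rewrite (int_subr x mP P0) PK_int// muleC.
  apply: (measurableT_comp mP) => //.
  exact: (measurableT_comp (@trans3_meas R x) (@opp3_meas R)).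
- rewrite mm_tonelli2; last 2 first.
  + apply/measurable_EFinP; apply: measurable_funM; [exact: m2_mm|exact: PK_mm_meas].
  + by move=> z; rewrite lee_fin mulr_ge0// PK_ge0.
  rewrite -ge0_integralZl_EFin//; last 2 first.
  + by move=> x _; rewrite lee_fin.
  + exact/measurable_EFinP.
  apply: eq_integral => y _ /=; under eq_integral do rewrite EFinM.
  rewrite ge0_integralZl_EFin//.
    by rewrite (int_subl y mP P0) PK_int// muleC.
  apply: (measurableT_comp mP) => //.
  under eq_fun do rewrite addrC; exact: (@trans3_meas R (- y)).
Qed.

(** A Schur test: |f(x) f(y)| is at most half the sum of the squares, and each square integrates
    against a kernel of total mass (2 pi)^3. *)
Lemma PK_bound f e : L2 mu f -> 0 < e ->
  (\int[mm]_z `|f z.1 * f z.2 * PK e (z.1 - z.2)|%:E <= ((2 * pi) ^+ 3 * n2 mu f ^+ 2)%:E)%E.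
Proof.
move=> Lf e0; have [mf f2] := Lf.
pose a x := f x ^+ 2.
have ma : measurable_fun setT a by apply: measurable_funX.
have a0 x : 0 <= a x by exact: sqr_ge0.
have [h1 h2] := PK_young e0 ma a0.
have mP := PK_mm_meas e0.
apply: (@le_trans _ _ (\int[mm]_z ((2^-1)%:E * ((a z.1 * PK e (z.1 - z.2))%:E + (a z.2 * PK e (z.1 - z.2))%:E)))%E).
  apply: ge0_le_integral => //.
  - apply/measurable_EFinP; apply: measurableT_comp => //; apply: measurable_funM => //.
    by apply: measurable_funM; [exact: m1_mm|exact: m2_mm].
  - apply: measurable_funeM; apply: emeasurable_funD; apply/measurable_EFinP.
      by apply: measurable_funM => //; exact: m1_mm.
    by apply: measurable_funM => //; exact: m2_mm.
  - move=> z _; rewrite -EFinD -EFinM lee_fin normrM (ger0_norm (PK_ge0 _ e0)).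
    rewrite -mulrDl mulrA ler_wpM2r ?PK_ge0// normrM /a.
    rewrite -(real_normK (num_real (f z.1))) -(real_normK (num_real (f z.2))).
    by have := sqr_ge0 (`|f z.1| - `|f z.2|); nra.
rewrite ge0_integralZl_EFin//; last 2 first.
- by move=> z _; rewrite adde_ge0// lee_fin mulr_ge0// PK_ge0.
- apply: emeasurable_funD; apply/measurable_EFinP.
    by apply: measurable_funM => //; exact: m1_mm.
  by apply: measurable_funM => //; exact: m2_mm.
rewrite ge0_integralD//; last 4 first.
- by move=> z _; rewrite lee_fin mulr_ge0// PK_ge0.
- by apply/measurable_EFinP; apply: measurable_funM => //; exact: m1_mm.
- by move=> z _; rewrite lee_fin mulr_ge0// PK_ge0.
- by apply/measurable_EFinP; apply: measurable_funM => //; exact: m2_mm.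
have h0 : (\int[mu]_x (a x)%:E)%E = (n2 mu f ^+ 2)%:E by exact: n2_eint.
rewrite h1 h2 h0.
change ((2^-1 * ((2 * pi) ^+ 3 * n2 mu f ^+ 2 + (2 * pi) ^+ 3 * n2 mu f ^+ 2))%:E <=
  ((2 * pi) ^+ 3 * n2 mu f ^+ 2)%:E)%E.
rewrite lee_fin le_eqVlt; apply/orP; left; apply/eqP.
by field.
Qed.

Lemma c0_pi : c0 R ^+ 2 * (2 * pi) ^+ 3 = 1.
Proof. by rewrite c0_sqr mulVf// gt_eqF// exprn_gt0// mulr_gt0// pi_gt0. Qed.

Lemma W_CST_eint f e : intg f -> 0 < e ->
  (\int[mu]_p (W e p * (CT f p ^+ 2 + ST f p ^+ 2))%:E =
   (c0 R ^+ 2 * \int[mm]_z (f z.1 * f z.2 * PK e (z.1 - z.2)))%:E)%E.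
Proof.
by move=> i e0; have [iW <-] := CST_W i e0; rewrite Rint_EFin.
Qed.

Lemma W_CST_le f e : intg f -> L2 mu f -> 0 < e ->
  (\int[mu]_p (W e p * (CT f p ^+ 2 + ST f p ^+ 2))%:E <= (n2 mu f ^+ 2)%:E)%E.
Proof.
move=> i Lf e0; rewrite W_CST_eint// lee_fin.
have [mf f2] := Lf; have mP := PK_mm_meas e0.
have mF : measurable_fun setT (fun z : R3 * R3 => f z.1 * f z.2 * PK e (z.1 - z.2)).
  apply: measurable_funM => //.
  by apply: measurable_funM; [exact: m1_mm|exact: m2_mm].
have iF : mm.-integrable setT (EFin \o (fun z : R3 * R3 => f z.1 * f z.2 * PK e (z.1 - z.2))).
  apply/integrableP; split; first exact/measurable_EFinP.
  exact: le_lt_trans (PK_bound Lf e0) (ltry _).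
rewrite -[leRHS]mul1r -c0_pi -mulrA ler_wpM2l ?sqr_ge0//.
apply: le_trans (ler_norm _) _.
apply: le_trans (le_normr_Rintegral measurableT iF) _.
rewrite -lee_fin Rint_EFin; first exact: PK_bound.
exact: integrable_norm iF.
Qed.

Lemma W_cvg p : W (n.+1%:R^-1) p @[n --> \oo] --> (1 : R).
Proof.
have H (t : R) : pw (n.+1%:R^-1) t @[n --> \oo] --> (1 : R).
  rewrite /pw -[X in _ --> X](expR0 R); apply: continuous_cvg; first exact: continuous_expR.
  rewrite -[X in _ --> X]oppr0 -(mul0r `|t|); apply: cvgN; apply: cvgMl.
  exact: cvg_harmonic.
have : W (n.+1%:R^-1) p @[n --> \oo] --> (1 * 1 * 1 : R).
  by apply: cvgM => //; exact: cvgM.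
by rewrite !mulr1.
Qed.

Lemma T0_contr f : intg f -> L2 mu f -> L2 mu (T0 f) /\ n2 mu (T0 f) <= n2 mu f.
Proof.
move=> i Lf; apply: L2_of_eint; [exact: T0_meas| |exact: n2_ge0].
rewrite T0_CST1//.
have mA : measurable_fun setT (fun p => CT f p ^+ 2 + ST f p ^+ 2).
  by apply: measurable_funD; apply: measurable_funX; [exact: CT_meas|exact: ST_meas].
apply: (fatou_le (g_ := fun n p => W (n.+1%:R^-1) p * (CT f p ^+ 2 + ST f p ^+ 2))).
- move=> n; apply: measurable_funM => //; apply: integrable_meas (W_intg _).
  by rewrite invr_gt0.
- by [].
- by move=> n x; rewrite mulr_ge0 ?addr_ge0 ?sqr_ge0// ltW// W_gt0.
- by move=> x; rewrite addr_ge0 ?sqr_ge0.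
- apply: nearW => x; rewrite -[X in _ --> X]mul1r; apply: cvgM; first exact: W_cvg.
  exact: cvg_cst.
- by move=> n; apply: W_CST_le => //; rewrite invr_gt0.
Qed.

(* Convolution of the indicator of an interval with the Poisson kernel. *)
Definition AI e (a b x : R) : R := 2 * (atan ((b - x) / e) - atan ((a - x) / e)).

Lemma atan_cont : continuous (@atan R).
Proof. exact: continuous_atan. Qed.

Lemma AI_cont e a b : continuous (AI e a b).
Proof.
move=> x; apply: cvgM; first exact: cvg_cst.
have H (c : R) : atan ((c - x0) / e) @[x0 --> x] --> atan ((c - x) / e).
  apply: continuous_cvg; first exact: atan_cont.
  apply: cvgM; last exact: cvg_cst.
  by apply: cvgB; [exact: cvg_cst|exact: cvg_id].
by apply: cvgB; exact: H.
Qed.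

Lemma AI_bound e (a b x : R) : 0 < e -> a < b -> 0 <= AI e a b x <= 2 * pi.
Proof.
move=> e0 ab; rewrite /AI.
have := atan_gtNpi2 ((a - x) / e); have := atan_ltpi2 ((b - x) / e).
have : atan ((a - x) / e) <= atan ((b - x) / e).
  by apply: le_atan; rewrite ler_pM2r ?invr_gt0// lerB// ltW.
move: (atan _) (atan _) (@pi R) => u v t; lra.
Qed.

(** The double integral of [pk e (x - y)] over x and y in ]a, b], with the inner integral already
    evaluated. *)
Definition IA e a b : R := \int[l1]_x (\1_(oc a b) x * AI e a b x).

Lemma IA_intg e a b : 0 < e -> a < b ->
  l1.-integrable setT (EFin \o (fun x : mR => \1_(oc a b) x * AI e a b x)).
Proof.
move=> e0 ab.
have i1 : l1.-integrable setT (EFin \o (\1_(oc a b) : mR -> R)).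
  apply/integrableP; split; first by apply/measurable_EFinP; exact: moc.
  under eq_integral do rewrite /= ger0_norm//.
  by rewrite int_oc ltry.
apply: (le_intg _ _ (intgZ (2 * pi) i1)).
  apply: measurable_funM; first exact: moc.
  exact: continuous_measurable_fun (@AI_cont e a b).
move=> x; have /andP[h1 h2] := AI_bound x e0 ab.
by rewrite normrM [`|AI _ _ _ _|]ger0_norm// [`|\1_ _ _|]ger0_norm// mulrC ler_wpM2r.
Qed.

Lemma IA_cvg a b : a < b ->
  IA (n.+1%:R^-1) a b @[n --> \oo] --> 2 * pi * (b - a).
Proof.
move=> ab.
have i1 : l1.-integrable setT (EFin \o (\1_(oc a b) : mR -> R)).
  apply/integrableP; split; first by apply/measurable_EFinP; exact: moc.
  under eq_integral do rewrite /= ger0_norm//.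
  by rewrite int_oc ltry.
have e0 n : 0 < n.+1%:R^-1 :> R by rewrite invr_gt0.
have lim (c x : R) : 0 < c - x -> atan ((c - x) / n.+1%:R^-1) @[n --> \oo] --> pi / 2.
  move=> cx; under eq_fun do rewrite invrK.
  have H : (c - x) * n.+1%:R @[n --> \oo] --> (+oo : set_system R).
    have Hn : n.+1%:R @[n --> \oo] --> (+oo : set_system R).
      by rewrite (cvg_shiftS (fun n : nat => n%:R : R)); exact: cvgr_idn.
    apply/cvgryPge => A; have /cvgryPge/(_ (A / (c - x))) := Hn.
    by apply: filterS => n; rewrite ler_pdivrMr// mulrC.
  by apply: (@cvg_comp _ _ _ (fun n : nat => (c - x) * n.+1%:R) (@atan R) \oo (+oo : set_system R)); [exact: H|exact: cvgy_atan].
have -> : 2 * pi * (b - a) = \int[l1]_t (2 * pi * \1_(oc a b) t).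
  rewrite RintZ// /Rintegral int_oc /=; congr (_ * _).
  by rewrite maxEle ifF// subr_le0 leNgt ab.
apply: (DCT (g := fun t : mR => 2 * pi * \1_(oc a b) t)).
- by move=> n; exact: integrable_meas (IA_intg (e0 n) ab).
- exact: integrable_meas (intgZ (2 * pi) i1).
(* The point [b] belongs to the half-open interval, but there [AI] tends to pi instead of 2 pi; it
   is discarded as a null set. *)
- exists [set b]; split => //; first exact: lebesgue_measure_set1.
  move=> t /= nt; apply: contrapT => tb; apply: nt.
  rewrite indicE; have [/set_mem|_] := boolP (t \in oc a b); last first.
    by under eq_fun do rewrite mul0r; rewrite mulr0; exact: cvg_cst.
  rewrite /oc /= in_itv /= => /andP[ax xleb].
  have xltb : (t : R) < b by rewrite lt_neqAle xleb andbT; apply/eqP.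
  rewrite mulr1; under eq_fun do rewrite mul1r /AI.
  have -> : 2 * pi = 2 * (pi / 2 - (- (pi / 2))) :> R by field.
  apply: cvgM; first exact: cvg_cst.
  apply: cvgB; first by apply: lim; rewrite subr_gt0.
  under eq_fun do rewrite -opprB mulNr atanN.
  by apply: cvgN; apply: lim; rewrite subr_gt0.
- exact: intgZ.
- move=> n t; have /andP[h1 h2] := AI_bound t (e0 n) ab.
  by rewrite normrM [`|AI _ _ _ _|]ger0_norm// [`|\1_ _ _|]ger0_norm// mulrC ler_wpM2r.
Qed.

Lemma PK_box e (a b : R3) : 0 < e -> a.1.1 < b.1.1 -> a.1.2 < b.1.2 -> a.2 < b.2 ->
  \int[mm]_z (\1_(box a b) z.1 * \1_(box a b) z.2 * PK e (z.1 - z.2)) =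
  IA e a.1.1 b.1.1 * IA e a.1.2 b.1.2 * IA e a.2 b.2.
Proof.
move=> e0 h1 h2 h3.
have mb : measurable_fun setT (\1_(box a b) : R3 -> R).
  by apply: measurable_indic; exact: measurable_box.
rewrite /Rintegral mm_tonelli1; last 2 first.
- apply/measurable_EFinP; apply: measurable_funM; last exact: PK_mm_meas.
  by apply: measurable_funM; [exact: m1_mm|exact: m2_mm].
- by move=> z; rewrite lee_fin mulr_ge0 ?PK_ge0.
have AI0 (u v t : R) : u < v -> 0 <= AI e u v t by move=> uv; have /andP[] := AI_bound t e0 uv.
have mk (t u v : R) : measurable_fun setT (fun y : mR => pk e (t - y) * \1_(oc u v) y).
  apply: measurable_funM; last exact: moc.
  apply: (measurableT_comp (pk_meas e0)); exact: measurable_funB.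
transitivity (fine (\int[mu]_x ((\1_(oc a.1.1 b.1.1) x.1.1 * AI e a.1.1 b.1.1 x.1.1) *
   (\1_(oc a.1.2 b.1.2) x.1.2 * AI e a.1.2 b.1.2 x.1.2) *
   (\1_(oc a.2 b.2) x.2 * AI e a.2 b.2 x.2))%:E)%E).
  congr fine; apply: eq_integral => x _ /=.
  transitivity (\int[mu]_y ((\1_(box a b) x)%:E *
     ((pk e (x.1.1 - y.1.1) * \1_(oc a.1.1 b.1.1) y.1.1) *
      (pk e (x.1.2 - y.1.2) * \1_(oc a.1.2 b.1.2) y.1.2) *
      (pk e (x.2 - y.2) * \1_(oc a.2 b.2) y.2))%:E))%E.
    apply: eq_integral => y _; rewrite -EFinM; congr EFin.
    by rewrite [\1_(box a b) y]indic_box /PK /=; ring.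
  have k0 (t u v y : R) : 0 <= pk e (t - y) * \1_(oc u v) y by rewrite mulr_ge0 ?pk_ge0.
  rewrite ge0_integralZl_EFin//; last 2 first.
  - by move=> y _; rewrite lee_fin; apply: mulr_ge0; first apply: mulr_ge0; exact: k0.
  - apply/measurable_EFinP; apply: measurable_funM; first apply: measurable_funM.
    + exact: (measurableT_comp (mk _ _ _) (@m11 R)).
    + exact: (measurableT_comp (mk _ _ _) (@m12 R)).
    + exact: (measurableT_comp (mk _ _ _) (@m2 R)).
  have := tonelli3 (mk x.1.1 a.1.1 b.1.1) (mk x.1.2 a.1.2 b.1.2) (mk x.2 a.2 b.2)
    (fun y : mR => k0 _ _ _ y) (fun y : mR => k0 _ _ _ y) (fun y : mR => k0 _ _ _ y).
  move=> ->; rewrite !pk_int_oc// -!EFinM; congr EFin.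
  by rewrite indic_box /AI; ring.
have mA (u v : R) : measurable_fun setT (fun x : mR => \1_(oc u v) x * AI e u v x).
  apply: measurable_funM; first exact: moc.
  exact: continuous_measurable_fun (@AI_cont e u v).
rewrite (tonelli3 (mA _ _) (mA _ _) (mA _ _)); last 3 first.
- by move=> x; rewrite mulr_ge0// AI0.
- by move=> x; rewrite mulr_ge0// AI0.
- by move=> x; rewrite mulr_ge0// AI0.
have i1 := IA_intg e0 h1; have i2 := IA_intg e0 h2; have i3 := IA_intg e0 h3.
by rewrite -(Rint_EFin i1) -(Rint_EFin i2) -(Rint_EFin i3).
Qed.

Lemma n2_box (a b : R3) : a.1.1 < b.1.1 -> a.1.2 < b.1.2 -> a.2 < b.2 ->
  n2 mu (\1_(box a b) : R3 -> R) ^+ 2 =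
  (b.1.1 - a.1.1) * (b.1.2 - a.1.2) * (b.2 - a.2).
Proof.
move=> h1 h2 h3; rewrite n2E /ip.
have -> : \int[mu]_x (\1_(box a b) x * \1_(box a b) x) = \int[mu]_x (\1_(box a b) x : R).
  by apply: eq_Rint => x; rewrite indicE; case: (_ \in _); rewrite ?mulr1 ?mulr0.
rewrite /Rintegral int_box /=.
have M (u v : R) : u < v -> Num.max (v - u) 0 = v - u.
  by move=> uv; rewrite maxEle ifF// subr_le0 leNgt uv.
by rewrite !M.
Qed.

(** As [W] is at most 1, weighted integrals bound the squared norm of the transform from below;
    [PK_box] makes them explicit products, which tend to the volume of the box because [c0 ^+ 2]
    cancels (2 pi)^3. *)
Lemma T0_box (a b : R3) : a.1.1 < b.1.1 -> a.1.2 < b.1.2 -> a.2 < b.2 ->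
  n2 mu (\1_(box a b) : R3 -> R) <= n2 mu (T0 (\1_(box a b) : R3 -> R)).
Proof.
move=> h1 h2 h3; have i := intg_box a b; have Lf := L2_box a b.
have [LT _] := T0_contr i Lf.
rewrite -(@ler_pXn2r _ 2)// ?nnegrE ?n2_ge0//.
have e0 n : 0 < n.+1%:R^-1 :> R by rewrite invr_gt0.
have mA : measurable_fun setT (fun p => CT (\1_(box a b) : R3 -> R) p ^+ 2 + ST (\1_(box a b) : R3 -> R) p ^+ 2).
  by apply: measurable_funD; apply: measurable_funX; [exact: CT_meas|exact: ST_meas].
have le n : c0 R ^+ 2 * (IA n.+1%:R^-1 a.1.1 b.1.1 * IA n.+1%:R^-1 a.1.2 b.1.2 * IA n.+1%:R^-1 a.2 b.2)
    <= n2 mu (T0 (\1_(box a b) : R3 -> R)) ^+ 2.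
  rewrite -PK_box// -lee_fin -(W_CST_eint i (e0 n)) -(n2_eint LT) T0_CST1//.
  apply: ge0_le_integral => //.
  - by move=> p _; rewrite lee_fin mulr_ge0 ?addr_ge0 ?sqr_ge0// ltW// W_gt0.
  - apply/measurable_EFinP; apply: measurable_funM => //; exact: integrable_meas (W_intg (e0 n)).
  - exact/measurable_EFinP.
  - move=> p _; rewrite lee_fin ler_piMl ?addr_ge0 ?sqr_ge0// W_le1//.
rewrite n2_box//.
have : c0 R ^+ 2 * (IA n.+1%:R^-1 a.1.1 b.1.1 * IA n.+1%:R^-1 a.1.2 b.1.2 * IA n.+1%:R^-1 a.2 b.2)
  @[n --> \oo] --> c0 R ^+ 2 * ((2 * pi * (b.1.1 - a.1.1)) * (2 * pi * (b.1.2 - a.1.2)) * (2 * pi * (b.2 - a.2))).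
  apply: cvgM; first exact: cvg_cst.
  by apply: cvgM; [apply: cvgM|]; exact: IA_cvg.
have -> : c0 R ^+ 2 * ((2 * pi * (b.1.1 - a.1.1)) * (2 * pi * (b.1.2 - a.1.2)) * (2 * pi * (b.2 - a.2))) =
   (c0 R ^+ 2 * (2 * pi) ^+ 3) * ((b.1.1 - a.1.1) * (b.1.2 - a.1.2) * (b.2 - a.2)) by ring.
rewrite c0_pi mul1r => cv.
rewrite -(cvg_lim (@Rhausdorff R) cv); apply: limr_le.
  by apply/cvg_ex; eexists; exact: cv.
exact: nearW.
Qed.

End contraction.

(** * The Hartley transform on L^2 *)

Section hartley.
Context (R : realType).
Local Notation R3 := (R3 R).
Local Notation mu := (leb3 R).
Local Notation intg f := (mu.-integrable setT (EFin \o f)).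
Local Notation L2 := (L2 mu).
Local Notation n2 := (n2 mu).
Local Notation ip := (ip mu).
Implicit Types (f g h : R3 -> R) (p x y z : R3).

Lemma T0B f g p : intg f -> intg g -> T0 (fun x => f x - g x) p = T0 f p - T0 g p.
Proof.
move=> i j; rewrite /T0 /CT /ST.
have -> : \int[mu]_x ((f x - g x) * cos (dot3 p x)) =
    \int[mu]_x (f x * cos (dot3 p x)) - \int[mu]_x (g x * cos (dot3 p x)).
  rewrite -RintB; [|exact: intg_cos..].
  by apply: eq_Rint => x; rewrite mulrBl.
have -> : \int[mu]_x ((f x - g x) * sin (dot3 p x)) =
    \int[mu]_x (f x * sin (dot3 p x)) - \int[mu]_x (g x * sin (dot3 p x)).
  rewrite -RintB; [|exact: intg_sin..].
  by apply: eq_Rint => x; rewrite mulrBl.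
ring.
Qed.

Lemma T0Z f c p : intg f -> T0 (fun x => c * f x) p = c * T0 f p.
Proof.
move=> i; rewrite /T0 /CT /ST.
have -> : \int[mu]_x ((c * f x) * cos (dot3 p x)) = c * \int[mu]_x (f x * cos (dot3 p x)).
  by rewrite -RintZ; [apply: eq_Rint => x; rewrite mulrA|exact: intg_cos].
have -> : \int[mu]_x ((c * f x) * sin (dot3 p x)) = c * \int[mu]_x (f x * sin (dot3 p x)).
  by rewrite -RintZ; [apply: eq_Rint => x; rewrite mulrA|exact: intg_sin].
ring.
Qed.

Lemma T0_sym f g : intg f -> L2 f -> intg g -> L2 g -> ip (T0 f) g = ip f (T0 g).
Proof.
move=> i Lf j Lg.
have K u v : intg u -> intg v -> \int[mu]_p (u p * T0 v p) =
    \int[mu]_p (u p * CT v p) + \int[mu]_p (u p * ST v p).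
  move=> iu iv; rewrite -RintD.
  - by apply: eq_Rint => p; rewrite /T0 mulrDr.
  - have := intgZ (c0 R) (K3_intg (@cosd_meas R) (@cosd_le R) iu iv).
    by apply: eq_integrable => // p _; rewrite /= /CT mulrCA.
  - have := intgZ (c0 R) (K3_intg (@sind_meas R) (@sind_le R) iu iv).
    by apply: eq_integrable => // p _; rewrite /= /ST mulrCA.
rewrite ipC; apply: etrans (K _ _ j i) _; rewrite (CT_sym i j) (ST_sym i j); apply/esym.
exact: K.
Qed.

Definition ball3 (n : nat) : set R3 := [set x | norm3 x <= n%:R].

Lemma dot3E (p : R3) : dot3 p p = p.1.1 ^+ 2 + p.1.2 ^+ 2 + p.2 ^+ 2.
Proof. by rewrite /dot3 -!expr2. Qed.

Lemma sqrt_meas : measurable_fun setT (fun t : measurableTypeR R => Num.sqrt t : R).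
Proof. exact: continuous_measurable_fun (@sqrt_continuous R). Qed.

Lemma dot3_diag_meas : measurable_fun setT (fun x : R3 => dot3 x x).
Proof.
rewrite (funext dot3E).
apply: measurable_funD; first apply: measurable_funD; apply: measurable_funX.
- exact: m11.
- exact: m12.
- exact: m2.
Qed.

Lemma norm3_meas : measurable_fun setT (fun x : R3 => norm3 x).
Proof. exact: measurableT_comp sqrt_meas dot3_diag_meas. Qed.

Lemma measurable_ball3 n : measurable (ball3 n).
Proof.
have := norm3_meas measurableT (measurable_itv `]-oo, (n%:R : R)]).
rewrite setTI; congr measurable; apply/seteqP; split => x /=; rewrite /ball3 /= in_itv //.
Qed.

Lemma dot3_ge0 x : 0 <= dot3 x x.
Proof. by rewrite /dot3 -!expr2 !addr_ge0// sqr_ge0. Qed.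

Lemma norm3_ge0 x : 0 <= norm3 x. Proof. exact: sqrtr_ge0. Qed.

Lemma norm3_sqr x : norm3 x ^+ 2 = dot3 x x.
Proof. by rewrite sqr_sqrtr// dot3_ge0. Qed.

Lemma norm3N x : norm3 (- x) = norm3 x.
Proof. by rewrite /norm3 dot3Nl dot3C dot3Nl opprK. Qed.

Lemma norm3_coord x : [/\ `|x.1.1 : R| <= norm3 x, `|x.1.2 : R| <= norm3 x & `|x.2 : R| <= norm3 x].
Proof.
have H (t : R) : t ^+ 2 <= dot3 x x -> `|t| <= norm3 x.
  move=> h; rewrite -(@ler_pXn2r _ 2)// ?nnegrE ?norm3_ge0//.
  by rewrite norm3_sqr real_normK ?num_real.
have h1 := sqr_ge0 (x.1.1 : R); have h2 := sqr_ge0 (x.1.2 : R); have h3 := sqr_ge0 (x.2 : R).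
by split; apply: H; rewrite /dot3 -!expr2; lra.
Qed.

Lemma L2_indic_ball n : L2 (\1_(ball3 n) : R3 -> R).
Proof.
(* The half-side is n + 1 because boxes are open on the left while the ball of radius n is
   closed. *)
pose b : R3 := ((n.+1%:R, n.+1%:R), n.+1%:R).
apply: (L2_le (g := \1_(box (- b) b))) (L2_box (- b) b).
  by apply: measurable_indic; exact: measurable_ball3.
move=> x; rewrite !ger0_norm// !indicE ler_nat.
have [/set_mem xB|//] := boolP (x \in ball3 n).
rewrite mem_set//; have [h1 h2 h3] := norm3_coord x.
have K (t : R) : `|t| <= norm3 x -> - n.+1%:R < t <= n.+1%:R.
  move=> tx; have : `|t| < n.+1%:R by apply: le_lt_trans tx _; apply: le_lt_trans xB _; rewrite ltr_nat.
  by rewrite ltr_norml => /andP[-> /ltW ->].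
by split; apply: K.
Qed.

(** The balls are those of [is_fourier], so that [HTn] is the Hartley counterpart of the truncated
    Fourier integrals occurring there. *)
Definition trunc3 f (n : nat) : R3 -> R := fun x => f x * \1_(ball3 n) x.

Lemma trunc_intg f n : L2 f -> intg (trunc3 f n).
Proof. by move=> Lf; apply: L2_mul => //; exact: L2_indic_ball. Qed.

Lemma trunc_meas f n : measurable_fun setT f -> measurable_fun setT (trunc3 f n).
Proof.
by move=> mf; apply: measurable_funM => //; apply: measurable_indic; exact: measurable_ball3.
Qed.

Lemma trunc_L2 f n : L2 f -> L2 (trunc3 f n).
Proof.
move=> Lf; apply: (L2_le (g := f)) => //; first by apply: trunc_meas; case: Lf.
by move=> x; rewrite /trunc3 indicE; case: (_ \in _); rewrite ?mulr1 ?mulr0 ?normr0.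
Qed.

Lemma trunc_cvg f : L2 f -> cvgL2 mu (trunc3 f) f.
Proof.
move=> Lf; have [mf f2] := Lf.
have E n : n2 (fun x => trunc3 f n x - f x) ^+ 2 = \int[mu]_x ((trunc3 f n x - f x) ^+ 2).
  by rewrite n2E; apply: eq_Rint => x; rewrite expr2.
have : \int[mu]_x ((trunc3 f n x - f x) ^+ 2) @[n --> \oo] --> \int[mu]_x (fun=> 0 : R) x.
  have mt n : measurable_fun setT (fun x => (trunc3 f n x - f x) ^+ 2).
    by apply: measurable_funX; exact: measurable_funB (trunc_meas n mf) mf.
  apply: (DCT mt (measurable_cst (0 : R)) _ f2).
  - apply: nearW => x; apply: cvg_near_cst; have : \forall n \near \oo, trunc3 f n x = f x.
      near=> n; rewrite /trunc3 indicE mem_set ?mulr1//= /ball3 /=; near: n.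
      by apply: filterS (nbhs_infty_gtr (norm3 x)) => n /ltW.
    by apply: filterS => n ->; rewrite subrr expr0n.
  - move=> n x; rewrite ger0_norm ?sqr_ge0// /trunc3 indicE.
    by case: (_ \in _); rewrite ?mulr1 ?subrr ?expr0n ?sqr_ge0// mulr0 sub0r sqrrN.
rewrite /Rintegral integral0 /= => H e e0.
have e2 : 0 < e ^+ 2 by rewrite exprn_gt0.
move/cvgr0Pnorm_le : H => /(_ _ e2) [N _ HN]; exists N => n Nn.
have := HN n Nn; rewrite /= -/(Rintegral mu setT _) -E ger0_norm ?sqr_ge0//.
by rewrite ler_pXn2r ?nnegrE ?n2_ge0// ltW.
Unshelve. all: by end_near. Qed.

Definition HTn f (n : nat) := T0 (trunc3 f n).

Lemma HTn_L2 f n : L2 f -> L2 (HTn f n).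
Proof. by move=> Lf; have [] := T0_contr (trunc_intg n Lf) (trunc_L2 n Lf). Qed.

Lemma HTnB f m n : L2 f -> n2 (fun p => HTn f m p - HTn f n p) <=
  n2 (fun x => trunc3 f m x - trunc3 f n x).
Proof.
move=> Lf; have im := trunc_intg m Lf; have in_ := trunc_intg n Lf.
rewrite (_ : (fun p => _) = T0 (fun x => trunc3 f m x - trunc3 f n x)); last first.
  by apply/funext => p; rewrite /HTn T0B.
have [] := T0_contr (intgB im in_) => //.
by apply: L2B; exact: trunc_L2.
Qed.

Lemma HTn_cauchy f : L2 f -> cauchyL2 mu (HTn f).
Proof.
move=> Lf e e0.
have [N HN] := cvgL2_cauchy (fun n => trunc_L2 n Lf) Lf (trunc_cvg Lf) e0.
by exists N => m n Nm Nn; apply: le_trans (HTnB _ _ Lf) _; exact: HN.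
Qed.

(** Stated for every [f], so that choice yields [HT] as a total function on representatives; outside
    L^2 its value is arbitrary. *)
Lemma HT_ex f : exists h, L2 f -> L2 h /\ cvgL2 mu (HTn f) h.
Proof.
have [Lf|nL] := pselect (L2 f); last by exists f.
have [h Lh ch] := complete_L2 (fun n => HTn_L2 n Lf) (HTn_cauchy Lf).
by exists h.
Qed.

Definition HT f : R3 -> R := projT1 (cid (HT_ex f)).

Lemma HT_L2 f : L2 f -> L2 (HT f).
Proof. by move=> Lf; have [] := projT2 (cid (HT_ex f)) Lf. Qed.

Lemma HT_cvg f : L2 f -> cvgL2 mu (HTn f) (HT f).
Proof. by move=> Lf; have [] := projT2 (cid (HT_ex f)) Lf. Qed.

Lemma HT_contr f : L2 f -> n2 (HT f) <= n2 f.
Proof.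
move=> Lf.
have c1 := cvgL2_n2 (fun n => HTn_L2 n Lf) (HT_L2 Lf) (HT_cvg Lf).
have c2 := cvgL2_n2 (fun n => trunc_L2 n Lf) Lf (trunc_cvg Lf).
apply: ler_cvg_to c1 c2 _; apply: nearW => n.
by have [] := T0_contr (trunc_intg n Lf) (trunc_L2 n Lf).
Qed.

(** [T0] is symmetric on truncations. The two truncation radii are sent to infinity one after the
    other, by continuity of the inner product in each argument. *)
Lemma HT_sym f g : L2 f -> L2 g -> ip (HT f) g = ip f (HT g).
Proof.
move=> Lf Lg.
have c1 := cvgL2_ip (fun n => HTn_L2 n Lf) (HT_L2 Lf) Lg (HT_cvg Lf).
have c2 := cvgL2_ip (fun n => HTn_L2 n Lg) (HT_L2 Lg) Lf (HT_cvg Lg).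
have H n m : ip (HTn f n) (trunc3 g m) = ip (HTn g m) (trunc3 f n).
  rewrite T0_sym; [by rewrite ipC|exact: trunc_intg|exact: trunc_L2|exact: trunc_intg|exact: trunc_L2].
have d1 m : ip (HT f) (trunc3 g m) = ip (HTn g m) f.
  have c3 := cvgL2_ip (fun n => HTn_L2 n Lf) (HT_L2 Lf) (trunc_L2 m Lg) (HT_cvg Lf).
  have c4 := cvgL2_ip (fun n => trunc_L2 n Lf) Lf (HTn_L2 m Lg) (trunc_cvg Lf).
  move: c4; under eq_fun do rewrite ipC -H; move=> c4.
  rewrite [RHS]ipC; exact: (cvg_unique _ c3 c4).
have c5 := cvgL2_ip (fun n => trunc_L2 n Lg) Lg (HT_L2 Lf) (trunc_cvg Lg).
move: c5; under eq_fun do rewrite ipC d1; move=> c5.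
by rewrite ipC [RHS]ipC; apply: (cvg_unique _ c5 c2).
Qed.

Lemma HT_T0 f : intg f -> L2 f -> HT f = T0 f %[ae mu].
Proof.
move=> i Lf; have [LT _] := T0_contr i Lf.
apply: (cvgL2_unique (u := HTn f)) => //; [by move=> n; exact: HTn_L2|exact: HT_L2|exact: HT_cvg|].
move=> e e0; have [N HN] := trunc_cvg Lf e0; exists N => n Nn.
rewrite (_ : (fun p => _) = T0 (fun x => trunc3 f n x - f x)); last first.
  by apply/funext => p; rewrite /HTn T0B//; exact: trunc_intg.
apply: le_trans (HN n Nn).
have [] := T0_contr (intgB (trunc_intg n Lf) i) => //.
by apply: L2B => //; exact: trunc_L2.
Qed.

Lemma ae_ip f g h : L2 f -> L2 g -> L2 h -> f = g %[ae mu] -> ip f h = ip g h.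
Proof.
move=> [mf _] [mg _] [mh _] fg; apply: ae_eq_Rint.
- exact: measurable_funM.
- exact: measurable_funM.
- by apply: filterS fg => x /(_ I) /= ->.
Qed.

Lemma n2_ip0 f : L2 f -> (forall g, L2 g -> ip f g = 0) -> f = (fun=> 0) %[ae mu].
Proof. by move=> Lf H; apply: n2_eq0 => //; rewrite /n2 H ?sqrtr0. Qed.

(** [HT] is chosen separately for each function, so linearity can only hold almost everywhere.
    Symmetry moves [HT] onto an arbitrary test function, where linearity of the inner product
    suffices. *)
Lemma HT_lin f g (c : R) : L2 f -> L2 g ->
  HT (fun x => f x + c * g x) = (fun p => HT f p + c * HT g p) %[ae mu].
Proof.
move=> Lf Lg; have Lcg := L2Z c Lg; have Lfg := L2D Lf Lcg.
have LH := HT_L2 Lfg; have Lr := L2D (HT_L2 Lf) (L2Z c (HT_L2 Lg)).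
have : (fun p => HT (fun x => f x + c * g x) p - (HT f p + c * HT g p)) = (fun=> 0) %[ae mu].
  apply: n2_ip0; first exact: L2B.
  move=> u Lu; have LHu := HT_L2 Lu.
  have LHf := HT_L2 Lf; have LHg := HT_L2 Lg.
  rewrite (ipBl LH Lr Lu) (HT_sym Lfg Lu) (ipDl Lf Lcg LHu) (ipZl c Lg LHu).
  by rewrite (ipDl LHf (L2Z c LHg) Lu) (ipZl c LHg Lu) !HT_sym// subrr.
apply: filterS => p /(_ I) /= /eqP; rewrite subr_eq0 => /eqP ->//.
Qed.

Lemma HT_ae f g : L2 f -> L2 g -> f = g %[ae mu] -> HT f = HT g %[ae mu].
Proof.
move=> Lf Lg fg; have LHf := HT_L2 Lf; have LHg := HT_L2 Lg.
have : (fun p => HT f p - HT g p) = (fun=> 0) %[ae mu].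
  apply: n2_ip0; first exact: L2B.
  move=> u Lu; have LHu := HT_L2 Lu.
  by rewrite ipBl// !HT_sym// (ae_ip Lf Lg LHu fg) subrr.
apply: filterS => p /(_ I) /= /eqP; rewrite subr_eq0 => /eqP ->//.
Qed.

(* [HT (HT h) - h] is orthogonal to every box, since a symmetric contraction
   squares to the identity on the vectors whose norm it preserves. *)
Lemma HTK h : L2 h -> HT (HT h) = h %[ae mu].
Proof.
move=> Lh.
(* By symmetry <HT (HT f), f> = |HT f|^2 = |f|^2, so |HT (HT f) - f|^2 is at most |f|^2 - 2 |f|^2 +
   |f|^2 = 0. *)
have fixd f : L2 f -> n2 f <= n2 (HT f) -> HT (HT f) = f %[ae mu].
  move=> Lf le_n; have LH := HT_L2 Lf; have LHH := HT_L2 LH.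
  apply: n2_ae0 => //.
  have E : ip (HT (HT f)) f = n2 f ^+ 2.
    rewrite HT_sym// -n2E; congr (_ ^+ 2); apply/eqP; rewrite eq_le le_n andbT.
    exact: HT_contr.
  have : n2 (fun x => HT (HT f) x - f x) ^+ 2 <= 0.
    rewrite n2E ipBl//; last exact: L2B.
    rewrite !ipBr// (ipC _ f) E -!n2E.
    have : n2 (HT (HT f)) ^+ 2 <= n2 f ^+ 2.
      rewrite lerXn2r ?nnegrE ?n2_ge0//.
      by apply: le_trans (HT_contr LH) _; exact: HT_contr.
    by lra.
  by rewrite exprn_even_le0//= => /eqP.
have LH := HT_L2 Lh; have LHH := HT_L2 LH; have LB := L2B LHH Lh.
apply: n2_ae0 => //.
suff : (fun x => HT (HT h) x - h x) = (fun=> 0) %[ae mu].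
  move=> H; rewrite (ae_n2 LB (L20 _) H); exact: n2_0.
apply: box_total => // a b.
have [[h1 h2 h3]|nab] := pselect [/\ a.1.1 < b.1.1, a.1.2 < b.1.2 & a.2 < b.2]; last first.
  have -> : box a b = set0.
    apply/seteqP; split => // x [] /andP[u1 u2] /andP[v1 v2] /andP[w1 w2].
    by apply: nab; split; [exact: lt_le_trans u2|exact: lt_le_trans v2|exact: lt_le_trans w2].
  by rewrite integral_set0.
have Lb := L2_box a b.
have bfix : HT (HT (\1_(box a b) : R3 -> R)) = \1_(box a b) %[ae mu].
  apply: fixd => //.
  have Hb := HT_T0 (intg_box a b) Lb.
  have [LT _] := T0_contr (intg_box a b) Lb.
  rewrite (ae_n2 (HT_L2 Lb) LT Hb); exact: T0_box.
have : ip (fun x => HT (HT h) x - h x) (\1_(box a b)) = 0.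
  rewrite ipBl// HT_sym// HT_sym//; last exact: HT_L2.
  have LHb := HT_L2 Lb.
  by rewrite [X in X - _]ipC (ae_ip (HT_L2 LHb) Lb Lh bfix) ipC subrr.
rewrite /ip => H0.
have ii := L2_mul LB Lb.
have := Rint_EFin ii; rewrite H0 => E0.
rewrite integral_mkcond -[RHS]/(0%:E : \bar R) E0; apply: eq_integral => x _.
by rewrite patchE indicE; case: ifP => _; rewrite ?mulr1 ?mulr0.
Qed.

Lemma HT_iso h : L2 h -> n2 (HT h) = n2 h.
Proof.
move=> Lh; apply/eqP; rewrite eq_le HT_contr//=.
have LH := HT_L2 Lh.
rewrite -(ae_n2 (HT_L2 LH) Lh (HTK Lh)); exact: HT_contr.
Qed.

End hartley.

(** * Fractional Laplacians and H^2 *)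

Section n2more.
Context d (T : measurableType d) (R : realType) (mu : {measure set T -> \bar R}).
Implicit Types f g : T -> R.

Lemma n2_le f g : L2 mu f -> L2 mu g -> (forall x, `|f x| <= `|g x|) -> n2 mu f <= n2 mu g.
Proof.
move=> Lf Lg fg; rewrite -(@ler_pXn2r _ 2)// ?nnegrE ?n2_ge0//.
rewrite -lee_fin -!n2_eint//; apply: ge0_le_integral => //.
- by move=> x _; rewrite lee_fin sqr_ge0.
- by apply/measurable_EFinP; apply: measurable_funX; case: Lf.
- by apply/measurable_EFinP; apply: measurable_funX; case: Lg.
by move=> x _; rewrite lee_fin -(real_normK (num_real (f x))) -(real_normK (num_real (g x))) lerXn2r ?nnegrE.
Qed.

Lemma n2_abs f : L2 mu f -> L2 mu (fun x => `|f x|) /\ n2 mu (fun x => `|f x|) = n2 mu f.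
Proof.
move=> Lf; have [mf _] := Lf; have L : L2 mu (fun x => `|f x|).
  apply: (L2_le _ _ Lf); last by move=> p; rewrite normr_id.
  exact: measurableT_comp (@normr_measurable R setT) mf.
by split=> //; apply/eqP; rewrite eq_le !n2_le// => x; rewrite normr_id.
Qed.

Lemma Lnorm2 f : L2 mu f -> ('N[mu]_2%:E[EFin \o f])%E = (n2 mu f)%:E.
Proof.
move=> Lf; rewrite unlock.
rewrite (_ : (\int[mu]_x _)%E = (n2 mu f ^+ 2)%:E).
  by rewrite poweR_EFin powR12_sqrt ?sqr_ge0// sqrtr_sqr ger0_norm// n2_ge0.
rewrite -n2_eint//; apply: eq_integral => x _ /=.
by rewrite powR_mulrn// real_normK ?num_real.
Qed.

Lemma L2norm_cvg0 (u : nat -> T -> R) : (forall n, L2 mu (u n)) ->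
  (fun n => 'N[mu]_2%:E[EFin \o u n])%E @ \oo --> 0%E <-> n2 mu (u n) @[n --> \oo] --> (0 : R).
Proof.
move=> Lu; rewrite (_ : (fun n => _) = EFin \o (fun n => n2 mu (u n))); last first.
  by apply/funext => n; rewrite Lnorm2.
split=> [/fine_cvgP[]//|H]; apply/fine_cvgP; split => //; exact: nearW.
Qed.
End n2more.

Section link.
Context (R : realType).
Local Notation R3 := (R3 R).
Local Notation mu := (leb3 R).
Local Notation intg f := (mu.-integrable setT (EFin \o f)).
Local Notation L2 := (L2 mu).
Local Notation n2 := (n2 mu).
Local Notation ip := (ip mu).
Implicit Types (f g h u v w : R3 -> R) (p x y z : R3).

Lemma L2_opp f : L2 f -> L2 (fun p => f (- p)).
Proof.
move=> [mf f2]; split; first exact: measurableT_comp mf (@opp3_meas R).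
exact: (integrable_inv (@opp3_meas R) (@leb3_opp R) f2).
Qed.

Lemma n2_opp f : L2 f -> n2 (fun p => f (- p)) = n2 f.
Proof.
move=> Lf; have [mf f2] := Lf; have Lo := L2_opp Lf.
apply/eqP; rewrite -(@eqrXn2 _ 2)// ?n2_ge0//; apply/eqP/EFin_inj; rewrite -!n2_eint//.
apply: (int_opp3 (F := fun x => (f x ^+ 2)%:E)) => [|x].
  by apply/measurable_EFinP; exact: measurable_funX.
by rewrite lee_fin sqr_ge0.
Qed.

Definition evenp f p := (f p + f (- p)) / 2.
Definition oddp f p := (f p - f (- p)) / 2.

Lemma evenpE f : evenp f = fun p => 2^-1 * (f p + f (- p)).
Proof. by apply/funext => p; rewrite /evenp mulrC. Qed.

Lemma oddpE f : oddp f = fun p => 2^-1 * (f p - f (- p)).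
Proof. by apply/funext => p; rewrite /oddp mulrC. Qed.

Lemma L2_evenp f : L2 f -> L2 (evenp f).
Proof. by move=> Lf; rewrite evenpE; apply: L2Z; apply: L2D => //; exact: L2_opp. Qed.

Lemma L2_oddp f : L2 f -> L2 (oddp f).
Proof. by move=> Lf; rewrite oddpE; apply: L2Z; apply: L2B => //; exact: L2_opp. Qed.

Lemma n2_evenp f : L2 f -> n2 (evenp f) <= n2 f.
Proof.
move=> Lf; have Lo := L2_opp Lf; rewrite evenpE n2Z; last exact: L2D.
have := n2D Lf Lo; rewrite n2_opp// ger0_norm ?invr_ge0//.
by move: (n2 _) (n2 _) => a b; lra.
Qed.

Lemma n2_oddp f : L2 f -> n2 (oddp f) <= n2 f.
Proof.
move=> Lf; have Lo := L2_opp Lf; rewrite oddpE n2Z; last exact: L2B.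
have := n2D Lf (L2N Lo); rewrite n2N// n2_opp// ger0_norm ?invr_ge0//.
by move: (n2 _) (n2 _) => a b; lra.
Qed.

Lemma CT_evenp f : intg f -> CT f = evenp (T0 f).
Proof.
by move=> i; apply/funext => p; rewrite /evenp /T0 CT_even ST_odd//; field.
Qed.

Lemma ST_oddp f : intg f -> ST f = oddp (T0 f).
Proof.
by move=> i; apply/funext => p; rewrite /oddp /T0 CT_even ST_odd//; field.
Qed.

Lemma fourier_onE (D : set R3) f p :
  fourier_on D f p = Complex (CT (fun x => f x * \1_D x) p) (- ST (fun x => f x * \1_D x) p).
Proof.
have H (h : R3 -> R) : \int[mu]_(x in D) (f x * h x) = \int[mu]_x (f x * \1_D x * h x).
  rewrite Rintegral_mkcond; apply: eq_Rint => x; rewrite patchE indicE.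
  by case: ifP => _; rewrite ?mulr1// mulr0 mul0r.
apply/eqP; rewrite eq_complex /= /CT /ST -/(c0 R) !H.
by apply/andP; split; apply/eqP; ring.
Qed.

Lemma fourier_on_ball n f p :
  fourier_on [set x : R3 | norm3 x <= n%:R] f p =
  Complex (CT (trunc3 f n) p) (- ST (trunc3 f n) p).
Proof. exact: fourier_onE. Qed.

Lemma fourier_onT f p : fourier_on setT f p = Complex (CT f p) (- ST f p).
Proof.
rewrite fourier_onE; congr (Complex (CT _ p) (- ST _ p));
  by apply/funext => x; rewrite indicT mulr1.
Qed.

Definition fhart (F : R3 -> R[i]) p : R := complex.Re (F p) - complex.Im (F p).

Definition hfour f : R3 -> R[i] := fun p => Complex (evenp f p) (- oddp f p).

Lemma Lfun1P f : f \in Lfun mu 1 <-> intg f.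
Proof. exact: Lfun1_integrable. Qed.

Definition fdist f (F : R3 -> R[i]) n p : R :=
  Normc.normc (F p - fourier_on [set x | norm3 x <= n%:R] f p).

Lemma fdistE f F n p : fdist f F n p =
  Num.sqrt ((complex.Re (F p) - CT (trunc3 f n) p) ^+ 2 +
            (complex.Im (F p) + ST (trunc3 f n) p) ^+ 2).
Proof. by rewrite /fdist fourier_on_ball; case: (F p) => a b /=; rewrite opprK. Qed.

Lemma L2_CT f : intg f -> L2 f -> L2 (CT f).
Proof. by move=> i Lf; rewrite CT_evenp//; apply: L2_evenp; have [] := T0_contr i Lf. Qed.

Lemma L2_ST f : intg f -> L2 f -> L2 (ST f).
Proof. by move=> i Lf; rewrite ST_oddp//; apply: L2_oddp; have [] := T0_contr i Lf. Qed.

Lemma fdist_L2 f F n : L2 f -> L2 (fun p => complex.Re (F p)) ->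
  L2 (fun p => complex.Im (F p)) -> L2 (fdist f F n).
Proof.
move=> Lf LR LI; have i := trunc_intg n Lf; have Lt := trunc_L2 n Lf.
have [m1 q1] := L2B LR (L2_CT i Lt); have [m2 q2] := L2D LI (L2_ST i Lt).
have E : fdist f F n = fun p => Num.sqrt ((complex.Re (F p) - CT (trunc3 f n) p) ^+ 2 +
            (complex.Im (F p) + ST (trunc3 f n) p) ^+ 2).
  by apply/funext => p; rewrite fdistE.
split.
  rewrite E; apply: (measurableT_comp (@sqrt_meas R)).
  by apply: measurable_funD; exact: measurable_funX.
have := intgD q1 q2; congr (integrable _ _ _); apply/funext => p /=.
by rewrite E sqr_sqrtr// addr_ge0// sqr_ge0.
Qed.

(** Whichever clause of [is_fourier] supplies [F], its Hartley form must be [HT f]. In the L^2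
    clause the errors of the real and of the imaginary part are each dominated by the modulus
    [fdist]. *)
Lemma fourier_HT f F : L2 f -> is_fourier f F -> fhart F = HT f %[ae mu].
Proof.
move=> Lf [[/Lfun1P i FE]|[_ [/Lfun2P LR /Lfun2P LI] /L2norm_cvg0 H]].
  apply: filterS (HT_T0 i Lf) => p /(_ I) -> _.
  by rewrite /fhart FE fourier_onT /= opprK.
apply: (cvgL2_unique (u := HTn f)); [by move=> n; exact: HTn_L2|exact: L2B|exact: HT_L2| |exact: HT_cvg].
have Ld n := fdist_L2 n Lf LR LI.
have {}H := H Ld.
move=> e e0; have e2 : 0 < e / 2 by rewrite divr_gt0.
move/cvgr0Pnorm_le : H => /(_ _ e2) [N _ HN]; exists N => n Nn.
have := HN n Nn; rewrite /= ger0_norm ?n2_ge0// -/(fdist f F n) => dn; have Lfd := Ld n.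
have i := trunc_intg n Lf; have Lt := trunc_L2 n Lf.
have L1 := L2B (L2_CT i Lt) LR; have L3 := L2D (L2_ST i Lt) LI.
rewrite (_ : (fun p => _) = (fun p => (CT (trunc3 f n) p - complex.Re (F p)) +
   (ST (trunc3 f n) p + complex.Im (F p)))); last first.
  by apply/funext => p; rewrite /fhart /HTn /T0; ring.
apply: le_trans (n2D L1 L3) _.
have B1 : n2 (fun p => CT (trunc3 f n) p - complex.Re (F p)) <= e / 2.
  apply: le_trans dn; apply: n2_le Lfd _ => // p; rewrite distrC fdistE (ger0_norm (sqrtr_ge0 _)).
  by rewrite -sqrtr_sqr ler_sqrt ?addr_ge0 ?sqr_ge0// lerDl sqr_ge0.
have B2 : n2 (fun p => ST (trunc3 f n) p + complex.Im (F p)) <= e / 2.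
  apply: le_trans dn; apply: n2_le Lfd _ => // p; rewrite addrC fdistE (ger0_norm (sqrtr_ge0 _)).
  by rewrite -sqrtr_sqr ler_sqrt ?addr_ge0 ?sqr_ge0// lerDr sqr_ge0.
by rewrite [leRHS]splitr lerD.
Qed.

(** Serves the data [f] and [K], which are given as integrable functions; their transform is then
    the integral [T0] rather than the L^2 limit [HT]. *)
Lemma fourier_T0 f F : intg f -> is_fourier f F -> fhart F = T0 f %[ae mu].
Proof.
move=> i fF; have [[_ FE]|[/Lfun2P Lf _ _]] := fF.
  by apply: nearW => p _; rewrite /fhart FE fourier_onT /= opprK.
apply: filterS2 (fourier_HT Lf fF) (HT_T0 i Lf) => p H1 H2 _.
by rewrite H1// H2.
Qed.

(** The modulus of the truncation error is at most the sum of the absolute even and odd parts of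
    [HTn f n - HT f], and taking these parts does not increase the L^2 norm. *)
Lemma is_fourier_hfour f : L2 f -> is_fourier f (hfour (HT f)).
Proof.
move=> Lf; have LH := HT_L2 Lf; right; split; first exact/Lfun2P.
  split; apply/Lfun2P; first exact: L2_evenp.
  by apply: L2N; exact: L2_oddp.
have LR := L2_evenp LH; have LI := L2N (L2_oddp LH).
apply/(@L2norm_cvg0 _ _ _ mu (fdist f (hfour (HT f)))); first by move=> n; exact: fdist_L2.
apply/cvgr0Pnorm_le => e e0; have e2 : 0 < e / 2 by rewrite divr_gt0.
have [N HN] := HT_cvg Lf e2; exists N => //= n Nn; have dn := HN n Nn.
rewrite ger0_norm ?n2_ge0//.
have i := trunc_intg n Lf; have Lt := trunc_L2 n Lf.
have LD := L2B (HTn_L2 n Lf) LH.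
have LE := L2_evenp LD; have LO := L2_oddp LD.
have [Ln1 En1] := n2_abs LE; have [Ln2 En2] := n2_abs LO.
have Lfd : L2 (fdist f (hfour (HT f)) n) by exact: fdist_L2.
apply: le_trans; first apply: (n2_le Lfd (L2D Ln1 Ln2)).
  move=> p; rewrite fdistE /hfour /=.
  rewrite ger0_norm ?sqrtr_ge0// [leRHS]ger0_norm ?addr_ge0//.
  rewrite -(@ler_pXn2r _ 2)// ?nnegrE ?sqrtr_ge0 ?addr_ge0//.
  rewrite sqr_sqrtr ?addr_ge0 ?sqr_ge0// [leRHS]sqrrD !real_normK ?num_real//.
  rewrite (_ : evenp (HT f) p - CT (trunc3 f n) p = - evenp (fun x => HTn f n x - HT f x) p); last first.
    by rewrite CT_evenp// /evenp /HTn; ring.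
  rewrite (_ : - oddp (HT f) p + ST (trunc3 f n) p = oddp (fun x => HTn f n x - HT f x) p); last first.
    by rewrite ST_oddp// /oddp /HTn; ring.
  by rewrite sqrrN addrAC lerDl mulrn_wge0// mulr_ge0.
apply: le_trans (n2D Ln1 Ln2) _; rewrite En1 En2 [leRHS]splitr lerD//.
- by apply: le_trans dn; exact: n2_evenp.
- by apply: le_trans dn; exact: n2_oddp.
Qed.

Lemma ae_opp (P : R3 -> Prop) : (\forall p \ae mu, P p) -> \forall p \ae mu, P (- p).
Proof. exact: (ae_inv (@opp3_meas R) (@leb3_opp R)). Qed.

Definition symb s p : R := norm3 p `^ (2 * s).

Lemma symbN s p : symb s (- p) = symb s p.
Proof. by rewrite /symb norm3N. Qed.

Lemma symb_ge0 s p : 0 <= symb s p.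
Proof. exact: powR_ge0. Qed.

Lemma symb_meas s : measurable_fun setT (symb s : R3 -> R).
Proof. exact: measurableT_comp (@measurable_powR R (2 * s)) (@norm3_meas R). Qed.

Lemma symb1 p : symb 1 p = norm3 p ^+ 2.
Proof. by rewrite /symb mulr1 powR_mulrn// norm3_ge0. Qed.

(** The symbol is real and even, so multiplication by it respects even and odd parts and the Fourier
    relation is equivalent to the Hartley one. The converse reads the Hartley relation at both [p]
    and [- p]. *)
Lemma is_fraclapP s u w : L2 u ->
  is_fraclap s u w <-> L2 w /\ HT w = (fun p => symb s p * HT u p) %[ae mu].
Proof.
move=> Lu; split=> [[/Lfun2P Lw [U [W [uU wW E]]]]|[Lw E]].
  split=> //; apply: filterS3 (fourier_HT Lu uU) (fourier_HT Lw wW) E => p h1 h2 h3 _.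
  rewrite -h1// -h2// /fhart h3 -/(symb s p); case: (U p) => a b /=; ring.
split; first exact/Lfun2P.
exists (hfour (HT u)), (hfour (HT w)); split; [exact: is_fourier_hfour..|].
apply: filterS2 E (ae_opp E) => p /(_ I) h1 /(_ I) h2.
apply/eqP; rewrite eq_complex /= /evenp /oddp h1 h2 symbN -/(symb s p).
by apply/andP; split; apply/eqP; ring.
Qed.

Lemma is_fraclap_T0 s u w : intg u -> is_fraclap s u w ->
  L2 w /\ HT w = (fun p => symb s p * T0 u p) %[ae mu].
Proof.
move=> iu [/Lfun2P Lw [U [W [uU wW E]]]]; split => //.
apply: filterS3 (fourier_T0 iu uU) (fourier_HT Lw wW) E => p h1 h2 h3 _.
rewrite -h1// -h2// /fhart h3 -/(symb s p); case: (U p) => a b /=; ring.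
Qed.

Lemma fraclap_get s u : fraclap_in_L2 s u -> is_fraclap s u (fraclap s u).
Proof. by move=> [w uw]; exact: (getPex (ex_intro [set w | is_fraclap s u w] w uw)). Qed.

Lemma fraclap_in_L2P s u : L2 u -> fraclap_in_L2 s u <-> L2 (fun p => symb s p * HT u p).
Proof.
move=> Lu; have [mH _] := HT_L2 Lu; have ms := symb_meas s.
split=> [[w /(is_fraclapP _ _ Lu)[Lw E]]|L].
  by apply: (L2_ae _ E); [exact: measurable_funM|exact: HT_L2].
(* Since [HT] is an involution, transforming the multiplied function back gives the fractional
   Laplacian. *)
exists (HT (fun p => symb s p * HT u p)); apply/(is_fraclapP _ _ Lu); split; first exact: HT_L2.
exact: HTK.
Qed.

Lemma H2sP s u : H2s s u <-> L2 u /\ L2 (fun p => symb s p * HT u p).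
Proof.
split=> [[/Lfun2P Lu /(fraclap_in_L2P _ Lu)]//|[Lu L]].
by split; [exact/Lfun2P|exact/fraclap_in_L2P].
Qed.

Lemma fraclap_hat s u : L2 u -> L2 (fun p => symb s p * HT u p) ->
  L2 (fraclap s u) /\ HT (fraclap s u) = (fun p => symb s p * HT u p) %[ae mu].
Proof. by move=> Lu /(fraclap_in_L2P _ Lu)/fraclap_get/(is_fraclapP _ _ Lu). Qed.

Lemma L2normE u : L2 u -> L2norm u = n2 u.
Proof. by move=> Lu; rewrite /L2norm Lnorm2. Qed.

(** 1 + |p|^4 adds the squared symbols of the identity and of the Laplacian; weighting by its root
    turns the H^2 norm into an L^2 norm. *)
Definition h2w p : R := Num.sqrt (1 + norm3 p ^+ 4).

Lemma h2w_sqr p : h2w p ^+ 2 = 1 + norm3 p ^+ 4.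
Proof. by rewrite sqr_sqrtr// addr_ge0// exprn_ge0// norm3_ge0. Qed.

Lemma h2w_ge1 p : 1 <= h2w p.
Proof. by rewrite -[X in X <= _]sqrtr1 ler_sqrt ?lerDl ?addr_ge0// exprn_ge0// norm3_ge0. Qed.

Lemma h2w_meas : measurable_fun setT (h2w : R3 -> R).
Proof.
apply: (measurableT_comp (@sqrt_meas R)).
by apply: measurable_funD => //; apply: measurable_funX; exact: norm3_meas.
Qed.

Lemma L2_h2w h : measurable_fun setT h ->
  L2 (fun p => h2w p * h p) <-> L2 h /\ L2 (fun p => symb 1 p * h p).
Proof.
move=> mh; have mhw := h2w_meas; have ms := symb_meas 1; split=> [L|[[_ i1] [_ i2]]].
  split; (apply: L2_le L; [exact: measurable_funM || exact: mh|move=> p]);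
    rewrite !normrM (ger0_norm (le_trans ler01 (h2w_ge1 p))).
  - by rewrite -[X in X <= _]mul1r ler_wpM2r// h2w_ge1.
  - rewrite ler_wpM2r// ger0_norm ?symb_ge0//.
    rewrite -(@ler_pXn2r _ 2)// ?nnegrE ?symb_ge0 ?sqrtr_ge0// h2w_sqr symb1 -exprM.
    by rewrite lerDr.
split; first exact: measurable_funM.
have := intgD i1 i2; congr (integrable _ _ _); apply/funext => p /=.
by rewrite !exprMn h2w_sqr symb1 -exprM; congr EFin; ring.
Qed.

Lemma H2P u : H2s 1 u <-> L2 u /\ L2 (fun p => h2w p * HT u p).
Proof.
split=> [/H2sP[Lu L]|[Lu]]; have LH := HT_L2 Lu; have [mH _] := LH.
  by split=> //; apply/L2_h2w.
by move/(L2_h2w mH) => [_ L]; apply/H2sP.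
Qed.

Lemma H2_normE u : H2s 1 u -> H2s_norm 1 u = n2 (fun p => h2w p * HT u p).
Proof.
move=> Hu; have [Lu L] := (H2sP 1 u).1 Hu; have [_ Lw] := (H2P u).1 Hu.
have [Lf E] := fraclap_hat Lu L.
rewrite /H2s_norm !L2normE// -(HT_iso Lu) -(HT_iso Lf) (ae_n2 (HT_L2 Lf) L E).
rewrite -[RHS]ger0_norm ?n2_ge0// -sqrtr_sqr; congr Num.sqrt.
have LH := HT_L2 Lu.
apply: EFin_inj; rewrite EFinD -!n2_eint// -ge0_integralD//; last first.
- by apply/measurable_EFinP; apply: measurable_funX; case: L.
- by move=> x _; rewrite lee_fin sqr_ge0.
- by apply/measurable_EFinP; apply: measurable_funX; case: LH.
- by move=> x _; rewrite lee_fin sqr_ge0.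
apply: eq_integral => p _; rewrite -EFinD !exprMn h2w_sqr symb1 -exprM.
by congr EFin; ring.
Qed.

End link.

(** * Integral of a radial power over a ball *)

Section radial.
Context (R : realType).
Local Notation R3 := (R3 R).
Local Notation mu := (leb3 R).
Local Notation mR := (measurableTypeR R).
Local Notation l1 := (@lebesgue_measure R).

(** An indicator that allows |p| <= r and t |p| <= 1 to be expressed through [dot3 p p], without
    square roots. *)
Definition step (t : R) : R := (0 <= t)%R%:R.

Lemma step_ge0 t : 0 <= step t. Proof. by rewrite /step ler0n. Qed.

Lemma step_meas : measurable_fun setT (step : mR -> R).
Proof.
have -> : step = \1_(`[0, +oo[%classic) :> (mR -> R).
  by apply/funext => t; rewrite indicE /step mem_setE in_itv/= andbT.
by apply: measurable_indic; exact: measurable_itv.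
Qed.

Lemma sqr_le_sqrt (c x : R) : 0 <= c -> (x ^+ 2 <= c) = (- Num.sqrt c <= x <= Num.sqrt c).
Proof.
move=> c0; rewrite -ler_norml -(@ler_pXn2r _ 2 _ `|x|)// ?nnegrE ?sqrtr_ge0//.
by rewrite sqr_sqrtr// real_normK ?num_real.
Qed.

Lemma itv_int (a b : R) : a <= b -> (\int[l1]_(x in `[a, b]) 1%:E = (b - a)%:E)%E.
Proof.
move=> ab; rewrite integral_cst ?mul1e; last exact: measurable_itv.
rewrite [LHS](lebesgue_measure_itv `[a, b])/= lte_fin; case: ltP => // ba.
by have -> : a = b by [apply/eqP; rewrite eq_le ab]; rewrite subrr.
Qed.

Lemma int_mask (D : set mR) (h : mR -> R) : (\int[l1]_(x in D) (h x)%:E = \int[l1]_x (\1_D x * h x)%:E)%E.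
Proof.
rewrite integral_mkcond; apply: eq_integral => x _; rewrite patchE indicE.
by case: ifP => _; rewrite ?mul1r ?mul0r.
Qed.

Lemma chord_int c : (\int[l1]_x (step (c - x ^+ 2))%:E = (2 * Num.sqrt c)%:E)%E.
Proof.
have [c0|c0] := leP 0 c; last first.
  rewrite ltr0_sqrtr// mulr0; apply: integral0_eq => x _.
  by rewrite /step subr_ge0 leNgt (lt_le_trans c0 (sqr_ge0 _)).
have s0 := sqrtr_ge0 c.
transitivity (\int[l1]_(x in `[(- Num.sqrt c)%R, Num.sqrt c]) 1%:E)%E.
  rewrite [RHS]int_mask; apply: eq_integral => x _.
  by rewrite mulr1 indicE /step subr_ge0 mem_setE in_itv/= sqr_le_sqrt.
by rewrite itv_int; [congr EFin; ring|lra].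
Qed.

(** The area of a disc, by the substitution y = r sin t: the integrand becomes 2 c cos^2 t, with
    primitive c (t + sin t cos t). *)
Lemma disc_int c : (\int[l1]_y (2 * Num.sqrt (c - y ^+ 2)%R)%:E = (pi * Num.max c 0)%:E)%E.
Proof.
have [c0|c0] := leP c 0.
  rewrite mulr0; apply: integral0_eq => y _.
  by rewrite ler0_sqrtr ?mulr0// subr_le0 (le_trans c0)// sqr_ge0.
pose r := Num.sqrt c; have r0 : 0 < r by rewrite sqrtr_gt0.
have rr : r ^+ 2 = c by rewrite sqr_sqrtr// ltW.
pose G (y : R) := 2 * Num.sqrt (c - y ^+ 2).
pose F (t : R) := r * sin t.
have pi2 : - (pi / 2) < pi / 2 :> R by have := @pi_gt0 R; lra.
transitivity (\int[l1]_(y in `[F (- (pi / 2))%R, F (pi / 2)%R]) (G y)%:E)%E.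
  rewrite [RHS]int_mask; apply: eq_integral => y _; rewrite indicE mem_setE in_itv/=.
  rewrite /F sinN sin_pihalf mulrN mulr1 -(sqr_le_sqrt _ (ltW c0)).
  by rewrite /G; case: leP => h; rewrite ?mul1r// mul0r ltr0_sqrtr ?mulr0// subr_lt0.
have dF (t : R) : is_derive t 1 F (r * cos t) by rewrite /F; apply: is_derive_eq.
have DF : derive1 F = fun t => r * cos t.
  by apply/funext => t; rewrite derive1E; have [_ ->] := dF t.
have cF := is_derive_cont dF.
have cDF : continuous (fun t => r * cos t).
  by move=> t; apply: cvgM; [exact: cvg_cst|exact: continuous_cos].
rewrite integration_by_substitution_increasing ?ltW//; last 6 first.
- move=> x y xI yI xy; by rewrite /F ltr_pM2l// ltr_sin.
- by rewrite DF => t _; exact: cDF.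
- by rewrite DF; apply/cvg_ex; eexists; apply: cvg_at_right_filter; exact: cDF.
- by rewrite DF; apply/cvg_ex; eexists; apply: cvg_at_left_filter; exact: cDF.
- split.
  + by move=> t _; have [] := dF t.
  + by apply: cvg_at_right_filter; exact: cF.
  + by apply: cvg_at_left_filter; exact: cF.
- apply: continuous_subspaceT => t; apply: cvgM; first exact: cvg_cst.
  apply: continuous_comp; last exact: sqrt_continuous.
  by apply: cvgB; [exact: cvg_cst|exact: exprn_continuous].
have dP (t : R) : is_derive t 1 (fun t => c * (t + sin t * cos t)) (2 * c * cos t ^+ 2).
  apply: is_derive_eq; rewrite /GRing.scale /=.
  have := cos2Dsin2 t; move: (cos t) (sin t) => a b; nra.
have cP : continuous (fun t : R => 2 * c * cos t ^+ 2).
  rewrite (_ : (fun t => _) = (fun t => 2 * c * (cos t * cos t))); last first.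
    by apply/funext => t; rewrite expr2.
  by move=> t; apply: cvgM; [exact: cvg_cst|apply: cvgM; exact: continuous_cos].
transitivity (\int[l1]_(t in `[(- (pi / 2))%R, (pi / 2)%R]) (2 * c * cos t ^+ 2)%:E)%E.
  apply: eq_integral => t; rewrite inE/= in_itv/= => tI.
  have ct : 0 <= cos t by apply: cos_ge0_pihalf.
  congr EFin; rewrite /= DF.
  transitivity (2 * Num.sqrt (c - (r * sin t) ^+ 2) * (r * cos t)); first by [].
  have -> : c - (r * sin t) ^+ 2 = (r * cos t) ^+ 2.
    by rewrite !exprMn rr; have := cos2Dsin2 t; move: (cos t) (sin t) => a b; nra.
  rewrite sqrtr_sqr ger0_norm; last by rewrite mulr_ge0// ltW.
  by rewrite -rr; ring.
rewrite (FTC_itv pi2 dP cP) !sinN !cosN cos_pihalf; congr EFin.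
by field.
Qed.

(** The volume of a ball by slicing: a chord in the first coordinate, a disc in the first two, and
    pi (r^2 - z^2) integrated over the third. *)
Lemma ball_int r : 0 <= r ->
  (\int[mu]_p (step (r ^+ 2 - dot3 p p))%:E = (4 / 3 * pi * r ^+ 3)%:E)%E.
Proof.
move=> r0.
have m (h : R3 -> R) : measurable_fun setT h -> measurable_fun setT (fun p : R3 => (step (h p))%:E).
  by move=> mh; apply/measurable_EFinP; exact: measurableT_comp step_meas mh.
have mm (h : mR * mR -> R) : measurable_fun setT h -> measurable_fun setT (fun p : mR * mR => (step (h p))%:E).
  by move=> mh; apply/measurable_EFinP; exact: measurableT_comp step_meas mh.
rewrite (@fubini_tonelli2 _ _ _ _ _ (prodsf l1 l1) l1 (fun p : R3 => (step (r ^+ 2 - dot3 p p))%:E)); last 2 first.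
- apply: m; apply: measurable_funB => //.
  exact: dot3_diag_meas.
- by move=> p; rewrite lee_fin step_ge0.
have E (z : mR) : (\int[prodsf l1 l1]_w (step (r ^+ 2 - dot3 ((w, z) : R3) (w, z)))%:E =
    (pi * Num.max (r ^+ 2 - z ^+ 2) 0)%:E)%E.
  rewrite (@fubini_tonelli2 _ _ _ _ _ l1 l1 (fun w : mR * mR => (step (r ^+ 2 - dot3 ((w, z) : R3) (w, z)))%:E)); last 2 first.
  - apply: mm; apply: measurable_funB => //.
    have -> : (fun w : mR * mR => dot3 ((w, z) : R3) (w, z)) = (fun w => w.1 ^+ 2 + w.2 ^+ 2 + z ^+ 2).
      by apply/funext => x; rewrite dot3E.
    apply: measurable_funD => //; apply: measurable_funD; apply: measurable_funX.
    + exact: measurable_fst.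
    + exact: measurable_snd.
  - by move=> w; rewrite lee_fin step_ge0.
  rewrite -disc_int; apply: eq_integral => y _; rewrite -chord_int; apply: eq_integral => x _.
  by rewrite dot3E/=; congr (step _)%:E; ring.
transitivity (\int[l1]_(z in `[(- r)%R, r]) (pi * (r ^+ 2 - z ^+ 2))%:E)%E.
  rewrite [RHS]int_mask; apply: eq_integral => z _; rewrite /fubini_G [LHS]E indicE mem_setE in_itv/=.
  have -> : (- r <= z <= r) = (z ^+ 2 <= r ^+ 2).
    by rewrite sqr_le_sqrt ?sqr_ge0// sqrtr_sqr ger0_norm.
  by rewrite -subr_ge0; case: leP => h; rewrite ?mul1r// mulr0 mul0r.
move: r0; rewrite le_eqVlt => /predU1P[<-|r0].
  by rewrite oppr0 set_itv1 integral_set1 expr0n/= mulr0.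
have dP (t : R) : is_derive t 1 (fun t => pi * (r ^+ 2 * t - 3^-1 * t ^+ 3)) (pi * (r ^+ 2 - t ^+ 2)).
  by apply: is_derive_eq; rewrite /GRing.scale /=; field.
have cP : continuous (fun t : R => pi * (r ^+ 2 - t ^+ 2)).
  move=> t; apply: cvgM; first exact: cvg_cst.
  by apply: cvgB; [exact: cvg_cst|exact: exprn_continuous].
rewrite (FTC_itv _ dP cP); last by lra.
by congr EFin; field.
Qed.

Lemma powR_decr (a b : R) (u : R) : 0 < a -> a <= b -> u <= 0 -> b `^ u <= a `^ u.
Proof.
move=> a0 ab u0; have b0 := lt_le_trans a0 ab.
rewrite -[u]opprK !(powRN _ (- u)) lef_pV2 ?posrE ?powR_gt0//.
by apply: ge0_ler_powR; rewrite ?oppr_ge0// ?nnegrE ltW.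
Qed.

Lemma powR_cvgy (u : R) : u < 0 -> x `^ u @[x --> +oo%R] --> (0 : R).
Proof.
move=> u0; apply/cvgr0Pnorm_le => e e0; near=> x.
have a0 : 0 < e `^ u^-1 by rewrite powR_gt0.
rewrite ger0_norm ?powR_ge0//.
apply: le_trans (powR_decr a0 _ (ltW u0)) _.
  by near: x; exact: nbhs_pinfty_ge.
by rewrite -powRrM mulVf ?powRr1 ?(ltW e0)// lt_eqF.
Unshelve. all: by end_near. Qed.

Lemma powR_cont_gt0 (u x : R) : 0 < x -> {for x, continuous (@powR R ^~ u)}.
Proof.
move=> x0; have [d _] := is_derive1_powR u x0.
by apply: differentiable_continuous; exact/derivable1_diffP.
Qed.

Lemma powR_FTC (a b u : R) : 0 < a -> a < b ->
  (\int[l1]_(x in `[a, b]) (u * x `^ (u - 1))%:E = (b `^ u - a `^ u)%:E)%E.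
Proof.
move=> a0 ab.
rewrite (@continuous_FTC2 _ _ (@powR R ^~ u)) ?EFinB//.
- apply: continuous_in_subspaceT => x; rewrite inE/= in_itv/= => /andP[ax _].
  apply: cvgM; first exact: cvg_cst.
  by apply: powR_cont_gt0; exact: lt_le_trans ax.
- split.
  + move=> x; rewrite in_itv/= => /andP[ax _].
    by have [] := is_derive1_powR u (lt_trans a0 ax).
  + by apply: cvg_at_right_filter; exact: powR_cont_gt0.
  + by apply: cvg_at_left_filter; apply: powR_cont_gt0; exact: lt_trans ab.
- move=> x; rewrite in_itv/= => /andP[ax _].
  by rewrite derive1E; have [_ ->] := is_derive1_powR u (lt_trans a0 ax).
Qed.

Lemma powR_FTCy (a u : R) : 0 < a -> u < 0 ->
  (\int[l1]_(x in `[a, +oo[) (x `^ (u - 1))%:E = (- u^-1 * a `^ u)%:E)%E.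
Proof.
move=> a0 u0; have un0 : u != 0 by rewrite lt_eqF.
have d (x : R) : 0 < x -> is_derive x 1 (fun x => u^-1 * x `^ u) (x `^ (u - 1)).
  move=> x0; have := is_derive1_powR u x0 => dx; apply: is_derive_eq.
  by rewrite /GRing.scale /= mulKf.
have c (x : R) : 0 < x -> {for x, continuous (fun x => u^-1 * x `^ u)}.
  move=> x0; have [dx _] := d x x0.
  by apply: differentiable_continuous; exact/derivable1_diffP.
rewrite (@ge0_continuous_FTC2y _ _ (fun x => u^-1 * x `^ u) a 0).
- by rewrite sub0e -EFinN mulNr.
- by move=> x _; exact: powR_ge0.
- apply: continuous_in_subspaceT => x; rewrite inE/= in_itv/= andbT => ax.
  by apply: powR_cont_gt0; exact: lt_le_trans ax.
- by rewrite -[X in _ --> X](mulr0 u^-1); apply: cvgM; [exact: cvg_cst|exact: powR_cvgy].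
- by move=> x ax; have [] := d x (lt_trans a0 ax).
- by apply: cvg_at_right_filter; exact: c.
- move=> x; rewrite in_itv/= andbT => ax.
  by rewrite derive1E; have [_ ->] := d x (lt_trans a0 ax).
Qed.

Lemma invr_powR (x u : R) : 0 < x -> x^-1 `^ u = x `^ (- u).
Proof. by move=> x0; rewrite -powR_inv1 ?ltW// -powRrM mulN1r. Qed.

(* Layer cake in the variable [t = 1 / |p|]. *)
Lemma radial_int (al r : R) : 0 < al < 3 -> 0 < r ->
  (\int[mu]_p (step (r ^+ 2 - dot3 p p) * norm3 p `^ (- al))%:E <=
   (4 * pi / (3 - al) * r `^ (3 - al))%:E)%E.
Proof.
move=> /andP[a0 a3] r0; have ri0 : 0 < r^-1 by rewrite invr_gt0.
pose B p := step (r ^+ 2 - dot3 p p).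
(* For 0 < |p| <= r, the difference |p|^(-al) - r^(-al) is the integral of al t^(al - 1) from 1/r to
   1/|p|; the indicator and [step] encode the two limits. *)
pose ker (p : R3) (t : mR) : R := \1_(`[r^-1, +oo[%classic : set mR) t * (al * t `^ (al - 1)) * step (1 - t ^+ 2 * dot3 p p).
pose wt (t : mR) : R := \1_(`[r^-1, +oo[%classic : set mR) t * (al * t `^ (al - 1)).
have wt0 t : 0 <= wt t by rewrite mulr_ge0// mulr_ge0 ?powR_ge0// ltW.
have ker0 p t : 0 <= ker p t by apply: mulr_ge0; [exact: wt0|exact: step_ge0].
have mdot := @dot3_diag_meas R.
have mwt : measurable_fun setT wt.
  apply: measurable_funM; first by apply: measurable_indic; exact: measurable_itv.
  by apply: measurable_funM => //; exact: measurable_powR.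
have mker : measurable_fun setT (fun z : R3 * mR => (ker z.1 z.2)%:E).
  apply/measurable_EFinP; apply: measurable_funM.
    exact: (measurableT_comp mwt measurable_snd).
  apply: (measurableT_comp step_meas); apply: measurable_funB => //; apply: measurable_funM.
    apply: measurable_funX; exact: measurable_snd.
  exact: (measurableT_comp mdot measurable_fst).
have mB : measurable_fun setT (B : R3 -> R).
  by apply: (measurableT_comp step_meas); exact: measurable_funB.
have kint p : B p = 1 -> 0 < norm3 p -> (\int[l1]_t (ker p t)%:E = (norm3 p `^ (- al) - r `^ (- al))%:E)%E.
  move=> Bp p0.
  have pr : norm3 p <= r.
    move: Bp; rewrite /B /step; case: leP => [|_ /esym/eqP]; last by rewrite oner_eq0.
    by rewrite subr_ge0 -norm3_sqr ler_pXn2r ?nnegrE ?norm3_ge0 ?(ltW r0).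
  transitivity (\int[l1]_(t in `[(r^-1)%R, ((norm3 p)^-1)%R]) (al * t `^ (al - 1))%:E)%E.
    rewrite [RHS]int_mask; apply: eq_integral => t _; rewrite /ker !indicE !mem_setE !in_itv/= andbT.
    case: (leP r^-1 t) => rt /=; rewrite ?mul0r//.
    have t0 : 0 < t by exact: lt_le_trans rt.
    have -> : step (1 - t ^+ 2 * dot3 p p) = (t <= (norm3 p)^-1)%R%:R.
      rewrite /step subr_ge0 -norm3_sqr -exprMn expr_le1//; last by rewrite mulr_ge0// ltW.
      by rewrite -ler_pdivlMr// div1r.
    by rewrite mul1r mulrC.
  have ip : r^-1 <= (norm3 p)^-1 by rewrite lef_pV2.
  move: ip; rewrite le_eqVlt => /predU1P[ip|ip].
    by rewrite -ip set_itv1 integral_set1 -[norm3 p]invrK -ip invrK subrr.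
  by rewrite powR_FTC// !invr_powR.
have step1 p : ((B p * norm3 p `^ (- al))%:E <= (B p * r `^ (- al))%:E + \int[l1]_t (ker p t)%:E)%E.
  have I0 : (0 <= \int[l1]_t (ker p t)%:E)%E by apply: integral_ge0 => t _; rewrite lee_fin.
  have [B1|B0] : B p = 1 \/ B p = 0 by rewrite /B /step; case: (_ <= _); [left|right].
    (* At the origin [powR] gives 0 for a nonzero exponent, so the singularity needs no separate
       null set. *)
    have [n0|np] := eqVneq (norm3 p) 0.
      rewrite n0 powR0 ?oppr_eq0 ?gt_eqF// mulr0; apply: adde_ge0 => //.
      by rewrite lee_fin mulr_ge0 ?powR_ge0// step_ge0.
    rewrite kint//; last by rewrite lt_def np norm3_ge0.
    by rewrite -EFinD lee_fin B1 !mul1r addrC subrK.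
  by rewrite B0 !mul0r add0e.
have mI : measurable_fun setT (fun p => \int[l1]_t (ker p t)%:E)%E.
  have k0 (z : R3 * mR) : (0 <= (ker z.1 z.2)%:E)%E by rewrite lee_fin.
  exact: (measurable_fun_fubini_tonelli_F _ mker k0).
apply: (@le_trans _ _ (\int[mu]_p ((B p * r `^ (- al))%:E + \int[l1]_t (ker p t)%:E))%E).
  apply: ge0_le_integral => //.
  - by move=> p _; rewrite lee_fin mulr_ge0 ?step_ge0// powR_ge0.
  - apply/measurable_EFinP; apply: measurable_funM => //.
    exact: measurableT_comp (@measurable_powR R (- al)) (@norm3_meas R).
  - apply: emeasurable_funD => //; apply/measurable_EFinP; exact: measurable_funM.
  - by move=> p _; exact: step1.
rewrite ge0_integralD//; last 3 first.
- by move=> p _; rewrite lee_fin mulr_ge0 ?step_ge0// powR_ge0.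
- by apply/measurable_EFinP; exact: measurable_funM.
- by move=> p _; apply: integral_ge0 => t _; rewrite lee_fin.
have -> : (\int[mu]_p (B p * r `^ (- al))%:E = (4 / 3 * pi * r `^ (3 - al))%:E)%E.
  under eq_integral do rewrite mulrC EFinM.
  rewrite ge0_integralZl//; last 3 first.
  - exact/measurable_EFinP.
  - by move=> p _; rewrite lee_fin step_ge0.
  - by rewrite lee_fin powR_ge0.
  rewrite ball_int ?ltW// -EFinM; congr EFin.
  rewrite powRD; last by apply/implyP => _; rewrite gt_eqF.
  by rewrite powR_mulrn ?ltW//; ring.
(* With p integrated first, t |p| <= 1 describes a ball of radius 1/t; what remains is t^(al - 4),
   integrable at infinity because al < 3. *)
have -> : (\int[mu]_p \int[l1]_t (ker p t)%:E = (4 / 3 * pi * (al / (3 - al)) * r `^ (3 - al))%:E)%E.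
  transitivity (\int[l1]_t \int[mu]_p (ker p t)%:E)%E.
    apply: (@fubini_tonelli _ _ _ _ _ (mu3 R) l1 (fun z : R3 * mR => (ker z.1 z.2)%:E)) => //.
    by move=> z; rewrite lee_fin.
  transitivity (\int[l1]_(t in `[(r^-1)%R, +oo[) (4 / 3 * pi * al * t `^ ((al - 3) - 1))%:E)%E.
    rewrite [RHS]int_mask; apply: eq_integral => t _.
    under eq_integral do rewrite /ker -/(wt t) EFinM.
    rewrite ge0_integralZl//; last 3 first.
    - apply/measurable_EFinP; apply: (measurableT_comp step_meas).
      by apply: measurable_funB => //; exact: measurable_funM.
    - by move=> p _; rewrite lee_fin step_ge0.
    - by rewrite lee_fin.
    rewrite /wt indicE mem_setE in_itv/= andbT; case: leP => rt; last first.
      by rewrite !mul0r mul0e.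
    have t0 : 0 < t by exact: lt_le_trans rt.
    have -> : (\int[mu]_p (step (1 - t ^+ 2 * dot3 p p))%:E = (4 / 3 * pi * t^-1 ^+ 3)%:E)%E.
      rewrite -ball_int ?invr_ge0 ?(ltW t0)//; apply: eq_integral => p _; congr EFin.
      rewrite /step !subr_ge0; congr (nat_of_bool _)%:R.
      by rewrite exprVn -[(t ^+ 2)^-1]div1r ler_pdivlMr ?exprn_gt0// mulrC.
    rewrite -EFinM; congr EFin; rewrite !mul1r.
    have -> : t `^ (al - 3 - 1) = t `^ (al - 1) * t ^- 3.
      have -> : al - 3 - 1 = (al - 1) + (- 3%:R) by ring.
      rewrite powRD; last by apply/implyP => _; rewrite gt_eqF.
      by rewrite powR_invn ?(ltW t0).
    by rewrite exprVn; ring.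
  under eq_integral do rewrite EFinM.
  rewrite ge0_integralZl//; last 3 first.
  - by apply/measurable_EFinP; apply: measurable_funTS; exact: measurable_powR.
  - by move=> t _; rewrite lee_fin powR_ge0.
  - by rewrite lee_fin !mulr_ge0 ?pi_ge0 ?(ltW a0).
  rewrite powR_FTCy//; last by lra.
  rewrite -EFinM invr_powR// opprB; congr EFin.
  have a3' : 3 - al != 0 by rewrite subr_eq0 gt_eqF.
  have a3'' : al - 3 != 0 by rewrite subr_eq0 lt_eqF.
  by field; apply/andP.
(* The two contributions combine through 1 + al / (3 - al) = 3 / (3 - al). *)
rewrite -EFinD lee_fin le_eqVlt; apply/orP; left; apply/eqP.
have a3' : 3 - al != 0 by rewrite subr_eq0 gt_eqF.
by field.
Qed.

End radial.

(** * Convolutions and the H^2 estimate *)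

Section convolution.
Context (R : realType).
Local Notation R3 := (R3 R).
Local Notation mu := (leb3 R).
Local Notation mm := (mm3 R).
Local Notation intg f := (mu.-integrable setT (EFin \o f)).
Local Notation L2 := (L2 mu).
Local Notation n2 := (n2 mu).
Implicit Types (f h K G : R3 -> R) (p x y z : R3).

Lemma dot3Dr p x y : dot3 p (x + y) = dot3 p x + dot3 p y.
Proof. by rewrite /dot3 /=; ring. Qed.

Lemma intg_subl f y : intg f -> intg (fun x => f (x - y)).
Proof.
move=> i; have := integrable_inv (@trans3_meas R (- y)) (@leb3_trans R (- y)) i.
by congr (integrable _ _ _); apply/funext => x /=; rewrite addrC.
Qed.

Lemma Rint_subl f y : intg f -> \int[mu]_x f (x - y) = \int[mu]_x f x.
Proof.
move=> i; rewrite -(Rintegral_inv (@trans3_meas R (- y)) (@leb3_trans R (- y)) i).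
by apply: eq_Rint => x; rewrite addrC.
Qed.

Lemma int_eabs f : intg f -> (\int[mu]_x `|f x|%:E = (\int[mu]_x `|f x|)%:E)%E.
Proof.
move=> i; rewrite Rint_EFin//.
by have := integrable_norm i; congr (integrable _ _ _); apply/funext.
Qed.

Lemma intg_subr f x : intg f -> intg (fun y => f (x - y)).
Proof.
move=> i; have j := integrable_inv (@opp3_meas R) (@leb3_opp R) i.
have := intg_subl x j; congr (integrable _ _ _); apply/funext => y /=.
by rewrite opprB.
Qed.

Lemma Rint_subr f x : intg f -> \int[mu]_y f (x - y) = \int[mu]_y f y.
Proof.
move=> i; have j := integrable_inv (@opp3_meas R) (@leb3_opp R) i.
rewrite -(Rintegral_inv (@opp3_meas R) (@leb3_opp R) i) -(Rint_subl x j).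
by apply: eq_Rint => y; rewrite opprB.
Qed.

Lemma intg_abs f : intg f -> intg (fun x => `|f x|).
Proof. by move=> i; have := integrable_norm i; congr (integrable _ _ _); apply/funext. Qed.

Section conv_props.
Variables (K G : R3 -> R) (B : R).
Hypotheses (iK : intg K) (iG : intg G) (GB : forall x, `|G x| <= B).

Let mK := integrable_meas iK.
Let mG := integrable_meas iG.

Let mF : measurable_fun setT (fun z : R3 * R3 => K (z.1 - z.2) * G z.2).
Proof.
apply: measurable_funM; first exact: measurableT_comp mK (@sub3_meas R).
exact: m2_mm.
Qed.

Let FB x y : `|K (x - y) * G y| <= B * `|K (x - y)|.
Proof. by rewrite normrM mulrC ler_wpM2r. Qed.

Lemma conv_int1 x : intg (fun y => K (x - y) * G y).
Proof.
apply: (@le_intg _ _ _ _ _ (fun y => B * `|K (x - y)|)).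
- exact: measurable_funM (integrable_meas (intg_subr x iK)) mG.
- exact: FB.
- exact: (intgZ B (intg_subr x (intg_abs iK))).
Qed.

Lemma conv_le x : `|conv3 K G x| <= B * \int[mu]_y `|K y|.
Proof.
have i := conv_int1 x.
have j := intg_subr x (intg_abs iK).
apply: (@le_trans _ _ (\int[mu]_y `|K (x - y) * G y|)).
  exact: le_normr_Rintegral.
rewrite -(Rint_subr x (intg_abs iK)) -RintZ//.
apply: le_Rintegral => //.
- exact: intg_abs.
- exact: intgZ.
Qed.

Lemma conv_fin : (\int[mu]_x \int[mu]_y `|K (x - y) * G y|%:E < +oo)%E.
Proof.
have mFa : measurable_fun setT (fun z : R3 * R3 => `|K (z.1 - z.2) * G z.2|%:E).
  by apply/measurable_EFinP; exact: (measurableT_comp (@normr_measurable R setT) mF).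
have F0 (z : R3 * R3) : (0 <= `|K (z.1 - z.2) * G z.2|%:E)%E by rewrite lee_fin.
have := mm_tonelli1 mFa F0; have := mm_tonelli2 mFa F0 => /= -> <-.
have mKa : measurable_fun setT (fun x : R3 => `|K x|%:E).
  by apply/measurable_EFinP; exact: (measurableT_comp (@normr_measurable R setT) mK).
have E y : (\int[mu]_x `|K (x - y) * G y|%:E = `|G y|%:E * (\int[mu]_x `|K x|)%:E)%E.
  under eq_integral do rewrite normrM mulrC EFinM.
  rewrite ge0_integralZl//; last first.
    apply/measurable_EFinP; apply: measurableT_comp => //.
    exact: integrable_meas (intg_subl y iK).
  rewrite (int_subl (F := fun x => `|K x|%:E)) => [||x]; last by rewrite lee_fin.
  - by rewrite int_eabs.
  - exact: mKa.
under eq_integral do rewrite E muleC.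
rewrite ge0_integralZl//; last 2 first.
- by apply/measurable_EFinP; exact: measurableT_comp.
- by rewrite lee_fin Rintegral_ge0.
by rewrite int_eabs// -EFinM ltry.
Qed.

Lemma conv_intg : intg (conv3 K G).
Proof.
have := (@Rfubini_int1 _ _ _ _ _ (mu3 R) (mu3 R) (fun z : R3 * R3 => K (z.1 - z.2) * G z.2) mF conv_int1 conv_fin).
by congr (integrable _ _ _).
Qed.

(** The convolution is both integrable and bounded, hence square integrable. *)
Lemma conv_L2 : L2 (conv3 K G).
Proof.
have i := conv_intg; have mc := integrable_meas i; split => //.
apply: (le_intg (g := fun x => (B * \int[mu]_y `|K y|) * `|conv3 K G x|)).
- exact: measurable_funX.
- by move=> x; rewrite ger0_norm ?sqr_ge0// -real_normK ?num_real// expr2 ler_wpM2r// conv_le.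
- by apply: intgZ; exact: intg_abs.
Qed.

(** Fubini and the translation x = z + y: the part of the convolution theorem common to cosine and
    sine. *)
Lemma conv_trig (k : R3 -> R) : measurable_fun setT k -> (forall x, `|k x| <= 1) ->
  \int[mu]_x (conv3 K G x * k x) = \int[mu]_y (G y * \int[mu]_z (K z * k (z + y))).
Proof.
move=> mk k1.
pose F (z : R3 * R3) := k z.1 * (K (z.1 - z.2) * G z.2).
have mF' : measurable_fun setT F by apply: measurable_funM => //; exact: m1_mm.
have Fle x y : `|F (x, y)| <= `|K (x - y) * G y| by rewrite normrM ler_piMl.
have i1 x : mu.-integrable setT (fun y => (F (x, y))%:E).
  exact: (intgZ (k x) (conv_int1 x)).
have iy y : intg (fun x => K (x - y) * k x).
  apply: (le_intg (g := fun x => `|K (x - y)|)).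
  - exact: measurable_funM (integrable_meas (intg_subl y iK)) mk.
  - by move=> x; rewrite normrM ler_piMr.
  - exact: intg_abs (intg_subl y iK).
have i2 y : mu.-integrable setT (fun x => (F (x, y))%:E).
  have := intgZ (G y) (iy y); congr (integrable _ _ _); apply/funext => x /=.
  by rewrite /F/=; congr EFin; ring.
have fin : (\int[mu]_x \int[mu]_y `|F (x, y)|%:E < +oo)%E.
  apply: le_lt_trans conv_fin; apply: ge0_le_integral.
  - exact: measurableT.
  - by move=> x _; apply: integral_ge0 => y _; rewrite lee_fin.
  - have F0 (z : R3 * R3) : (0 <= `|F z|%:E)%E by rewrite lee_fin.
    have mFa : measurable_fun setT (fun z : R3 * R3 => `|F z|%:E).
      by apply/measurable_EFinP; exact: (measurableT_comp (@normr_measurable R setT) mF').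
    exact: (@measurable_fun_fubini_tonelli_F _ _ _ _ _ (mu3 R) _ mFa F0).
  - have F0 (z : R3 * R3) : (0 <= `|K (z.1 - z.2) * G z.2|%:E)%E by rewrite lee_fin.
    have mFa : measurable_fun setT (fun z : R3 * R3 => `|K (z.1 - z.2) * G z.2|%:E).
      by apply/measurable_EFinP; exact: (measurableT_comp (@normr_measurable R setT) mF).
    exact: (@measurable_fun_fubini_tonelli_F _ _ _ _ _ (mu3 R) _ mFa F0).
  - move=> x _; apply: ge0_le_integral => //.
    + by apply/measurable_EFinP; apply: measurableT_comp => //; exact: integrable_meas (i1 x).
    + by apply/measurable_EFinP; apply: measurableT_comp => //; exact: integrable_meas (conv_int1 x).
    + by move=> y _; rewrite lee_fin.
have := @Rfubini _ _ _ _ _ (mu3 R) (mu3 R) F mF' i1 i2 fin.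
move=> H; transitivity (\int[mu]_x \int[mu]_y F (x, y)).
  apply: eq_Rint => x; rewrite mulrC; exact: esym (RintZ (k x) (conv_int1 x)).
rewrite {}H; apply: eq_Rint => y.
have -> : \int[mu]_z (K z * k (z + y)) = \int[mu]_x (K (x - y) * k x).
  rewrite -(Rint_subl y); first by apply: eq_Rint => x; rewrite subrK.
  apply: (le_intg (g := fun x => `|K x|)).
  - rewrite (_ : (fun x => _) = (fun x => K x * k (y + x))); last first.
      by apply/funext => x; rewrite (addrC x).
    exact: measurable_funM mK (measurableT_comp mk (@trans3_meas R y)).
  - by move=> x; rewrite normrM ler_piMr.
  - exact: intg_abs.
rewrite -(RintZ (G y) (iy y)); apply: eq_Rint => x; rewrite /F/=; ring.
Qed.

(** The convolution theorem in modulus. The addition formulas produce the two components of a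
    complex product, whose sums of squares multiply; [c0 R ^- 2] is the factor (2 pi)^3 of the
    symmetric normalisation. *)
Lemma CST_conv p : CT (conv3 K G) p ^+ 2 + ST (conv3 K G) p ^+ 2 =
  (c0 R ^- 2) * ((CT K p ^+ 2 + ST K p ^+ 2) * (CT G p ^+ 2 + ST G p ^+ 2)).
Proof.
have mdp : measurable_fun setT (fun x : R3 => dot3 p x).
  exact: (measurableT_comp (@dot3_meas R) (pair1_measurable p)).
have iKc := intg_cos p iK; have iKs := intg_sin p iK.
have iGc := intg_cos p iG; have iGs := intg_sin p iG.
rewrite /CT /ST.
rewrite (conv_trig (k := fun x => cos (dot3 p x))) => [||x]; last exact: cos_le1n; last first.
  exact: measurableT_comp (@mcos R) mdp.
rewrite (conv_trig (k := fun x => sin (dot3 p x))) => [||x]; last exact: sin_le1n; last first.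
  exact: measurableT_comp (@msin R) mdp.
set A := \int[mu]_x (K x * cos (dot3 p x)); set S := \int[mu]_x (K x * sin (dot3 p x)).
set C := \int[mu]_x (G x * cos (dot3 p x)); set D := \int[mu]_x (G x * sin (dot3 p x)).
have -> : \int[mu]_y (G y * \int[mu]_z (K z * cos (dot3 p (z + y)))) = C * A - D * S.
  transitivity (\int[mu]_y (A * (G y * cos (dot3 p y)) - S * (G y * sin (dot3 p y)))).
    apply: eq_Rint => y.
    rewrite (_ : \int[mu]_z _ = cos (dot3 p y) * A - sin (dot3 p y) * S); first by ring.
    rewrite -!RintZ// -RintB; [|exact: intgZ..].
    by apply: eq_Rint => z; rewrite dot3Dr cosD; ring.
  rewrite RintB; [|exact: intgZ..].
  by rewrite !RintZ// -/C -/D; ring.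
have -> : \int[mu]_y (G y * \int[mu]_z (K z * sin (dot3 p (z + y)))) = C * S + D * A.
  transitivity (\int[mu]_y (S * (G y * cos (dot3 p y)) + A * (G y * sin (dot3 p y)))).
    apply: eq_Rint => y.
    rewrite (_ : \int[mu]_z _ = cos (dot3 p y) * S + sin (dot3 p y) * A); first by ring.
    rewrite -!RintZ// -RintD; [|exact: intgZ..].
    by apply: eq_Rint => z; rewrite dot3Dr sinD; ring.
  rewrite RintD; [|exact: intgZ..].
  by rewrite !RintZ// -/C -/D; ring.
have c0n : c0 R != 0 by rewrite gt_eqF// c0_gt0.
by field.
Qed.

End conv_props.

Lemma symb_eq0 s p : 0 < s -> norm3 p = 0 -> symb s p = 0.
Proof. by move=> s0 p0; rewrite /symb p0 powR0// mulf_neq0// gt_eqF. Qed.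

Definition solhat (s1 s2 : R) h p : R := T0 h p / (symb s1 p + symb s2 p).

Lemma solhat_meas s1 s2 h : intg h -> measurable_fun setT (solhat s1 s2 h).
Proof.
move=> ih; apply: measurable_funM; first exact: T0_meas.
rewrite (_ : (fun p => _) = (fun p => (symb s1 p + symb s2 p) `^ (-1))); last first.
  by apply/funext => p; rewrite powR_inv1// addr_ge0// symb_ge0.
apply: (measurableT_comp (@measurable_powR R (-1))).
exact: measurable_funD (@symb_meas R s1) (@symb_meas R s2).
Qed.

(** The weight against which the squared transform of the right-hand side integrates to the squared
    H^2 norm of the solution. *)
Definition solw (s1 s2 : R) p : R := h2w p ^+ 2 / (symb s1 p + symb s2 p) ^+ 2.

Lemma solwE s1 s2 h p : (h2w p * solhat s1 s2 h p) ^+ 2 = solw s1 s2 p * T0 h p ^+ 2.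
Proof. by rewrite /solw /solhat !exprMn exprVn; ring. Qed.

Lemma solw_ge0 s1 s2 p : 0 <= solw s1 s2 p.
Proof. by rewrite divr_ge0 ?sqr_ge0. Qed.

Lemma solw_meas s1 s2 : measurable_fun setT (solw s1 s2).
Proof.
rewrite (_ : solw s1 s2 = (fun p => h2w p ^+ 2 * ((symb s1 p + symb s2 p) `^ (- 2%:R)))); last first.
  by apply/funext => p; rewrite powR_invn// addr_ge0// symb_ge0.
apply: measurable_funM; first by apply: measurable_funX; exact: h2w_meas.
apply: (measurableT_comp (@measurable_powR R (- 2%:R))).
exact: measurable_funD (@symb_meas R s1) (@symb_meas R s2).
Qed.

Lemma solwN s1 s2 p : solw s1 s2 (- p) = solw s1 s2 p.
Proof. by rewrite /solw /h2w !symbN norm3N. Qed.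

(** Dropping [symb s2] from the denominator leaves (1 + |p|^4) |p|^(-4 s1). The |p|^4 part is
    exactly the squared symbol of (-Delta)^(1 - s1); the other part is kept inside radius [r] and
    replaced by its value at [r] outside. *)
Lemma solw_le s1 s2 r p : 0 < s1 -> 0 < s2 -> 0 < r ->
  solw s1 s2 p <= step (r ^+ 2 - dot3 p p) * norm3 p `^ (- (4 * s1)) + r `^ (- (4 * s1))
    + symb (1 - s1) p ^+ 2.
Proof.
move=> s10 s20 r0; set b := step _; have b0 : 0 <= b by exact: step_ge0.
(* At the origin the denominator is 0 and its inverse is 0 by convention, so the left side
   vanishes. *)
have [p0|pn] := eqVneq (norm3 p) 0.
  rewrite {1}/solw (symb_eq0 s10 p0) (symb_eq0 s20 p0) addr0 expr0n/= invr0 mulr0.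
  by rewrite !addr_ge0 ?sqr_ge0 ?mulr_ge0 ?powR_ge0.
have p0 : 0 < norm3 p by rewrite lt_def pn norm3_ge0.
have sp0 : 0 < symb s1 p by exact: powR_gt0.
have E1 : (symb s1 p ^+ 2)^-1 = norm3 p `^ (- (4 * s1)).
  rewrite powRN /symb -powR_mulrn ?powR_ge0// -powRrM; congr (_ `^ _)^-1; ring.
have E2 : symb (1 - s1) p ^+ 2 = norm3 p ^+ 4 * norm3 p `^ (- (4 * s1)).
  rewrite /symb -powR_mulrn ?powR_ge0// -powRrM -powR_mulrn ?ltW// -powRD; last first.
    by apply/implyP => _; rewrite gt_eqF.
  by congr (_ `^ _); ring.
have le1 : norm3 p `^ (- (4 * s1)) <= b * norm3 p `^ (- (4 * s1)) + r `^ (- (4 * s1)).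
  rewrite /b /step subr_ge0 -norm3_sqr ler_pXn2r ?nnegrE ?norm3_ge0 ?(ltW r0)//.
  case: (leP (norm3 p) r) => pr; first by rewrite mul1r lerDl powR_ge0.
  by rewrite mul0r add0r powR_decr// ?(ltW pr)// oppr_le0 mulr_ge0// ltW.
apply: (@le_trans _ _ (h2w p ^+ 2 * norm3 p `^ (- (4 * s1)))).
  rewrite ler_wpM2l ?sqr_ge0// -E1 lef_pV2 ?posrE ?exprn_gt0// ?ltr_wpDr ?symb_ge0//.
  by rewrite lerXn2r ?nnegrE ?addr_ge0 ?symb_ge0// lerDl symb_ge0.
by rewrite h2w_sqr mulrDl mul1r E2 lerD2r.
Qed.

Lemma CST_int G : intg G -> L2 G ->
  (\int[mu]_p (CT G p ^+ 2 + ST G p ^+ 2)%:E <= (n2 G ^+ 2)%:E)%E.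
Proof.
move=> iG LG; have [LT nT] := T0_contr iG LG.
by rewrite -T0_CST1// n2_eint// lee_fin lerXn2r ?nnegrE ?n2_ge0.
Qed.

Lemma CST_meas f : intg f -> measurable_fun setT (fun p => CT f p ^+ 2 + ST f p ^+ 2).
Proof.
move=> i; apply: measurable_funD; apply: measurable_funX; [exact: CT_meas|exact: ST_meas].
Qed.

Lemma CST_ge0 f p : 0 <= CT f p ^+ 2 + ST f p ^+ 2.
Proof. by rewrite addr_ge0 ?sqr_ge0. Qed.

(** The three terms of [solw_le] meet different bounds on the product of the squared transforms of K
    and G: sup bounds for both inside the ball; the sup bound for K with the L^2 norm of G for the
    term [r] to the power -4 s1; the sup bound for G with [q] for the last term. *)
Lemma solhat_int s1 s2 r K G (B k a b q : R) :
  0 < s1 < 3 / 4 -> 0 < s2 -> 0 < r -> intg K -> intg G -> L2 G ->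
  (forall x, `|G x| <= B) -> \int[mu]_x `|K x| <= k -> \int[mu]_x `|G x| <= a ->
  n2 G <= b -> L2 (fun p => symb (1 - s1) p * T0 K p) ->
  n2 (fun p => symb (1 - s1) p * T0 K p) <= q ->
  (\int[mu]_p ((h2w p * solhat s1 s2 (conv3 K G) p) ^+ 2)%:E <=
   (k ^+ 2 * (c0 R ^+ 2 * a ^+ 2 * (4 * pi / (3 - 4 * s1) * r `^ (3 - 4 * s1)) +
              r `^ (- (4 * s1)) * b ^+ 2) + a ^+ 2 * q ^+ 2)%:E)%E.
Proof.
move=> /andP[s10 s13].
have al : 0 < 4 * s1 < 3 by apply/andP; split; lra.
move=> s20 r0 iK iG LG GB Kk Ga Gb LQ Qq.
have ic := conv_intg iK iG GB.
have k0 : 0 <= k by apply: le_trans Kk; exact: Rintegral_ge0.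
have a0 : 0 <= a by apply: le_trans Ga; exact: Rintegral_ge0.
have b0 : 0 <= b by apply: le_trans Gb; exact: n2_ge0.
have q0 : 0 <= q by apply: le_trans Qq; exact: n2_ge0.
pose KK p := CT K p ^+ 2 + ST K p ^+ 2; pose GG p := CT G p ^+ 2 + ST G p ^+ 2.
have mKK : measurable_fun setT KK := CST_meas iK.
have mGG : measurable_fun setT GG := CST_meas iG.
have KK0 p : 0 <= KK p := CST_ge0 K p.
have GG0 p : 0 <= GG p := CST_ge0 G p.
have KKk p : KK p <= c0 R ^+ 2 * k ^+ 2.
  apply: le_trans (CST_le p iK) _; rewrite ler_wpM2l ?sqr_ge0//.
  by rewrite lerXn2r ?nnegrE// Rintegral_ge0.
have GGa p : GG p <= c0 R ^+ 2 * a ^+ 2.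
  apply: le_trans (CST_le p iG) _; rewrite ler_wpM2l ?sqr_ge0//.
  by rewrite lerXn2r ?nnegrE// Rintegral_ge0.
under eq_integral do rewrite solwE.
rewrite (T0_CST ic (@solw_ge0 s1 s2) (@solw_meas s1 s2) (@solwN s1 s2)).
pose S p := step (r ^+ 2 - dot3 p p) * norm3 p `^ (- (4 * s1)).
have S0 p : 0 <= S p by rewrite mulr_ge0 ?step_ge0 ?powR_ge0.
pose rr := r `^ (- (4 * s1)); have rr0 : 0 <= rr by exact: powR_ge0.
pose y p := symb (1 - s1) p ^+ 2.
have c00 : c0 R != 0 by rewrite gt_eqF// c0_gt0.
have c2 : 0 < c0 R ^+ 2 by rewrite exprn_gt0// c0_gt0.
pose U p := (k ^+ 2 * (c0 R ^+ 2 * a ^+ 2)) * S p + (k ^+ 2 * rr) * GG p + a ^+ 2 * (y p * KK p).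
have mS : measurable_fun setT S.
  apply: measurable_funM.
    apply: (measurableT_comp (@step_meas R)).
    rewrite (_ : (fun p => _) = (fun p => r ^+ 2 - norm3 p ^+ 2)); last first.
      by apply/funext => p; rewrite norm3_sqr.
    by apply: measurable_funB => //; apply: measurable_funX; exact: norm3_meas.
  exact: measurableT_comp (@measurable_powR R _) (@norm3_meas R).
have my : measurable_fun setT y by apply: measurable_funX; exact: symb_meas.
have y0 p : 0 <= y p by exact: sqr_ge0.
have mU1 : measurable_fun setT (fun p => (k ^+ 2 * (c0 R ^+ 2 * a ^+ 2)) * S p).
  exact: measurable_funM.
have mU2 : measurable_fun setT (fun p => (k ^+ 2 * rr) * GG p) by exact: measurable_funM.
have mU3 : measurable_fun setT (fun p => y p * KK p) by exact: measurable_funM.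
have mU3' : measurable_fun setT (fun p => a ^+ 2 * (y p * KK p)) by exact: measurable_funM.
have ptw p : solw s1 s2 p * (CT (conv3 K G) p ^+ 2 + ST (conv3 K G) p ^+ 2) <= U p.
  rewrite (CST_conv iK iG GB p) -/(KK p) -/(GG p) mulrCA.
  apply: (@le_trans _ _ (c0 R ^- 2 * ((S p + rr + y p) * (KK p * GG p)))).
    rewrite ler_wpM2l ?invr_ge0 ?sqr_ge0// ler_wpM2r ?mulr_ge0//.
    exact: solw_le.
  rewrite mulrC ler_pdivrMr// /U.
  have h1 : S p * (KK p * GG p) <= S p * ((c0 R ^+ 2 * k ^+ 2) * (c0 R ^+ 2 * a ^+ 2)).
    by rewrite ler_wpM2l// ler_pM.
  have h2 : rr * (KK p * GG p) <= rr * ((c0 R ^+ 2 * k ^+ 2) * GG p).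
    by rewrite ler_wpM2l// ler_wpM2r.
  have h3 : y p * (KK p * GG p) <= y p * (KK p * (c0 R ^+ 2 * a ^+ 2)).
    by rewrite ler_wpM2l// ler_wpM2l.
  rewrite [leLHS](_ : _ = S p * (KK p * GG p) + rr * (KK p * GG p) + y p * (KK p * GG p)); last by ring.
  apply: le_trans (lerD (lerD h1 h2) h3) _.
  by rewrite le_eqVlt; apply/orP; left; apply/eqP; ring.
apply: (@le_trans _ _ (\int[mu]_p (U p)%:E)%E).
  apply: ge0_le_integral.
  - exact: measurableT.
  - by move=> p _; rewrite lee_fin mulr_ge0 ?solw_ge0 ?CST_ge0.
  - apply/measurable_EFinP; exact: measurable_funM (@solw_meas s1 s2) (CST_meas ic).
  - by apply/measurable_EFinP; apply: measurable_funD => //; exact: measurable_funD.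
  - by move=> p _; rewrite lee_fin.
have U10 p : 0 <= (k ^+ 2 * (c0 R ^+ 2 * a ^+ 2)) * S p.
  by apply: mulr_ge0 (S0 p); apply: mulr_ge0 (sqr_ge0 k) _; exact: mulr_ge0 (sqr_ge0 _) (sqr_ge0 a).
have U20 p : 0 <= (k ^+ 2 * rr) * GG p.
  by apply: mulr_ge0 (GG0 p); apply: mulr_ge0 rr0; exact: sqr_ge0.
have U30 p : 0 <= a ^+ 2 * (y p * KK p).
  by apply: mulr_ge0 (sqr_ge0 a) _; exact: mulr_ge0 (y0 p) (KK0 p).
under eq_integral do rewrite EFinD.
rewrite ge0_integralD//; last 4 first.
- by move=> p _; rewrite lee_fin addr_ge0.
- by apply/measurable_EFinP; exact: measurable_funD.
- by move=> p _; rewrite lee_fin.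
- exact/measurable_EFinP.
under eq_integral do rewrite EFinD.
rewrite ge0_integralD//; last 4 first.
- by move=> p _; rewrite lee_fin.
- exact/measurable_EFinP.
- by move=> p _; rewrite lee_fin.
- exact/measurable_EFinP.
have intZ (c e : R) (F : R3 -> R) : 0 <= c -> measurable_fun setT F -> (forall p, 0 <= F p) ->
    (\int[mu]_p (F p)%:E <= e%:E)%E -> (\int[mu]_p (c * F p)%:E <= (c * e)%:E)%E.
  move=> ? mF F0 Fe; under eq_integral do rewrite EFinM.
  rewrite ge0_integralZl ?lee_fin//; last 2 first.
  - exact/measurable_EFinP.
  - by move=> p _; rewrite lee_fin.
  by rewrite EFinM lee_wpmul2l ?lee_fin.
have sq0 (t : R) : 0 <= t ^+ 2 := sqr_ge0 t.
have I1 := intZ _ _ _ (mulr_ge0 (sq0 k) (mulr_ge0 (sq0 (c0 R)) (sq0 a))) mS S0 (radial_int al r0).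
have GGb : (\int[mu]_p (GG p)%:E <= (b ^+ 2)%:E)%E.
  by apply: le_trans (CST_int iG LG) _; rewrite lee_fin lerXn2r ?nnegrE ?n2_ge0.
have I2 := intZ _ _ _ (mulr_ge0 (sq0 k) rr0) mGG GG0 GGb.
have yKKq : (\int[mu]_p (y p * KK p)%:E <= (q ^+ 2)%:E)%E.
  have yN p : y (- p) = y p by rewrite /y symbN.
  rewrite -(T0_CST iK y0 my yN); under eq_integral do rewrite -exprMn.
  by rewrite n2_eint// lee_fin lerXn2r ?nnegrE ?n2_ge0.
have I3 := intZ _ _ _ (sq0 a) mU3 (fun p => mulr_ge0 (y0 p) (KK0 p)) yKKq.
apply: le_trans (leeD (leeD I1 I2) I3) _.
by rewrite -!EFinD lee_fin le_eqVlt; apply/orP; left; apply/eqP; rewrite /rr; ring.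
Qed.

End convolution.

(** * Optimal splitting radius and the constant H *)

Section constants.
Context (R : realType).

(* [r] is the splitting radius that balances the two parts of the low/high
   frequency decomposition of the L^2 norm. *)
Lemma H_const_bound (s N k q M d : R) (r := (8 * pi ^+ 2 * s / N ^+ 2) `^ (3^-1)) :
  0 < s < 3 / 4 -> 0 < N -> 0 <= M -> 0 <= d ->
  k ^+ 2 * (c0 R ^+ 2 * (M * N * d) ^+ 2 * (4 * pi / (3 - 4 * s) * r `^ (3 - 4 * s)) +
            r `^ (- (4 * s)) * (M * d) ^+ 2) + (M * N * d) ^+ 2 * q ^+ 2 <=
  ((2 * M * N ^+ 2 * Num.sqrt
    (3 * k ^+ 2 * N `^ (8 * s / 3 - 2)
     / ((3 - 4 * s) * s `^ (4 * s / 3) * pi `^ (8 * s / 3)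
        * 2 `^ (4 * s + 8 * s / 3))
     + q ^+ 2 / 4)) / N * d) ^+ 2.
Proof.
move=> /andP[s0 s1] N0 M0 d0.
have p0 := @pi_gt0 R; have s3 : 0 < 3 - 4 * s by lra.
pose t := 4 * s / 3; have t0 : 0 < t by rewrite /t; lra.
have -> : 8 * s / 3 = 2 * t by rewrite /t; ring.
rewrite -/t.
(* The only loss in this estimate: the stated constant carries the optimal value multiplied by 4 /
   2^(2 t), which is at least 1 because t <= 1, that is s <= 3/4. *)
have tle : 2 `^ (2 * t) <= 4 :> R.
  rewrite (_ : 4 = 2 `^ 2%:R :> R); last by rewrite powR_mulrn//; ring.
  by apply: ler_powR; [lra|rewrite /t; lra].
pose b := 8 * pi ^+ 2 * s / N ^+ 2.
have b0 : 0 < b by rewrite !mulr_gt0// ?invr_gt0 ?exprn_gt0.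
have r0 : 0 < r by exact: powR_gt0.
have r3 : r ^+ 3 = b by rewrite -powR_mulrn ?(ltW r0)// /r -powRrM mulVf ?powRr1 ?ltW.
pose X := r `^ (- (4 * s)).
have X0 : 0 <= X by exact: powR_ge0.
(* Because r^3 = b, the low and high parts are multiples of the same [X]; their coefficients add up
   as 4 s / (3 - 4 s) + 1 = 3 / (3 - 4 s). *)
have -> : r `^ (3 - 4 * s) = b * X.
  rewrite powRD; last by apply/implyP => _; rewrite gt_eqF.
  by rewrite -[r `^ 3]/(r `^ 3%:R) powR_mulrn ?(ltW r0)// r3.
have A0 : 0 < s `^ t by exact: powR_gt0.
have P0 : 0 < pi `^ (2 * t) :> R by exact: powR_gt0.
have Z0 : 0 < 2 `^ (4 * s) :> R by exact: powR_gt0.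
have V0 : 0 < N `^ (2 * t) by exact: powR_gt0.
have W0 : 0 < 2 `^ (2 * t) :> R by exact: powR_gt0.
have XE : X = N `^ (2 * t) / (2 `^ (4 * s) * pi `^ (2 * t) * s `^ t).
  rewrite /X /r -/b -powRrM (_ : 3^-1 * - (4 * s) = - t); last by rewrite /t; ring.
  rewrite powRN -[RHS]invrK invf_div; congr _^-1.
  rewrite /b powRM ?invr_ge0 ?mulr_ge0 ?exprn_ge0 ?(ltW p0) ?(ltW s0) ?(ltW N0)//.
  rewrite powRM ?mulr_ge0 ?exprn_ge0 ?(ltW p0) ?(ltW s0)// powRM ?exprn_ge0 ?(ltW p0)//.
  have pw (x : R) : 0 < x -> (x ^+ 2) `^ t = x `^ (2 * t).
    by move=> x0; rewrite -powR_mulrn ?ltW// -powRrM.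
  rewrite pw// invr_powR ?exprn_gt0// powRN pw//; congr (_ * _ * _ / _).
  rewrite (_ : 8 = 2 `^ 3%:R :> R); last by rewrite powR_mulrn//; ring.
  by rewrite -powRrM; congr (_ `^ _); rewrite /t; field.
have ND : N `^ (2 * t - 2) = N `^ (2 * t) / N ^+ 2.
  rewrite powRD; last by apply/implyP => _; rewrite gt_eqF.
  by rewrite powRN -[N `^ 2]/(N `^ 2%:R) powR_mulrn ?ltW.
rewrite ND powRD; last by apply/implyP => _; rewrite gt_eqF.
set A := s `^ t in A0 XE *; set P := pi `^ (2 * t) in P0 XE *.
set Z := 2 `^ (4 * s) in Z0 XE *; set V := N `^ (2 * t) in V0 XE *.
set Q := 2 `^ (2 * t) in W0 tle *.
have E : 0 <= 3 * k ^+ 2 * (V / N ^+ 2) / ((3 - 4 * s) * A * P * (Z * Q)) + q ^+ 2 / 4.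
  apply: addr_ge0; last by apply: divr_ge0 => //; exact: sqr_ge0.
  apply: divr_ge0; last by apply: ltW; rewrite !mulr_gt0.
  by apply: mulr_ge0; [apply: mulr_ge0 => //|apply: divr_ge0; first exact: ltW]; exact: sqr_ge0.
have Nn : N != 0 by rewrite gt_eqF.
have pn : pi != 0 :> R by rewrite gt_eqF.
have sn : 3 - 4 * s != 0 by rewrite gt_eqF.
have An : A != 0 by rewrite gt_eqF. have Pn : P != 0 by rewrite gt_eqF.
have Zn : Z != 0 by rewrite gt_eqF. have Qn : Q != 0 by rewrite gt_eqF.
rewrite (_ : (_ / N * d) ^+ 2 = (2 * M * N * d) ^+ 2 *
   (3 * k ^+ 2 * (V / N ^+ 2) / ((3 - 4 * s) * A * P * (Z * Q)) + q ^+ 2 / 4)); last first.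
  by rewrite -[in RHS](sqr_sqrtr E); field.
rewrite -/X [leLHS](_ : _ = (M * d) ^+ 2 * (k ^+ 2 * (3 / (3 - 4 * s) * X) + N ^+ 2 * q ^+ 2)); last first.
  rewrite c0_sqr /b; move: pn; move: (pi : R) => c cn; field.
  by do ?(apply/andP; split).
rewrite [leRHS](_ : _ = (M * d) ^+ 2 *
    (k ^+ 2 * (3 / (3 - 4 * s) * (4 * X / Q)) + N ^+ 2 * q ^+ 2)); last first.
  by rewrite XE; field; do ?(apply/andP; split).
rewrite ler_wpM2l ?sqr_ge0// lerD2r ler_wpM2l ?sqr_ge0// ler_wpM2l ?divr_ge0 ?(ltW s3)//.
by rewrite ler_pdivlMr// mulrC ler_wpM2r.
Qed.

End constants.

(** * The nonlinearity *)

Section C2.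
Context (R : realType).
Implicit Types (I : set R) (g : R -> R).

Lemma within_dnbhs_near I z (P : set R) : (\forall y \near within I z^', P y) ->
  \forall y \near z, I y -> y != z -> P y.
Proof.
rewrite near_withinE /dnbhs near_withinE; apply: filterS => y H Iy yz.
exact: H.
Qed.

Lemma derivable_within_cvg I g z : I z -> cvg ((fun y => (g y - g z) / (y - z)) @ within I z^') ->
  g y @[y --> within I (nbhs z)] --> g z.
Proof.
move=> Iz /cvg_ex[/= l ql]; apply/cvgrPdist_le => /= e e0.
have l0 : 0 < `|l| + 1 by rewrite ltr_wpDl.
have /within_dnbhs_near H1 : \forall y \near within I z^', `|l - (g y - g z) / (y - z)| <= 1.
  by move/cvgrPdist_le : ql => /(_ _ ltr01).
have H2 : \forall y \near z, `|z - y| <= e / (`|l| + 1).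
  by apply: (@cvgr_dist_le _ _ _ _ _ idfun z cvg_id); rewrite divr_gt0.
rewrite near_withinE; near=> y => Iy.
have [->|yz] := eqVneq y z; first by rewrite subrr normr0 ltW.
have h1 : `|l - (g y - g z) / (y - z)| <= 1 by move: Iy yz; near: y; exact: H1.
have h2 : `|z - y| <= e / (`|l| + 1) by near: y; exact: H2.
have yz0 : y - z != 0 by rewrite subr_eq0.
have -> : g z - g y = ((g y - g z) / (y - z)) * (z - y) by field.
rewrite normrM mulrC; rewrite ler_pdivlMr// in h2; apply: le_trans h2.
rewrite ler_wpM2l// -[X in `|X|](subKr l); apply: le_trans (ler_normB _ _) _.
by rewrite lerD2l.
Unshelve. all: by end_near. Qed.

Lemma derivable_within_continuous I g : derivable_within I g -> {within I, continuous g}.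
Proof.
by move=> dg; apply/subspace_continuousP => z Iz; apply: derivable_within_cvg (dg z Iz).
Qed.

(** Near an interior point the restriction to the interval is vacuous. This opens the way to the
    mean value theorem and identifies the relative derivative at 0 with [derive1 g 0]. *)
Lemma derivable_within_is_derive (a b : R) g z : derivable_within `[a, b]%classic g ->
  a < z < b -> is_derive z 1 g (derive_within `[a, b]%classic g z).
Proof.
move=> dg /andP[az zb]; set I := `[a, b]%classic.
have Iz : I z by rewrite /I /= in_itv/= !ltW.
have /= ql := dg z Iz; rewrite -/I in ql.
have H : h^-1 *: ((g \o shift z) (h *: (1 : R)) - g z) @[h --> 0^'] --> derive_within I g z.
  apply/cvgrPdist_le => /= e e0.
  have /within_dnbhs_near H1 : \forall y \near within I z^',
      `|derive_within I g z - (g y - g z) / (y - z)| <= e.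
    by move/cvgrPdist_le : ql => /(_ _ e0).
  have H2 : \forall y \near z, I y.
    have : \forall y \near z, y \in `]a, b[ by apply: near_in_itvoo; rewrite in_itv/= az.
    by apply: filterS => y; rewrite /I /= !in_itv/= => /andP[/ltW -> /ltW ->].
  have H3 : \forall y \near z, y != z -> `|derive_within I g z - (g y - g z) / (y - z)| <= e.
    by apply: filterS2 H1 H2 => y h Iy yz; exact: h.
  rewrite /dnbhs near_withinE; have /nbhs0P := H3.
  apply: filterS => h H h0; rewrite /= /shift /GRing.scale /= mulr1 (addrC h).
  have := H; rewrite addrAC subrr add0r mulrC; apply.
  by rewrite -subr_eq0 addrAC subrr add0r.
split; first by apply/cvg_ex; exists (derive_within I g z).
exact: cvg_lim H.
Qed.

(** Continuity on a compact interval bounds the set of values; without a bound, [sup] would say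
    nothing. *)
Lemma sup_norm_bound (a b : R) g z : {within `[a, b], continuous g} -> `[a, b]%classic z ->
  `|g z| <= C_norm `[a, b]%classic g.
Proof.
move=> cg zI.
have ab : a <= b by move: zI; rewrite /= in_itv/= => /andP[]; exact: le_trans.
have cn : {within `[a, b], continuous (fun z => `|g z|)}.
  by move=> x; apply: continuous_comp; [exact: cg|exact: norm_continuous].
have [c _ Hc] := EVT_max ab cn.
apply: ub_le_sup; last by exists z.
by exists `|g c| => _ [x xI <-]; apply: Hc.
Qed.

Section nonlinearity.
Variables (a M : R) (g : R -> R).
Hypotheses (a0 : 0 < a) (gD : D_M M `[- a, a]%classic g) (g0 : g 0 = 0) (dg0 : derive1 g 0 = 0).
Local Notation I := (`[- a, a]%classic : set R).
Let d := derive_within I g.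
Let dd := derive_within I d.

Let dg : derivable_within I g. Proof. by case: gD => -[]. Qed.
Let ddg : derivable_within I d. Proof. by case: gD => -[]. Qed.
Let cg : {within I, continuous g}. Proof. exact: derivable_within_continuous. Qed.
Let cd : {within I, continuous d}. Proof. exact: derivable_within_continuous. Qed.
Let cdd : {within I, continuous dd}. Proof. by case: gD => -[]. Qed.

Let I0 : I 0. Proof. by rewrite /= in_itv/= oppr_le0 !ltW. Qed.

Let norms : [/\ 0 <= C_norm I g, 0 <= C_norm I d & 0 <= C_norm I dd].
Proof. by split; [apply: le_trans (sup_norm_bound cg I0)|apply: le_trans (sup_norm_bound cd I0)|apply: le_trans (sup_norm_bound cdd I0)]. Qed.

Let sumM : C_norm I g + C_norm I d + C_norm I dd <= M. Proof. by case: gD. Qed.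

Lemma g_bound z : I z -> `|g z| <= M.
Proof. by move=> zI; have := sup_norm_bound cg zI; case: norms; move: sumM; lra. Qed.

Let d_bound z : I z -> `|d z| <= M.
Proof. by move=> zI; have := sup_norm_bound cd zI; case: norms; move: sumM; lra. Qed.

Let dd_bound z : I z -> `|dd z| <= M.
Proof. by move=> zI; have := sup_norm_bound cdd zI; case: norms; move: sumM; lra. Qed.

Let M0 : 0 <= M. Proof. by apply: le_trans (g_bound I0). Qed.

Let MVTI (h : R -> R) x y : derivable_within I h -> I x -> I y -> x < y ->
  exists2 c, x < c < y & h y - h x = derive_within I h c * (y - x).
Proof.
move=> dh; rewrite /= !in_itv/= => /andP[ax _] /andP[_ ya] xy.
have dh1 c : c \in `]x, y[ -> is_derive c 1 h (derive_within I h c).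
  rewrite in_itv/= => /andP[xc cy]; apply: derivable_within_is_derive => //.
  by rewrite (le_lt_trans ax xc) (lt_le_trans cy ya).
have ch : {within `[x, y], continuous h}.
  apply: continuous_subspaceW (derivable_within_continuous dh) => t /=.
  by rewrite !in_itv/= => /andP[xt ty]; rewrite (le_trans ax xt) (le_trans ty ya).
by have [c] := MVT xy dh1 ch; rewrite in_itv/= => xcy E; exists c.
Qed.

Let lip (h : R -> R) (L : R) x y : derivable_within I h ->
  (forall c, I c -> `|derive_within I h c| <= L) ->
  I x -> I y -> `|h x - h y| <= L * `|x - y|.
Proof.
move=> dh hL.
wlog xy : x y / x < y.
  move=> H xI yI; have [xy|yx|->] := ltgtP x y; first exact: H.
    by rewrite distrC (distrC x); exact: H.
  by rewrite !subrr normr0 mulr0.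
move=> xI yI; have [c /andP[xc cy] E] := MVTI dh xI yI xy.
rewrite distrC E normrM (distrC x) ler_wpM2r// hL//.
move: xI yI; rewrite /= !in_itv/= => /andP[ax _] /andP[_ ya].
by rewrite (ltW (le_lt_trans ax xc)) (ltW (lt_le_trans cy ya)).
Qed.

Lemma g_lip x y : I x -> I y -> `|g x - g y| <= M * `|x - y|.
Proof. exact: lip dg d_bound. Qed.

Let d0 : d 0 = 0.
Proof.
have H : is_derive (0 : R) 1 g (d 0).
  by apply: derivable_within_is_derive => //; rewrite oppr_lt0 a0.
by have [_ <-] := H; rewrite -derive1E.
Qed.

Let d_lin z : I z -> `|d z| <= M * `|z|.
Proof.
move=> zI; have := lip ddg dd_bound zI I0; rewrite d0 !subr0; exact.
Qed.

(** Here [e] is the sign of the points between [x] and [y]. From g'(0) = 0 follows |g'(c)| <= M |c|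
    = M e c, so M/2 e z^2 plus or minus g(z) is nondecreasing there; the two choices of sign give
    the absolute value. *)
Let quad (e x y : R) : e = 1 \/ e = -1 -> I x -> I y -> x < y ->
  (forall c, x < c < y -> 0 <= e * c) -> `|g y - g x| <= M / 2 * (e * (y ^+ 2 - x ^+ 2)).
Proof.
move=> e1 xI yI xy ec.
have key (f : R) : `|f| = 1 -> 0 <= M / 2 * (e * (y ^+ 2 - x ^+ 2)) - f * (g y - g x).
  move=> f1.
  pose psi (z : R) := M / 2 * e * z ^+ 2 - f * g z.
  pose dpsi (z : R) := M * e * z - f * d z.
  have ax : - a <= x by move: xI; rewrite /= in_itv/= => /andP[].
  have ya : y <= a by move: yI; rewrite /= in_itv/= => /andP[].
  have dpsi1 c : c \in `]x, y[ -> is_derive c 1 psi (dpsi c).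
    rewrite in_itv/= => /andP[xc cy].
    have dc : is_derive c 1 g (d c).
      by apply: derivable_within_is_derive => //; rewrite (le_lt_trans ax xc) (lt_le_trans cy ya).
    by rewrite /psi /dpsi; apply: is_derive_eq; rewrite /GRing.scale /=; field.
  have cpsi : {within `[x, y], continuous psi}.
    have cs : {within `[x, y], continuous g}.
      apply: continuous_subspaceW cg => t /=.
      by rewrite !in_itv/= => /andP[xt ty]; rewrite (le_trans ax xt) (le_trans ty ya).
    move=> t; apply: cvgB; last by apply: cvgM; [exact: cvg_cst|exact: cs].
    apply: cvgM; first exact: cvg_cst.
    have cq : {within `[x, y], continuous (fun z : R => z ^+ 2)}.
      by apply: continuous_subspaceT; exact: exprn_continuous.
    exact: cq.
  have [c] := MVT xy dpsi1 cpsi; rewrite in_itv/= => /andP[xc cy] E.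
  rewrite (_ : _ - _ = psi y - psi x); last by rewrite /psi; ring.
  rewrite E mulr_ge0//; last by rewrite subr_ge0 ltW.
  rewrite /dpsi subr_ge0 -mulrA.
  have cI : I c by rewrite /= in_itv/= (ltW (le_lt_trans ax xc)) (ltW (lt_le_trans cy ya)).
  have ec0 : 0 <= e * c by apply: ec; rewrite xc.
  have <- : `|c| = e * c.
    rewrite -(ger0_norm ec0) normrM (_ : `|e| = 1) ?mul1r//.
    by case: e1 => ->; rewrite ?normrN normr1.
  by apply: le_trans (ler_norm _) _; rewrite normrM f1 mul1r d_lin.
have h1 := key 1 (normr1 _); have h2 := key (-1); rewrite normrN normr1 in h2.
have {}h2 := h2 erefl.
by rewrite ler_norml; apply/andP; split; lra.
Qed.

Lemma g_quad x y : I x -> I y -> `|g x - g y| <= M / 2 * ((`|x| + `|y|) * `|x - y|).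
Proof.
wlog xy : x y / x < y.
  move=> H xI yI; have [xy|yx|->] := ltgtP x y; first exact: H.
    by rewrite distrC (distrC x) (addrC `|x|); exact: H.
  by rewrite !subrr normr0 !mulr0.
move=> xI yI; rewrite (distrC _ (g y)) (distrC x).
have [x0|x0] := leP 0 x.
  apply: le_trans (quad (or_introl erefl) xI yI xy _) _.
    by move=> c /andP[xc _]; rewrite mul1r (le_trans x0)// ltW.
  rewrite !ger0_norm ?(le_trans x0 (ltW xy)) ?subr_ge0 ?(ltW xy)//.
  by rewrite le_eqVlt; apply/orP; left; apply/eqP; ring.
have [y0|y0] := leP y 0.
  apply: le_trans (quad (or_intror erefl) xI yI xy _) _.
    by move=> c /andP[_ cy]; rewrite mulN1r oppr_ge0 (le_trans (ltW cy)).
  rewrite (ler0_norm y0) (ler0_norm (ltW x0)) ger0_norm ?subr_ge0 ?(ltW xy)//.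
  by rewrite le_eqVlt; apply/orP; left; apply/eqP; ring.
(* Opposite signs: the estimate passes through 0, and x^2 + y^2 <= (y - x)^2 because x y < 0. *)
have h1 : `|g 0 - g x| <= M / 2 * (-1 * (0 ^+ 2 - x ^+ 2)).
  apply: quad => //; first by right.
  by move=> c /andP[_ c0]; rewrite mulN1r oppr_ge0 ltW.
have h2 : `|g y - g 0| <= M / 2 * (1 * (y ^+ 2 - 0 ^+ 2)).
  apply: quad => //; first by left.
  by move=> c /andP[c0 _]; rewrite mul1r ltW.
rewrite (gtr0_norm y0) (ltr0_norm x0) (gtr0_norm (_ : 0 < y - x)) ?subr_gt0//.
have h3 := ler_distD (g 0) (g y) (g x).
apply: le_trans h3 _; apply: le_trans (lerD h2 h1) _.
have nx0 : 0 <= - x by rewrite oppr_ge0 ltW.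
rewrite -mulrDr ler_wpM2l ?divr_ge0//.
have := mulr_ge0 (ltW y0) nx0; rewrite expr0n/=; nra.
Qed.

(* Values outside [I] are replaced by [0]; a function bounded a.e. by [a] is
   not changed a.e. *)
Definition clamp (z : R) : R := if `|z| <= a then z else 0.

Lemma clampI z : I (clamp z).
Proof.
rewrite /clamp; case: ifP => [za|_]; last exact: I0.
by rewrite /= in_itv/= -ler_norml.
Qed.

Lemma clamp_le z : `|clamp z| <= `|z|.
Proof. by rewrite /clamp; case: ifP; rewrite ?normr0. Qed.

Lemma clamp_id z : `|z| <= a -> clamp z = z.
Proof. by rewrite /clamp => ->. Qed.

Lemma clamp_meas : measurable_fun setT (clamp : measurableTypeR R -> R).
Proof.
have -> : (clamp : measurableTypeR R -> R) = (fun z => z * \1_I z).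
  apply/funext => z; rewrite /clamp ler_norml indicE mem_setE in_itv/=.
  by case: ifP => _; rewrite ?mulr1 ?mulr0.
by apply: measurable_funM => //; apply: measurable_indic; exact: measurable_itv.
Qed.

(** Only continuity on [I] is available. Since [g 0 = 0], composing with [clamp] amounts to
    extending [g] by 0 outside [I]. *)
Lemma g_clamp_meas : measurable_fun setT ((fun z => g (clamp z)) : measurableTypeR R -> R).
Proof.
have -> : ((fun z => g (clamp z)) : measurableTypeR R -> R) = g \_ I.
  apply/funext => z; rewrite patchE mem_setE in_itv/= -ler_norml /clamp.
  by case: ifP.
have mI : measurable (I : set (measurableTypeR R)) by exact: measurable_itv.
apply: (measurable_restrictT g mI).1.
by apply: subspace_continuous_measurable_fun => //; exact: measurable_itv.
Qed.

End nonlinearity.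
End C2.

(** * The space H^2 *)

Section nullset.
Import HBNNSimple.
Context d (T : measurableType d) (R : realType) (mu : {measure set T -> \bar R}).

(* No measurability: a simple function below [f] can be cut off on the null
   set. *)
Lemma ge0_integral_null (N : set T) (f g : T -> \bar R) : measurable N -> mu N = 0%E ->
  (forall x, 0 <= f x)%E -> (forall x, 0 <= g x)%E ->
  (forall x, ~ N x -> f x = g x) -> (\int[mu]_x f x = \int[mu]_x g x)%E.
Proof.
move=> mN N0; have le (u v : T -> \bar R) : (forall x, 0 <= u x)%E -> (forall x, 0 <= v x)%E ->
    (forall x, ~ N x -> u x = v x) -> (\int[mu]_x u x <= \int[mu]_x v x)%E.
  move=> u0 v0 uv; rewrite !ge0_integralTE//.
  apply: ge_ereal_sup => _ [h hu <-].
  have mC := measurableC mN.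
  have -> : sintegral mu h = sintegral mu (proj_nnsfun h mC).
    rewrite -!integralT_nnsfun; apply: ae_eq_integral => //.
    - exact/measurable_EFinP.
    - exact/measurable_EFinP.
    exists N; split => // x /= H; apply: contrapT => nN; apply: H => _.
    by rewrite /= mindicE mem_set ?mulr1.
  apply: ereal_sup_ubound; exists (proj_nnsfun h mC) => //= x.
  rewrite mindicE; have [xN|xN] := pselect (N x).
    by rewrite memNset ?mulr0//= => /(_ xN).
  by rewrite mem_set ?mulr1// -uv.
move=> f0 g0 fg; apply/eqP; rewrite eq_le !le// => x Nx.
by rewrite fg.
Qed.

(** Stated without measurability because [g (u0 y + v y)] may fail to be measurable where its
    argument leaves [I]. Positive and negative parts are compared separately off the null set. *)
Lemma Rintegral_ae (f g : T -> R) : f = g %[ae mu] -> \int[mu]_x f x = \int[mu]_x g x.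
Proof.
move=> [N [mN N0 H]]; have fg x : ~ N x -> f x = g x.
  by move=> nN; apply: contrapT => nfg; apply: nN; apply: H => /= /(_ I).
rewrite /Rintegral; congr fine; rewrite integralE [RHS]integralE.
congr (_ - _)%E; apply: (ge0_integral_null mN N0) => // x nN.
- by rewrite !funeposE fg.
- by rewrite !funenegE fg.
Qed.

End nullset.

Section H2.
Context (R : realType).
Local Notation R3 := (R3 R).
Local Notation mu := (leb3 R).
Local Notation intg f := (mu.-integrable setT (EFin \o f)).
Local Notation L2 := (L2 mu).
Local Notation n2 := (n2 mu).
Implicit Types (f g h u v w K G : R3 -> R) (p x y z : R3).

Lemma conv3_ae K G G' : G = G' %[ae mu] -> conv3 K G = conv3 K G'.
Proof.
move=> GG; apply/funext => x; apply: Rintegral_ae.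
by apply: filterS GG => y /(_ I) /= ->.
Qed.

Lemma sobolev_ae c u : sobolev_constant c -> H2s 1 u ->
  \forall x \ae mu, `|u x| <= c * H2s_norm 1 u.
Proof.
move=> [c0 cS] Hu; have := cS u Hu; rewrite unlock.
(* The norm at infinity is an essential supremum only if the whole space has positive measure;
   otherwise the whole space is null. *)
case: ifPn => [m0|m0 _].
  by move=> /ess_supP; apply: filterS => x; rewrite /= lee_fin.
exists setT; split => //.
by apply/eqP; rewrite eq_le measure_ge0 leNgt m0.
Qed.

Lemma norm3_ae : \forall p \ae mu, norm3 (p : R3) != 0.
Proof.
(* The origin lies in the plane where the third coordinate is 0, a product set of evident measure
   0. *)
pose A : set R3 := setT `*` [set 0].
have m1 : measurable [set (0 : measurableTypeR R)] by exact: measurable_set1.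
exists A; split.
- by apply: measurableX => //; exact: measurableT.
- rewrite [LHS](@product_measure1E _ _ _ _ _ (prodsf (@lebesgue_measure R) (@lebesgue_measure R)) (@lebesgue_measure R))//.
  by rewrite [X in (_ * X)%E](lebesgue_measure_set1 0) mule0.
- move=> p /= /negP/negPn/eqP p0; split => //=.
  have [_ _] := norm3_coord p; rewrite p0 normr_le0 => /eqP.
  exact.
Qed.

Lemma HT_inj f g : L2 f -> L2 g -> HT f = HT g %[ae mu] -> f = g %[ae mu].
Proof.
move=> Lf Lg fg.
have := HT_ae (HT_L2 Lf) (HT_L2 Lg) fg => H.
apply: filterS3 H (HTK Lf) (HTK Lg) => x h1 h2 h3 _.
by rewrite -h2// h1// h3.
Qed.

Lemma H2_L2 u : H2s 1 u -> L2 u. Proof. by move=> /H2P[]. Qed.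

Lemma H2_wL2 u : H2s 1 u -> L2 (fun p => h2w p * HT u p). Proof. by move=> /H2P[]. Qed.

(** Membership in H^2 and the norm can be read off any measurable representative [h] of the
    transform; this is how solutions given by their Hartley transform are measured. *)
Lemma H2_intro u h : L2 u -> HT u = h %[ae mu] -> measurable_fun setT h ->
  L2 (fun p => h2w p * h p) -> H2s 1 u /\ H2s_norm 1 u = n2 (fun p => h2w p * h p).
Proof.
move=> Lu uh mh Lh; have [mH _] := HT_L2 Lu.
have E : (fun p => h2w p * h p) = (fun p => h2w p * HT u p) %[ae mu].
  by apply: filterS uh => p /(_ I) ->.
have L : L2 (fun p => h2w p * HT u p).
  by apply: L2_ae E Lh; exact: measurable_funM (@h2w_meas R) mH.
have Hu : H2s 1 u by apply/H2P.
by split => //; rewrite H2_normE//; apply: ae_n2 => //; apply: filterS E => p H /H ->.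
Qed.

Lemma H2_lin u v c : H2s 1 u -> H2s 1 v ->
  H2s 1 (fun x => u x + c * v x) /\
  H2s_norm 1 (fun x => u x + c * v x) = n2 (fun p => h2w p * HT u p + c * (h2w p * HT v p)).
Proof.
move=> Hu Hv; have Lu := H2_L2 Hu; have Lv := H2_L2 Hv.
have Wu := H2_wL2 Hu; have Wv := H2_wL2 Hv.
have [mu_ _] := HT_L2 Lu; have [mv_ _] := HT_L2 Lv.
rewrite (_ : (fun p => _ + _) = (fun p => h2w p * (HT u p + c * HT v p))); last first.
  by apply/funext => p; ring.
apply: H2_intro.
- by apply: L2D => //; exact: L2Z.
- exact: HT_lin.
- exact: measurable_funD mu_ (measurable_funM (measurable_cst c) mv_).
- have := L2D Wu (L2Z c Wv); congr L2; apply/funext => p /=; ring.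
Qed.

Lemma H2D u v : H2s 1 u -> H2s 1 v -> H2s 1 (fun x => u x + v x) /\
  H2s_norm 1 (fun x => u x + v x) <= H2s_norm 1 u + H2s_norm 1 v.
Proof.
move=> Hu Hv; have [H E] := H2_lin 1 Hu Hv.
rewrite (_ : (fun x => u x + v x) = (fun x => u x + 1 * v x)); last by apply/funext => x; rewrite mul1r.
split=> //; rewrite E !H2_normE//.
under [X in n2 X]funext do rewrite mul1r.
by apply: n2D; exact: H2_wL2.
Qed.

Lemma H2B u v : H2s 1 u -> H2s 1 v -> H2s 1 (fun x => u x - v x) /\
  H2s_norm 1 (fun x => u x - v x) = n2 (fun p => h2w p * HT u p - h2w p * HT v p).
Proof.
move=> Hu Hv; have [H E] := H2_lin (-1) Hu Hv.
rewrite (_ : (fun x => u x - v x) = (fun x => u x + -1 * v x)); last by apply/funext => x; rewrite mulN1r.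
split=> //; rewrite E; congr n2; apply/funext => p; ring.
Qed.

Lemma n2_le_H2 u : H2s 1 u -> n2 u <= H2s_norm 1 u.
Proof.
move=> Hu; have Lu := H2_L2 Hu; rewrite H2_normE// -(HT_iso Lu).
apply: n2_le; [exact: HT_L2|exact: H2_wL2|move=> p].
by rewrite normrM ler_peMl// ger0_norm ?h2w_ge1// (le_trans ler01) ?h2w_ge1.
Qed.

Lemma H2_norm_ge0 u : 0 <= H2s_norm 1 u. Proof. exact: sqrtr_ge0. Qed.

Lemma H2_dist0 u v : H2s 1 u -> H2s 1 v -> H2s_norm 1 (fun x => u x - v x) = 0 -> u = v %[ae mu].
Proof.
move=> Hu Hv H0; apply: n2_ae0; [exact: H2_L2|exact: H2_L2|].
have [H _] := H2B Hu Hv; apply/eqP; rewrite eq_le n2_ge0 andbT -H0.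
exact: n2_le_H2.
Qed.

(** u -> [h2w p * HT u p] is an isometry of H^2 onto L^2: a limit [W] in L^2 is divided by the
    weight, which is at least 1, and transformed back. *)
Lemma H2_complete (v : nat -> R3 -> R) : (forall n, H2s 1 (v n)) ->
  cauchyL2 mu (fun n p => h2w p * HT (v n) p) ->
  exists2 u, H2s 1 u & forall e, 0 < e -> exists N, forall n, (N <= n)%N ->
    H2s_norm 1 (fun x => v n x - u x) <= e.
Proof.
move=> Hv Cv; have [W LW cW] := complete_L2 (fun n => H2_wL2 (Hv n)) Cv.
pose U p := (h2w p)^-1 * W p.
have w0 p : 0 < h2w (p : R3) by apply: lt_le_trans (h2w_ge1 p).
have mU : measurable_fun setT U.
  apply: measurable_funM; last by case: LW.
  rewrite (_ : (fun p => _) = (fun p => h2w p `^ (-1))); last first.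
    by apply/funext => p; rewrite powR_inv1// ltW.
  exact: measurableT_comp (@measurable_powR R (-1)) (@h2w_meas R).
have UW p : h2w p * U p = W p by rewrite /U mulVKf// gt_eqF.
have LU : L2 U.
  apply: (L2_le mU _ LW) => p; rewrite /U normrM ler_piMl// gtr0_norm ?invr_gt0//.
  by rewrite invf_le1// h2w_ge1.
have LhU : L2 (fun p => h2w p * U p) by rewrite (funext UW).
have Lu := HT_L2 LU.
have [Hu _] := H2_intro Lu (HTK LU) mU LhU.
exists (HT U) => // e /cW[N HN]; exists N => n Nn; have [_ ->] := H2B (Hv n) Hu.
apply: le_trans (HN n Nn); rewrite le_eqVlt; apply/orP; left; apply/eqP.
apply: ae_n2; [exact: L2B (H2_wL2 (Hv n)) (H2_wL2 Hu)|exact: L2B (H2_wL2 (Hv n)) LW|].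
by apply: filterS (HTK LU) => p /(_ I) E _; rewrite E UW.
Qed.

Lemma solhat_norm (s1 s2 M N d q B : R) K G :
  0 < s1 < 3 / 4 -> 0 < s2 -> intg K -> intg G -> L2 G -> (forall x, `|G x| <= B) ->
  0 < N -> 0 <= M -> 0 <= d ->
  \int[mu]_x `|G x| <= M * N * d -> n2 G <= M * d ->
  L2 (fun p => symb (1 - s1) p * T0 K p) -> n2 (fun p => symb (1 - s1) p * T0 K p) <= q ->
  L2 (fun p => h2w p * solhat s1 s2 (conv3 K G) p) /\
  n2 (fun p => h2w p * solhat s1 s2 (conv3 K G) p) <=
  2 * M * N ^+ 2 * Num.sqrt
    (3 * (\int[mu]_x `|K x|) ^+ 2 * N `^ (8 * s1 / 3 - 2)
     / ((3 - 4 * s1) * s1 `^ (4 * s1 / 3) * pi `^ (8 * s1 / 3)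
        * 2 `^ (4 * s1 + 8 * s1 / 3))
     + q ^+ 2 / 4) / N * d.
Proof.
move=> s1r s20 iK iG LG GB N0 M0 d0 Ga Gb LQ Qq.
have /andP[s10 s13] := s1r.
apply: L2_of_eint.
- apply: measurable_funM (@h2w_meas R) (solhat_meas _ _ _).
  exact: conv_intg iG GB.
- pose r := (8 * pi ^+ 2 * s1 / N ^+ 2) `^ (3^-1).
  have r0 : 0 < r.
    by apply: powR_gt0; rewrite !mulr_gt0// ?invr_gt0 ?exprn_gt0// pi_gt0.
  apply: le_trans (solhat_int s1r s20 r0 iK iG LG GB (lexx _) Ga Gb LQ Qq) _.
  by rewrite lee_fin; exact: H_const_bound.
- by rewrite mulr_ge0// divr_ge0 ?(ltW N0)// mulr_ge0 ?sqrtr_ge0// mulr_ge0 ?sqr_ge0// mulr_ge0.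
Qed.

End H2.

(** * The linear equation *)

Section solve.
Context (R : realType).
Local Notation R3 := (R3 R).
Local Notation mu := (leb3 R).
Local Notation intg f := (mu.-integrable setT (EFin \o f)).
Local Notation L2 := (L2 mu).
Local Notation n2 := (n2 mu).
Implicit Types (f h u v w K G : R3 -> R) (p x y z : R3).

Lemma symb_mono s t p : 0 <= s <= t -> symb s p <= 1 + symb t p.
Proof.
move=> /andP[s0 st]; rewrite /symb; have [p1|p1] := leP (norm3 p) 1.
  apply: (@le_trans _ _ 1); last by rewrite lerDl powR_ge0.
  have := @ge0_ler_powR R (2 * s) (mulr_ge0 (ler0n _ 2) s0) (norm3 p) 1.
  by rewrite powR1 !nnegrE norm3_ge0 ler01 => ->.
by rewrite (le_trans _ (_ : norm3 p `^ (2 * t) <= _)) ?lerDr// ler_powR ?(ltW p1)// ler_wpM2l.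
Qed.

Lemma symb_h2w s p : 0 <= s <= 1 -> symb s p <= 2 * h2w p.
Proof.
move=> s01; apply: le_trans (symb_mono p s01) _.
have h1 := h2w_ge1 p.
suff : symb 1 p <= h2w p by lra.
rewrite -(@ler_pXn2r _ 2)// ?nnegrE ?symb_ge0 ?(le_trans ler01 h1)// h2w_sqr symb1 -exprM.
by rewrite lerDr.
Qed.

Lemma L2_symb_mono s t h : 0 <= s <= t -> L2 h -> L2 (fun p => symb t p * h p) ->
  L2 (fun p => symb s p * h p).
Proof.
move=> st Lh Lt; have [mh _] := Lh.
have [A1 _] := n2_abs Lh; have [A2 _] := n2_abs Lt.
apply: (L2_le _ _ (L2D A1 A2)).
  exact: measurable_funM (@symb_meas R s) mh.
move=> p; rewrite [leRHS]ger0_norm ?addr_ge0// !normrM !(ger0_norm (symb_ge0 _ _)).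
by rewrite -[X in X + _]mul1r -mulrDl ler_wpM2r// symb_mono.
Qed.

Lemma fraclap_sum s1 s2 u : 0 <= s1 <= s2 -> H2s s2 u ->
  L2 (fun x => fraclap s1 u x + fraclap s2 u x) /\
  HT (fun x => fraclap s1 u x + fraclap s2 u x) =
    (fun p => (symb s1 p + symb s2 p) * HT u p) %[ae mu].
Proof.
move=> s12 /H2sP[Lu L2u]; have L1u := L2_symb_mono s12 (HT_L2 Lu) L2u.
have [F1 E1] := fraclap_hat Lu L1u; have [F2 E2] := fraclap_hat Lu L2u.
split; first exact: L2D F1 F2.
rewrite (_ : (fun x => _) = (fun x => fraclap s1 u x + 1 * fraclap s2 u x)); last first.
  by apply/funext => x; rewrite mul1r.
apply: filterS3 (HT_lin 1 F1 F2) E1 E2 => p h1 h2 h3 _.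
by rewrite h1// h2// h3// mul1r mulrDl.
Qed.

Lemma solvesP s1 s2 h u : 0 <= s1 <= s2 -> L2 h ->
  solves s1 s2 h u <-> H2s s2 u /\ HT h = (fun p => (symb s1 p + symb s2 p) * HT u p) %[ae mu].
Proof.
move=> s12 Lh; split=> -[Hu E]; split => //; have [LF EF] := fraclap_sum s12 Hu.
  by apply: filterS2 (HT_ae LF Lh E) EF => p h1 h2 _; rewrite -h1// h2.
apply: HT_inj => //.
by apply: filterS2 E EF => p h1 h2 _; rewrite h1// h2.
Qed.

(** The combined symbol vanishes only at the origin, a null set. Dividing by it gives existence,
    cancelling it gives uniqueness, and membership in the space of order 2 s2 follows from
    [symb s2 p <= 2 * h2w p]. *)
Lemma solhat_solves s1 s2 h (u := HT (solhat s1 s2 h)) : 0 < s1 < s2 -> s2 < 1 ->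
  intg h -> L2 h -> L2 (fun p => h2w p * solhat s1 s2 h p) ->
  [/\ H2s 1 u, H2s_norm 1 u = n2 (fun p => h2w p * solhat s1 s2 h p),
      HT u = solhat s1 s2 h %[ae mu], solves s1 s2 h u &
      forall w, solves s1 s2 h w -> w = u %[ae mu]].
Proof.
move=> /andP[s10 s12] s21 ih Lh LU.
have s1' : 0 <= s1 <= s2 by rewrite !ltW.
have s20 : 0 < s2 by exact: lt_trans s12.
have mU := solhat_meas s1 s2 ih.
have LUh : L2 (solhat s1 s2 h) by have [] := (L2_h2w mU).1 LU.
have Lu : L2 u := HT_L2 LUh.
have Eu : HT u = solhat s1 s2 h %[ae mu] := HTK LUh.
have [Hu Nu] := H2_intro Lu Eu mU LU.
have pos p : norm3 p != 0 -> symb s1 p + symb s2 p != 0.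
  move=> p0; have n0 : 0 < norm3 p by rewrite lt_def p0 norm3_ge0.
  by rewrite gt_eqF// addr_gt0// powR_gt0.
have Hs2 : H2s s2 u.
  apply/H2sP; split => //.
  apply: (L2_le _ _ (L2Z 2 (H2_wL2 Hu))).
    by have [mH _] := HT_L2 Lu; exact: measurable_funM (@symb_meas R s2) mH.
  move=> p; rewrite mulrA !normrM ler_wpM2r// -normrM ger0_norm ?symb_ge0//.
  by apply: le_trans (symb_h2w _ _) (ler_norm _); rewrite !ltW.
have Eh : HT h = (fun p => (symb s1 p + symb s2 p) * HT u p) %[ae mu].
  apply: filterS3 (HT_T0 ih Lh) Eu (@norm3_ae R) => p h1 h2 h3 _.
  by rewrite h1// h2// /solhat mulrC divfK// pos.
split => //; first exact/solvesP.
move=> w /(solvesP _ s1' Lh)[/H2sP[Lw _] Ew].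
apply: HT_inj => //.
apply: filterS3 Ew Eh (@norm3_ae R) => p h1 h2 h3 _.
have := h1 I; rewrite h2// => /(mulfI (pos p h3)) ->//.
Qed.

Lemma solhatZ s1 s2 c h p : intg h -> solhat s1 s2 (fun x => c * h x) p = c * solhat s1 s2 h p.
Proof. by move=> ih; rewrite /solhat T0Z// mulrA. Qed.

Lemma solhatB s1 s2 h k p : intg h -> intg k ->
  solhat s1 s2 (fun x => h x - k x) p = solhat s1 s2 h p - solhat s1 s2 k p.
Proof. by move=> ih ik; rewrite /solhat T0B// mulrBl. Qed.

(** Applying (-Delta)^(1 - s1) to the equation multiplies the transform of u by |p|^2 + |p|^(2 - 2
    s1 + 2 s2), which dominates |p|^2; hence the condition on f puts u in H^2. A zero norm would
    force f = 0. *)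
Lemma solves_H2 s1 s2 f u : 0 < s1 < s2 -> s1 < 1 -> intg f -> fraclap_in_L2 (1 - s1) f ->
  solves s1 s2 f u -> ~ (f = cst 0 %[ae mu]) -> H2s 1 u /\ 0 < H2s_norm 1 u.
Proof.
move=> /andP[s10 s12] s11 jf [w fw] su f0.
have s1' : 0 <= s1 <= s2 by rewrite !ltW.
have [Hu Ef] := su; have [LF EF] := fraclap_sum s1' Hu.
have mf := integrable_meas jf.
(* Square integrability of [f] comes from the equation, whose left side is in L^2. *)
have Lf : L2 f := L2_ae mf Ef LF.
have [_ Eh] := (solvesP _ s1' Lf).1 su.
have [Lu _] := (H2sP s2 u).1 Hu; have [mH _] := HT_L2 Lu.
have [Lw Ew] := is_fraclap_T0 jf fw.
have H2u : H2s 1 u.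
  apply/H2sP; split => //.
  pose X p := symb (1 - s1) p * ((symb s1 p + symb s2 p) * HT u p).
  have mX : measurable_fun setT X.
    apply: measurable_funM (@symb_meas R _) (measurable_funM _ mH).
    exact: measurable_funD (@symb_meas R s1) (@symb_meas R s2).
  have LX : L2 X.
    apply: L2_ae mX _ (HT_L2 Lw); apply: filterS3 Ew Eh (HT_T0 jf Lf) => p h1 h2 h3 _.
    by rewrite h1// -h3// h2.
  apply: (L2_le _ _ LX); first exact: measurable_funM (@symb_meas R 1) mH.
  move=> p; rewrite /X mulrA [leLHS]normrM [leRHS]normrM ler_wpM2r// mulrDr.
  have -> : symb (1 - s1) p * symb s1 p = symb 1 p.
    rewrite /symb -powRD; first by congr (_ `^ _); ring.
    by apply/implyP => /eqP; lra.
  have h0 := mulr_ge0 (symb_ge0 (1 - s1) p) (symb_ge0 s2 p).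
  rewrite ger0_norm ?symb_ge0//; apply: le_trans (ler_norm _).
  by rewrite lerDl.
split => //; rewrite lt_def H2_norm_ge0 andbT; apply/eqP => n00.
have L20' := @L20 _ _ _ mu.
apply: f0.
have u0 : u = (fun=> 0) %[ae mu].
  apply: n2_eq0 => //; apply/eqP; rewrite eq_le n2_ge0 andbT -n00; exact: n2_le_H2.
have H0 : HT u = HT (fun=> 0) %[ae mu] by exact: HT_ae.
have H00 : HT (fun=> 0) = (fun=> 0) %[ae mu].
  by apply: n2_eq0; [exact: HT_L2|rewrite HT_iso// n2_0].
have HF : HT f = HT (fun=> 0) %[ae mu].
  by apply: filterS3 Eh H0 H00 => p h1 h2 h3 _; rewrite h1// h2// h3// mulr0.
exact: HT_inj HF.
Qed.

End solve.

(** * The contraction *)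

Section nemytskii.
Context (R : realType).
Local Notation R3 := (R3 R).
Local Notation mu := (leb3 R).
Local Notation intg f := (mu.-integrable setT (EFin \o f)).
Local Notation L2 := (L2 mu).
Local Notation n2 := (n2 mu).
Implicit Types (f h u v w K G : R3 -> R) (p x y z : R3).
Variables (a M : R) (g : R -> R).
Hypotheses (a0 : 0 < a) (M0 : 0 < M) (gD : D_M M `[- a, a]%classic g) (g0 : g 0 = 0)
  (dg0 : derive1 g 0 = 0).

Lemma clamp_L2 w : L2 w -> L2 (fun x => clamp a (w x)) /\ n2 (fun x => clamp a (w x)) <= n2 w.
Proof.
move=> Lw; have [mw _] := Lw.
have L : L2 (fun x => clamp a (w x)).
  apply: (L2_le _ _ Lw); first exact: measurableT_comp (@clamp_meas R a) mw.
  by move=> x; exact: clamp_le.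
by split => //; apply: n2_le => // x; exact: clamp_le.
Qed.

Definition gc w x : R := g (clamp a (w x)).

Lemma gc_meas w : measurable_fun setT w -> measurable_fun setT (gc w).
Proof. by move=> mw; exact: measurableT_comp (g_clamp_meas gD g0) mw. Qed.

(** The quadratic bound and Cauchy-Schwarz give the L^1 estimate M/2 (N + N) d; the Lipschitz bound
    gives the L^2 estimate. Both have the form that [solhat_norm] expects. *)
Lemma gc_diff w1 w2 (N d : R) (D := fun x => gc w1 x - gc w2 x) :
  L2 w1 -> L2 w2 -> n2 w1 <= N -> n2 w2 <= N ->
  n2 (fun x => clamp a (w1 x) - clamp a (w2 x)) <= d ->
  [/\ intg D, L2 D, (forall x, `|D x| <= 2 * M), \int[mu]_x `|D x| <= M * N * d & n2 D <= M * d].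
Proof.
move=> L1 L2' n1 n2' nd.
pose z1 x := clamp a (w1 x); pose z2 x := clamp a (w2 x).
have [Lz1 nz1] := clamp_L2 L1; have [Lz2 nz2] := clamp_L2 L2'.
have Ld := L2B Lz1 Lz2.
have [A1 E1] := n2_abs Lz1; have [A2 E2] := n2_abs Lz2; have [Ad Ed] := n2_abs Ld.
have mD : measurable_fun setT D.
  by apply: measurable_funB; apply: gc_meas; [case: L1|case: L2'].
have D1 x : `|D x| <= M / 2 * ((`|z1 x| + `|z2 x|) * `|z1 x - z2 x|).
  exact: (g_quad a0 gD dg0 (clampI a0 _) (clampI a0 _)).
have D2 x : `|D x| <= M * `|z1 x - z2 x|.
  exact: (g_lip a0 gD (clampI a0 _) (clampI a0 _)).
have ii := L2_mul (L2D A1 A2) Ad.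
have iD : intg D by apply: (le_intg mD D1); exact: (intgZ (M / 2) ii).
have LMd := L2Z M Ld.
have D2' x : `|D x| <= `|M * (z1 x - z2 x)| by rewrite normrM (gtr0_norm M0).
have LD : L2 D := L2_le mD D2' LMd.
have N0 : 0 <= N by apply: le_trans n1; exact: n2_ge0.
have d0 : 0 <= d by apply: le_trans nd; exact: n2_ge0.
split => //.
- move=> x; apply: le_trans (ler_normB _ _) _.
  have h1 := g_bound a0 gD (clampI a0 (w1 x)); have h2 := g_bound a0 gD (clampI a0 (w2 x)).
  by rewrite (_ : 2 * M = M + M); [exact: lerD h1 h2|ring].
- have iaD := intg_abs iD.
  apply: (@le_trans _ _ (M / 2 * ip mu (fun x => `|z1 x| + `|z2 x|) (fun x => `|z1 x - z2 x|))).
    rewrite /ip -(RintZ _ ii); apply: le_Rintegral.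
    - exact: measurableT.
    - exact: iaD.
    - exact: (intgZ (M / 2) ii).
    - by move=> x _; exact: D1.
  have h1 := le_trans (ler_norm _) (CSn (L2D A1 A2) Ad).
  have h2 := n2D A1 A2; rewrite E1 E2 in h2; rewrite Ed in h1.
  have -> : M * N * d = M / 2 * ((N + N) * d) by field.
  rewrite ler_wpM2l ?divr_ge0 ?(ltW M0)//.
  apply: le_trans h1 _; apply: ler_pM => //; rewrite ?n2_ge0//.
  apply: le_trans h2 _; apply: lerD.
    exact: le_trans nz1 n1.
  exact: le_trans nz2 n2'.
- apply: le_trans (n2_le LD LMd D2') _.
  by rewrite (n2Z M Ld) (gtr0_norm M0) ler_wpM2l// ltW.
Qed.

(** The difference estimate against the zero function, with [N] itself as the distance. *)
Lemma gc_single w (N : R) : L2 w -> n2 w <= N ->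
  [/\ intg (gc w), L2 (gc w), (forall x, `|gc w x| <= 2 * M),
      \int[mu]_x `|gc w x| <= M * N * N & n2 (gc w) <= M * N].
Proof.
move=> Lw nw; have c0 : clamp a 0 = 0 by rewrite clamp_id// normr0 ltW.
have N0 : 0 <= N by apply: le_trans nw; exact: n2_ge0.
have [_ nc] := clamp_L2 Lw.
have := @gc_diff w (fun=> 0) N N Lw (L20 _) nw _ _.
rewrite n2_0 (_ : (fun x => clamp a (w x) - clamp a 0) = (fun x => clamp a (w x))); last first.
  by apply/funext => x; rewrite c0 subr0.
rewrite (_ : (fun x => gc w x - gc (fun=> 0) x) = gc w); last first.
  by apply/funext => x; rewrite /gc c0 g0 subr0.
move=> /(_ N0 (le_trans nc nw)) [h1 h2 h3 h4 h5]; have E x : gc w x - gc (fun=> 0) x = gc w x.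
  by rewrite /gc c0 g0 subr0.
split => // [x|]; first by rewrite -E.
by apply: le_trans h4; under [leRHS]eq_Rint do rewrite E.
Qed.

End nemytskii.

(** * Banach's fixed point argument in H^2 *)

Section banach.
Context (R : realType).
Local Notation R3 := (R3 R).
Local Notation mu := (leb3 R).
Implicit Types (u v w : R3 -> R).

Local Notation dist u v := (H2s_norm 1 (fun x => u x - v x)).

Lemma H2_distC u v : H2s 1 u -> H2s 1 v -> dist u v = dist v u.
Proof. by move=> Hu Hv; have [_ ->] := H2B Hu Hv; have [_ ->] := H2B Hv Hu; exact: n2BC. Qed.

Lemma H2_tri u v w : H2s 1 u -> H2s 1 v -> H2s 1 w -> dist u w <= dist u v + dist v w.
Proof.
move=> Hu Hv Hw; have [_ ->] := H2B Hu Hv; have [_ ->] := H2B Hv Hw; have [_ ->] := H2B Hu Hw.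
by apply: n2_tri; exact: H2_wL2.
Qed.

Lemma H2_norm_tri u v : H2s 1 u -> H2s 1 v -> H2s_norm 1 u <= dist v u + H2s_norm 1 v.
Proof.
move=> Hu Hv; have [H E] := H2B Hu Hv.
have [_] := H2D H Hv; rewrite (H2_distC Hv Hu).
by rewrite (_ : (fun x => u x - v x + v x) = u)//; apply/funext => x; rewrite subrK.
Qed.

Lemma H2_zero : H2s 1 (fun=> 0 : R) /\ H2s_norm 1 (fun=> 0 : R) = 0.
Proof.
have L0 : L2 mu (fun=> 0) := @L20 _ _ _ mu.
have H00 : HT (fun=> 0) = (fun=> 0 : R) %[ae mu].
  by apply: n2_eq0; [exact: HT_L2|rewrite HT_iso// n2_0].
have E : (fun p => h2w p * (0 : R)) = (fun=> 0) :> (R3 -> R).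
  by apply/funext => p; rewrite mulr0.
have [||H N] := H2_intro L0 H00; first exact: measurable_cst.
  by rewrite E.
by split => //; rewrite N E n2_0.
Qed.

(** [T] acts on representatives, so the distance is a pseudometric and the fixed point is one only
    almost everywhere. The iteration starts at 0, and the limit stays in the ball by the triangle
    inequality. *)
Lemma banach (rho q : R) (T : (R3 -> R) -> R3 -> R) : 0 < rho -> 0 <= q < 1 ->
  (forall v, H2_ball rho v -> H2_ball rho (T v)) ->
  (forall u v, H2_ball rho u -> H2_ball rho v -> dist (T u) (T v) <= q * dist u v) ->
  exists2 u, H2_ball rho u & T u = u %[ae mu].
Proof.
move=> rho0 /andP[q0 q1] TB Tq.
pose v n := iter n T (fun=> 0).
have Bv n : H2_ball rho (v n).
  elim: n => [|n IH] /=; last exact: TB.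
  by have [H N] := H2_zero; split => //=; rewrite N ltW.
have Hv n : H2s 1 (v n) by case: (Bv n).
have step1 n : dist (v n.+1) (v n) <= q ^+ n * dist (v 1%N) (v 0%N).
  elim: n => [|n IH]; first by rewrite expr0 mul1r.
  apply: le_trans (Tq _ _ (Bv n.+1) (Bv n)) _.
  by rewrite exprS -mulrA ler_wpM2l.
set D := dist (v 1%N) (v 0%N) in step1; have D0 : 0 <= D by exact: H2_norm_ge0.
have q1' : 0 < 1 - q by rewrite subr_gt0.
(* With the partial geometric sum in closed form, (1 - q^k) / (1 - q), the induction step is an
   identity after one triangle inequality. *)
have stepk n k : dist (v (n + k)%N) (v n) <= q ^+ n * D / (1 - q) * (1 - q ^+ k).
  elim: k => [|k IH].
    rewrite addn0 expr0 subrr mulr0; have [_ ->] := H2B (Hv n) (Hv n).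
    by under [X in n2 _ X]funext do rewrite subrr; rewrite n2_0.
  apply: le_trans (H2_tri (Hv _) (Hv (n + k)%N) (Hv n)) _.
  rewrite addnS; apply: le_trans (lerD (step1 (n + k)%N) IH) _.
  rewrite le_eqVlt; apply/orP; left; apply/eqP.
  by rewrite exprD exprS; field; rewrite gt_eqF.
have small e : 0 < e -> exists N, forall n, (N <= n)%N -> q ^+ n * D / (1 - q) <= e.
  move=> e0; have : (fun n => q ^+ n * (D / (1 - q))) @ \oo --> (0 * (D / (1 - q)) : R).
    apply: cvgM; last exact: cvg_cst.
    by apply: cvg_expr; rewrite ger0_norm.
  rewrite mul0r => /cvgr0Pnorm_le /(_ _ e0) [N _ HN]; exists N => n Nn.
  have := HN n Nn; rewrite /= ger0_norm mulrA//.
  by rewrite divr_ge0 ?(ltW q1')// mulr_ge0 ?exprn_ge0.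
have Cv : cauchyL2 mu (fun n p => h2w p * HT (v n) p).
  move=> e e0; have e2 : 0 < e / 2 by rewrite divr_gt0.
  have [N HN] := small _ e2; exists N.
  have near_ n : (N <= n)%N -> dist (v n) (v N) <= e / 2.
    move=> Nn; rewrite -(subnKC Nn); apply: le_trans (stepk _ _) _.
    apply: le_trans (HN N (leqnn N)); rewrite ler_piMr//.
      by rewrite divr_ge0 ?(ltW q1')// mulr_ge0 ?exprn_ge0.
    by rewrite gerBl exprn_ge0.
  move=> m n Nm Nn; have [_ <-] := H2B (Hv m) (Hv n).
  apply: le_trans (H2_tri (Hv m) (Hv N) (Hv n)) _.
  by rewrite [leRHS]splitr lerD ?near_// H2_distC// near_.
have [u Hu cu] := H2_complete Hv Cv.
have Bu : H2_ball rho u.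
  split => //; apply/ler_addgt0Pr => e e0; have [N HN] := cu _ e0.
  apply: le_trans (H2_norm_tri Hu (Hv N)) _.
  by rewrite addrC lerD ?HN//; case: (Bv N).
exists u => //; have [HTu _] := TB u Bu.
apply: H2_dist0 => //; apply/eqP; rewrite eq_le H2_norm_ge0 andbT.
apply/ler_addgt0Pr => e e0; rewrite add0r.
have e2 : 0 < e / 2 by rewrite divr_gt0.
have [N HN] := cu _ e2.
apply: le_trans (H2_tri HTu (Hv N.+1) Hu) _.
rewrite [leRHS]splitr lerD ?HN//.
apply: le_trans (Tq _ _ Bu (Bv N)) _; rewrite (H2_distC Hu (Hv N)).
apply: le_trans (HN N (leqnn N)); rewrite ler_piMl ?H2_norm_ge0// ltW//.
Qed.

End banach.

Theorem theorem1p3 (R : realType) (s1 s2 c_e M : R)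
    (f K u0 : R3 R -> R) (g : R -> R)
    (n0 := H2s_norm 1 u0)
    (I := `[- (c_e * n0) - c_e, c_e * n0 + c_e]%classic)
    (s1_range : 1 / 4 < s1 < 3 / 4) (s2_range : s1 < s2 < 1)
    (c_e_sobolev : sobolev_constant c_e)
    (f_nontrivial : ~ (f = cst 0 %[ae leb3 R]))
    (f_L1 : f \in Lfun (leb3 R) 1)
    (f_fraclap : fraclap_in_L2 (1 - s1) f)
    (K_L1 : K \in Lfun (leb3 R) 1)
    (K_fraclap : fraclap_in_L2 (1 - s1) K)
    (Q_gt0 : 0 < L2norm (fraclap (1 - s1) K))
    (u0_sol : solves s1 s2 f u0)
    (M_gt0 : 0 < M)
    (g0 : g 0 = 0) (dg0 : derive1 g 0 = 0)
    (g_DM : D_M M I g)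
    (g_nontrivial : exists2 z, I z & g z != 0) :
  forall rho eps : R, 0 < rho <= 1 ->
    0 < eps <= rho / H_const s1 M K u0 ->
    exists t_g : (R3 R -> R) -> (R3 R -> R),
      [/\ is_solution_map s1 s2 eps rho K g u0 t_g,
          strict_contraction_on (H2_ball rho) t_g &
          exists u_p : R3 R -> R,
            [/\ H2_ball rho u_p,
                t_g u_p = u_p %[ae leb3 R],
                (forall w, H2_ball rho w -> t_g w = w %[ae leb3 R] ->
                   w = u_p %[ae leb3 R]),
                solves s1 s2 (rhs eps K g u0 u_p) u_p &
                (forall w, H2_ball rho w ->
                   solves s1 s2 (rhs eps K g u0 w) w ->
                   w = u_p %[ae leb3 R])]].
Proof.
move=> rho eps /andP[rho0 rho1] /andP[eps0 epsH].
have /andP[s14 s13] := s1_range; have /andP[s12 s21] := s2_range.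
have s10 : 0 < s1 by lra.
have s34 : 0 <= 3 - 4 * s1 by lra.
have s20 : 0 < s2 by exact: lt_trans s12.
have s1r : 0 < s1 < 3 / 4 by rewrite s10.
have s12r : 0 < s1 < s2 by rewrite s10.
have s1l : 0 <= s1 <= s2 by rewrite !ltW.
pose mu := leb3 R.
have jf := (Lfun1P f).1 f_L1; have iK := (Lfun1P K).1 K_L1.
have s1l1 : s1 < 1 by lra.
have [Hu0 n00] := solves_H2 s12r s1l1 jf f_fraclap u0_sol f_nontrivial.
rewrite -/n0 in n00.
have ce0 : 0 < c_e by case: c_e_sobolev.
pose a := c_e * n0 + c_e; have a0 : 0 < a by rewrite addr_gt0// mulr_gt0.
have gD : D_M M `[- a, a]%classic g.
  by move: g_DM; rewrite /I /a opprD.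
pose N := n0 + 1; have N0 : 0 < N by rewrite addr_gt0.
(* [K] is given in L^1, so its fractional Laplacian is matched with [T0 K]; [Q] thereby becomes the
   norm required by [solhat_norm]. *)
have [wK [LwK EwK]] : exists w, L2 mu w /\
    (L2norm (fraclap (1 - s1) K) = n2 mu w) /\ HT w = (fun p => symb (1 - s1) p * T0 K p) %[ae mu].
  have [L E] := is_fraclap_T0 iK (fraclap_get K_fraclap).
  by exists (fraclap (1 - s1) K); rewrite L2normE.
move: EwK => [QE EwK].
have mTK : measurable_fun setT (fun p => symb (1 - s1) p * T0 K p).
  exact: measurable_funM (@symb_meas R _) (T0_meas iK).
have LTK : L2 mu (fun p => symb (1 - s1) p * T0 K p) := L2_ae mTK EwK (HT_L2 LwK).
have QT : n2 mu (fun p => symb (1 - s1) p * T0 K p) <= L2norm (fraclap (1 - s1) K).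
  by rewrite QE -(HT_iso LwK) (ae_n2 (HT_L2 LwK) LTK EwK).
have K1E : L1norm K = \int[mu]_x `|K x|.
  by rewrite /L1norm Lnorm1.
pose H := H_const s1 M K u0.
(* Positivity of [Q] makes the square root, hence [H], positive; only then does the bound on [eps]
   amount to [eps * H <= rho]. *)
have H0 : 0 < H.
  have p0 := @pi_gt0 R; rewrite /H /H_const -/n0 -/N; apply: mulr_gt0.
    by rewrite !mulr_gt0 ?exprn_gt0.
  rewrite sqrtr_gt0 ltr_wpDl//; last by rewrite divr_gt0// exprn_gt0.
  apply: divr_ge0.
    by apply: mulr_ge0; [apply: mulr_ge0 => //; exact: sqr_ge0|exact: powR_ge0].
  by rewrite !mulr_ge0 ?powR_ge0.
have epsH' : eps * H <= rho by rewrite -ler_pdivlMr.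
(* One estimate for two purposes: [d := N] gives norm at most [eps * H], so images stay in the ball,
   and [d] equal to the distance of two points gives the Lipschitz bound. *)
have bound (G : R3 R -> R) B d : mu.-integrable setT (EFin \o G) -> L2 mu G ->
    (forall x, `|G x| <= B) -> 0 <= d -> \int[mu]_x `|G x| <= M * N * d -> n2 mu G <= M * d ->
    L2 mu (fun p => h2w p * solhat s1 s2 (fun x => eps * conv3 K G x) p) /\
    n2 mu (fun p => h2w p * solhat s1 s2 (fun x => eps * conv3 K G x) p) <= eps * H / N * d.
  move=> iG LG GB d0 G1 G2.
  have [L Ln] := solhat_norm s1r s20 iK iG LG GB N0 (ltW M_gt0) d0 G1 G2 LTK QT.
  have ic := conv_intg iK iG GB.
  rewrite (_ : (fun p => h2w p * solhat s1 s2 (fun x => eps * conv3 K G x) p) =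
     (fun p => eps * (h2w p * solhat s1 s2 (conv3 K G) p))); last first.
    by apply/funext => p; rewrite solhatZ// mulrCA.
  split; first exact: L2Z.
  rewrite (n2Z eps L) (gtr0_norm eps0) -!mulrA ler_wpM2l ?(ltW eps0)//.
  by apply: le_trans Ln _; rewrite /H /H_const -/n0 -/N K1E -!mulrA.
pose w v := fun x => u0 x + v x : R.
pose G v := gc a g (w v).
have Hw v : H2_ball rho v -> H2s 1 (w v) /\ H2s_norm 1 (w v) <= N.
  move=> [Hv nv]; have [Hs ns] := H2D Hu0 Hv; split => //.
  by apply: le_trans ns _; rewrite lerD2l (le_trans nv).
(* [a] equals c_e (n0 + 1) and the H^2 norm of u0 + v is at most n0 + 1, so by the Sobolev bound
   [clamp] changes nothing almost everywhere. *)
have wa v : H2_ball rho v -> \forall x \ae mu, clamp a (w v x) = w v x.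
  move=> /Hw[Hs ns]; apply: filterS (sobolev_ae c_e_sobolev Hs) => x h.
  rewrite clamp_id//; apply: le_trans h _.
  by rewrite /a -[X in _ + X]mulr1 -mulrDr ler_wpM2l// ltW.
have rhsE v : H2_ball rho v -> rhs eps K g u0 v = (fun x => eps * conv3 K (G v) x).
  move=> Bv; apply/funext => x; rewrite /rhs; congr (_ * _ x).
  apply: conv3_ae; apply: filterS (wa v Bv) => y h _.
  by rewrite /G /gc h.
have nw v : H2_ball rho v -> n2 mu (w v) <= N.
  by move=> /Hw[Hs ns]; apply: le_trans (n2_le_H2 Hs) _.
have Gs v : H2_ball rho v -> [/\ mu.-integrable setT (EFin \o G v), L2 mu (G v),
    (forall x, `|G v x| <= 2 * M), \int[mu]_x `|G v x| <= M * N * N & n2 mu (G v) <= M * N].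
  by move=> Bv; have [Hs _] := Hw v Bv; exact: (gc_single a0 M_gt0 gD g0 dg0 (H2_L2 Hs) (nw v Bv)).
pose T v := HT (solhat s1 s2 (rhs eps K g u0 v)).
have sol v : H2_ball rho v -> [/\ H2_ball rho (T v),
    HT (T v) = solhat s1 s2 (rhs eps K g u0 v) %[ae mu],
    solves s1 s2 (rhs eps K g u0 v) (T v) &
    forall u, solves s1 s2 (rhs eps K g u0 v) u -> u = T v %[ae mu]].
  move=> Bv; have [iG LG GB G1 G2] := Gs v Bv.
  have [L Ln] := bound _ _ N iG LG GB (ltW N0) G1 G2.
  have ic := intgZ eps (conv_intg iK iG GB); have Lc := L2Z eps (conv_L2 iK iG GB).
  rewrite /T (rhsE v Bv).
  have [h1 h2 h3 h4 h5] := solhat_solves s12r s21 ic Lc L.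
  split; [split; first exact: h1|exact: h3|exact: h4|exact: h5].
  by rewrite h2; apply: le_trans Ln _; rewrite divfK// gt_eqF.
have dist_T v1 v2 : H2_ball rho v1 -> H2_ball rho v2 ->
    H2s_norm 1 (fun x => T v1 x - T v2 x) <= rho / N * H2s_norm 1 (fun x => v1 x - v2 x).
  move=> B1 B2; have [[HT1 _] E1 _ _] := sol v1 B1; have [[HT2 _] E2 _ _] := sol v2 B2.
  have [Hv1 _] := B1; have [Hv2 _] := B2.
  have [iG1 LG1 GB1 _ _] := Gs v1 B1; have [iG2 LG2 GB2 _ _] := Gs v2 B2.
  have [Hw1 _] := Hw v1 B1; have [Hw2 _] := Hw v2 B2.
  have [Hd _] := H2B Hv1 Hv2.
  set d := H2s_norm 1 (fun x => v1 x - v2 x).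
  have nd : n2 mu (fun x => clamp a (w v1 x) - clamp a (w v2 x)) <= d.
    apply: le_trans (n2_le_H2 Hd); rewrite le_eqVlt; apply/orP; left; apply/eqP.
    apply: ae_n2; [|exact: H2_L2|].
      by apply: L2B; [have [] := clamp_L2 a (H2_L2 Hw1)|have [] := clamp_L2 a (H2_L2 Hw2)].
    apply: filterS2 (wa v1 B1) (wa v2 B2) => x h1 h2 _.
    by rewrite h1 h2 /w; ring.
  have [iD LD DB D1 D2] := gc_diff a0 M_gt0 gD g0 dg0 (H2_L2 Hw1) (H2_L2 Hw2) (nw _ B1) (nw _ B2) nd.
  have [L Ln] := bound _ _ d iD LD DB (H2_norm_ge0 _) D1 D2.
  have [_ ->] := H2B HT1 HT2.
  have LhT := L2B (H2_wL2 HT1) (H2_wL2 HT2).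
  (* The division by the symbol and the convolution are linear, so the difference of two images is
     the solution for the single source [G v1 - G v2]. *)
  have E : (fun p => h2w p * HT (T v1) p - h2w p * HT (T v2) p) =
      (fun p => h2w p * solhat s1 s2 (fun x => eps * conv3 K (fun x => G v1 x - G v2 x) x) p) %[ae mu].
    rewrite (rhsE v1 B1) in E1; rewrite (rhsE v2 B2) in E2.
    have i1 := intgZ eps (conv_intg iK iG1 GB1); have i2 := intgZ eps (conv_intg iK iG2 GB2).
    have key (t x1 x2 y1 y2 : R) : x1 = y1 -> x2 = y2 -> t * x1 - t * x2 = t * (y1 - y2).
      by move=> -> ->; rewrite mulrBr.
    apply: filterS2 E1 E2 => p h1 h2 _.
    apply: etrans (key _ _ _ _ _ (h1 Logic.I) (h2 Logic.I)) _.
    rewrite -(solhatB s1 s2 p i1 i2); congr (_ * solhat s1 s2 _ p).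
    apply/funext => x; rewrite -mulrBr; congr (_ * _).
    rewrite /conv3 -(RintB (conv_int1 iK iG1 GB1 x) (conv_int1 iK iG2 GB2 x)).
    by apply: eq_Rint => y; rewrite mulrBr.
  rewrite (ae_n2 LhT L E); apply: le_trans Ln _.
  by rewrite ler_wpM2r ?H2_norm_ge0// ler_wpM2r// invr_ge0 ltW.
(* Strictness comes from rho <= 1 < n0 + 1, where n0 > 0 because f is nontrivial. *)
have q01 : 0 <= rho / N < 1.
  rewrite divr_ge0 ?(ltW rho0) ?(ltW N0)//= ltr_pdivrMr// mul1r.
  by apply: le_lt_trans rho1 _; rewrite ltrDr.
have TB v : H2_ball rho v -> H2_ball rho (T v) by move=> /sol[].
have [up Bup Tup] := banach rho0 q01 TB dist_T.
have uniq v : H2_ball rho v -> T v = v %[ae mu] -> v = up %[ae mu].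
  move=> Bv Tv.
  have [Hv _] := Bv; have [Hp _] := Bup; have [HTv _] := TB v Bv; have [HTp _] := TB up Bup.
  apply: (H2_dist0 Hv Hp).
  have := dist_T v up Bv Bup.
  have [Hd Ed] := H2B Hv Hp; have [HdT EdT] := H2B HTv HTp.
  have -> : H2s_norm 1 (fun x => T v x - T up x) = H2s_norm 1 (fun x => v x - up x).
    have LHd := H2_L2 Hd; have LHdT := H2_L2 HdT.
    rewrite !H2_normE//; apply: ae_n2; [exact: H2_wL2|exact: H2_wL2|].
    have : HT (fun x => T v x - T up x) = HT (fun x => v x - up x) %[ae mu].
      apply: HT_ae => //; apply: filterS2 Tv Tup => x h1 h2 _.
      by rewrite h1// h2.
    by apply: filterS => p h _; rewrite h.
  have := H2_norm_ge0 (fun x => v x - up x); move: q01 => /andP[q0 q1].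
  set D := H2s_norm _ _ => D0 DD; apply/eqP; rewrite eq_le D0 andbT leNgt; apply/negP => Dp.
  by move: DD; rewrite leNgt gtr_pMl// q1.
(* The equation holds for [T up] with right-hand side built from [up]; since both agree almost
   everywhere, it transfers to [up] through the Hartley characterisation. *)
have solup : solves s1 s2 (rhs eps K g u0 up) up.
  have [BT _ _ _] := sol up Bup; have [iG LG GB _ _] := Gs up Bup.
  have Lr : L2 mu (rhs eps K g u0 up).
    by rewrite (rhsE up Bup); exact: L2Z (conv_L2 iK iG GB).
  have [_ _ sT _] := sol up Bup; have [HsT ET] := (solvesP (T up) s1l Lr).1 sT.
  have [LTu LsT] := (H2sP s2 _).1 HsT; have Lup := H2_L2 Bup.1.
  have EH := HT_ae LTu Lup Tup.
  apply/(solvesP _ s1l Lr); split.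
    apply/H2sP; split => //; apply: L2_ae LsT.
      by have [mH _] := HT_L2 Lup; exact: measurable_funM (@symb_meas R s2) mH.
    by apply: filterS EH => p h _; rewrite h.
  by apply: filterS2 ET EH => p h1 h2 _; rewrite h1// h2.
exists T; split.
- by move=> v Bv; have [h1 _ h3 h4] := sol v Bv.
- by exists (rho / N).
exists up; split; [exact: Bup|exact: Tup|exact: uniq|exact: solup|].
move=> v Bv sv; apply: (uniq v Bv).
(* A solution of the nonlinear equation solves the linear problem with its own source, so linear
   uniqueness makes it a fixed point. *)
have [_ _ _ h] := sol v Bv.
by apply: filterS (h v sv) => x hx _; rewrite hx.
Qed.
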